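(* Let $V$ be an operator space. Then $V$ has the weak expectation property (WEP) if and only if for every Hilbert space $\mathcal H$ and for every (linear) complete isometry $\varphi: V\to B(\mathcal H)$, the subspace $\varphi(V)\subseteq B(\mathcal H)$ has a weak expectation.
   Context: An operator space $X\subseteq B(\mathcal H)$ has a weak expectation if there is a completely contractive map from $B(\mathcal H)$ into the weak*-closure of $X$ that is the identity on $X$. An operator space $V$ has the weak expectation property (WEP) if there exists a completely isometric embedding of the injective envelope $I(V)$ into $V^{**}$ that is the identity on $V$ (with $V\subseteq V^{**}$ canonically). Here $I(V)$ is the injective envelope of the operator space $V$ in the sense of Hamana and Ruan: an injective operator space containing $V$ that is a rigid extension (the only completely contractive self-map fixing $V$ is the identity) and an essential extension (any completely contractive map on $I(V)$ that is a complete isometry on $V$ is a complete isometry). *)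

(* Defs.v *)
From HB Require Import structures.
From mathcomp Require Import all_boot all_order all_algebra.
From mathcomp Require Import sesquilinear complex.
From mathcomp Require Import all_classical all_reals all_analysis.

Set Implicit Arguments.
Unset Strict Implicit.
Unset Printing Implicit Defensive.

Import Order.TTheory GRing.Theory Num.Theory.
Import numFieldNormedType.Exports.

Local Open Scope classical_set_scope.
Local Open Scope complex_scope.
Local Open Scope ring_scope.

(* The norm of a normed module over [R[i]] takes its values in [R[i]];
   [nrm x] is the same number, seen in [R]. *)
Definition nrm (R : realType) (E : normedModType R[i]) (x : E) : R :=
  complex.Re `|x|.

(* The Euclidean norm. The library's norm on matrices is the sup norm. *)
Definition l2norm (R : realType) (m : nat) (x : 'cV[R[i]]_m) : R :=
  Num.sqrt (\sum_i nrm (x i 0 : R[i]^o) ^+ 2).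

(* For [E] with Hilbertian norm [N], the norm of the operator matrix [T]
   acting on the Hilbert space direct sum of [n] copies of [E]. *)
Definition ampl_norm (R : realType) (E : nmodType) (N : E -> R) (n : nat)
    (T : 'I_n -> 'I_n -> E -> E) : R :=
  sup [set r | exists2 x : 'I_n -> E, \sum_j N (x j) ^+ 2 <= 1 &
    r = Num.sqrt (\sum_i N (\sum_j T i j (x j)) ^+ 2)].

HB.mixin Record Lmodule_hasMxNorm (R : realType) V
    of GRing.Lmodule R[i] V := {
  mxnorm : forall n : nat, 'M[V]_n -> R
}.

#[short(type="mxNormedType")]
HB.structure Definition MxNormed (R : realType) :=
  {V of GRing.Lmodule R[i] V & Lmodule_hasMxNorm R V}.

Arguments mxnorm {R s n} _.

Definition complete_contraction (R : realType) (V W : mxNormedType R)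
    (f : V -> W) :=
  forall (n : nat) (v : 'M[V]_n), mxnorm (map_mx f v) <= mxnorm v.

Definition complete_isometry (R : realType) (V W : mxNormedType R)
    (f : V -> W) :=
  forall (n : nat) (v : 'M[V]_n), mxnorm (map_mx f v) = mxnorm v.

Definition cbnorm (R : realType) (V W : mxNormedType R) (f : V -> W) : R :=
  sup [set r | exists n (v : 'M[V]_n),
    mxnorm v <= 1 /\ r = mxnorm (map_mx f v)].

(* [M_m] is normed as [B(C^m)], [C^m] being Euclidean. *)
HB.instance Definition _ (R : realType) (m : nat) :=
  Lmodule_hasMxNorm.Build R 'M[R[i]]_m
    (fun n (A : 'M['M[R[i]]_m]_n) =>
       ampl_norm (@l2norm R m) (fun i j => mulmx (A i j))).

HB.mixin Record NormedModule_hasInner (R : realType) H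
    of NormedModule R[i] H := {
  inner : {dot H for @Num.conj R[i]} ;
  inner_norm : forall x : H, inner x x = `|x| ^+ 2
}.

#[short(type="hilbertType")]
HB.structure Definition Hilbert (R : realType) :=
  {H of CompleteNormedModule R[i] H & NormedModule_hasInner R H}.

Section BoundedOperators.
Context (R : realType) (H : hilbertType R).

Definition bounded_operator : {pred H -> H} :=
  [pred T | `[< linear T /\ continuous T >]].

Lemma bounded_operator_submod : submod_closed bounded_operator.
Proof.
split=> [|a S T /asboolP[linS cS] /asboolP[linT cT]]; apply/asboolP; split.
- by move=> a x y /=; rewrite scaler0 addr0.
- exact: cst_continuous.
- have E x : (a *: S + T) x = a *: S x + T x by [].
  move=> b x y; rewrite !E linS linT !scalerDr !scalerA [a * b]mulrC.
  by rewrite addrACA.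
- move=> x; apply: continuousD; last exact: cT.
  by apply: continuousZl_tmp; exact: cS.
Qed.

HB.instance Definition _ :=
  GRing.isSubmodClosed.Build R[i] (H -> H) bounded_operator
    bounded_operator_submod.

Record bop := BOp { bop_fun :> H -> H ; _ : bop_fun \in bounded_operator }.

HB.instance Definition _ := [isSub for bop_fun].
HB.instance Definition _ := [Choice of bop by <:].
HB.instance Definition _ := [SubChoice_isSubLmodule of bop by <:].

HB.instance Definition _ := Lmodule_hasMxNorm.Build R bop
  (fun n (T : 'M[bop]_n) => ampl_norm (@nrm R H) (fun i j => T i j)).

End BoundedOperators.

Section WeakStar.
Context (R : realType) (H : hilbertType R).

Definition l2seq (x : nat -> H) : Prop :=
  cvgn (series (fun k => nrm (x k) ^+ 2)).

(* Square summable [x], [y] parametrize the trace class operators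
   [\sum_k |x_k><y_k|], that is, the elements of the predual of [B(H)];
   [normal_functional] is the corresponding duality pairing. *)
Definition normal_index : Type :=
  {xy : (nat -> H) * (nat -> H) | l2seq xy.1 /\ l2seq xy.2}.

Definition normal_functional (T : bop H) (w : normal_index) : R[i]^o :=
  limn (fun n : nat =>
    (\sum_(0 <= k < n) inner (T ((sval w).1 k)) ((sval w).2 k) : R[i]^o)).

Definition weak_star_bop : topologicalType :=
  initial_topology
    (normal_functional : bop H -> {ptws normal_index -> R[i]^o}).

Definition weak_star_closure (X : set (bop H)) : set (bop H) :=
  closure (X : set weak_star_bop).

Definition has_weak_expectation (X : set (bop H)) : Prop :=
  exists E : {linear bop H -> bop H},
    [/\ complete_contraction E,
        forall T, weak_star_closure X (E T)
      & forall T, X T -> E T = T].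

End WeakStar.

(* An operator space is a linear subspace of some [B(H)] with the inherited
   matrix norms. Norm closedness is not required. *)
HB.mixin Record MxNormed_isOpSpace (R : realType) V of MxNormed R V := {
  opspace_concrete : exists (H : hilbertType R) (j : {linear V -> bop H}),
    injective j /\ complete_isometry j
}.

#[short(type="opSpaceType")]
HB.structure Definition OpSpace (R : realType) :=
  {V of MxNormed R V & MxNormed_isOpSpace R V}.

Section BopOpSpace.
Context (R : realType) (H : hilbertType R).

Lemma bop_concrete : exists (K : hilbertType R) (j : {linear bop H -> bop K}),
  injective j /\ complete_isometry j.
Proof. by exists H, idfun; split=> // n v; rewrite map_mx_id. Qed.

HB.instance Definition _ := MxNormed_isOpSpace.Build R (bop H) bop_concrete.

End BopOpSpace.

Section Dual.
Context (R : realType) (V : mxNormedType R).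

Definition bounded_functional : {pred V -> R[i]^o} :=
  [pred f | `[< linear f /\
    exists c : R, forall v, nrm (f v) <=
                            c * mxnorm (const_mx v : 'M[V]_1) >]].

Lemma bounded_functional_submod : submod_closed bounded_functional.
Proof.
have nrmE (x : R[i]^o) : `|x| = (nrm x)%:C by [].
have nrmD (x y : R[i]^o) : nrm (x + y) <= nrm x + nrm y.
  by rewrite -lecR rmorphD -!nrmE ler_normD.
have nrmZ (a : R[i]) (x : R[i]^o) : nrm (a *: x) = nrm (a : R[i]^o) * nrm x.
  by apply: (@complexI R); rewrite rmorphM -!nrmE normrM.
split=> [|a f g /asboolP[linf [c fc]] /asboolP[ling [d gd]]]; apply/asboolP.
  split; first by move=> a x y /=; rewrite scaler0 addr0.
  by exists 0 => v; rewrite mul0r /nrm normr0.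
have E x : (a *: f + g) x = a *: f x + g x by [].
split=> [b x y|].
  by rewrite !E linf ling !scalerDr !scalerA [a * b]mulrC addrACA.
exists (nrm (a : R[i]^o) * c + d) => v; rewrite E (le_trans (nrmD _ _))//.
rewrite mulrDl lerD// nrmZ -mulrA ler_wpM2l//.
have := normr_ge0 (a : R[i]^o).
by rewrite nrmE ler0c.
Qed.

HB.instance Definition _ :=
  GRing.isSubmodClosed.Build R[i] (V -> R[i]^o) bounded_functional
    bounded_functional_submod.

Record dual := Dual {
  dual_fun :> V -> R[i]^o ; _ : dual_fun \in bounded_functional }.

HB.instance Definition _ := [isSub for dual_fun].
HB.instance Definition _ := [Choice of dual by <:].
HB.instance Definition _ := [SubChoice_isSubLmodule of dual by <:].

(* [M_n] of the dual of [V] is [CB(V, M_n)], with the cb norm. *)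
HB.instance Definition _ := Lmodule_hasMxNorm.Build R dual
  (fun n (f : 'M[dual]_n) =>
     cbnorm (fun v : V => (\matrix_(i, j) f i j v) : 'M[R[i]]_n)).

End Dual.

Section InjectiveEnvelope.
Context (R : realType).

Definition injective_opspace (I : opSpaceType R) : Prop :=
  forall (X Y : opSpaceType R) (i : {linear X -> Y}) (f : {linear X -> I}),
    complete_isometry i -> complete_contraction f ->
    exists2 g : {linear Y -> I}, complete_contraction g & g \o i =1 f.

Definition rigid_extension (V E : opSpaceType R) (i : V -> E) : Prop :=
  forall f : {linear E -> E},
    complete_contraction f -> f \o i =1 i -> f =1 id.

Definition essential_extension (V E : opSpaceType R) (i : V -> E) : Prop :=
  forall (W : opSpaceType R) (f : {linear E -> W}),
    complete_contraction f -> complete_isometry (f \o i) ->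
    complete_isometry f.

Definition injective_envelope (V E : opSpaceType R) (i : {linear V -> E}) :
    Prop :=
  [/\ complete_isometry i, injective_opspace E,
      rigid_extension i & essential_extension i].

(* The injective envelope is unique up to a complete isometry fixing [V], so
   it does not matter which one is used. The canonical embedding of [V] into
   its bidual sends [v] to evaluation at [v], hence the last clause. *)
Definition WEP (V : opSpaceType R) : Prop :=
  exists (E : opSpaceType R) (i : {linear V -> E})
         (j : {linear E -> dual (dual V)}),
    [/\ injective_envelope i, complete_isometry j
      & forall (v : V) (f : dual V), j (i v) f = f v].

End InjectiveEnvelope.

(* Main.v *)
(* WEP gives weak expectations: extend [V -> I(V)] along [V -> B(H)] by
   injectivity, embed [I(V)] in [V**], and return to [B(H)] by the operator [T]
   with [<T x, y> = xi (v |-> <phi v x, y>)]; on finitely many functionals an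
   element of [V**] agrees with a vector of [V], so [T] lies in the weak*
   closure of [phi(V)].

   Conversely, take for [phi] the direct sum of all completely contractive maps
   from [V] to matrix algebras. It factors through the l-infinity product [W] of
   these algebras, which is injective by the Arveson-Wittstock theorem, and by
   Hamana's argument [I(V)] sits in [W], as the range of a projection minimal
   among the completely contractive self-maps of [W] that fix [V]. Every
   functional on [V] of norm at most 1, indeed every completely contractive map
   [V -> M_m], is a compression of [phi] to a coordinate block, so an operator in
   the weak* closure of [phi(V)] extends it canonically; applied to the image of
   [I(V)] under the weak expectation this embeds [I(V)] in [V**]. The embedding
   is isometric since [V -> I(V)] is essential. *)

From HB Require Import structures.
Require Import Defs.
From mathcomp Require Import all_boot all_order all_algebra.
From mathcomp Require Import sesquilinear spectral.
From mathcomp Require Import all_classical all_reals all_analysis.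
From mathcomp Require Import complex ring lra.

Set Implicit Arguments.
Unset Strict Implicit.
Unset Printing Implicit Defensive.

Import Order.TTheory GRing.Theory Num.Theory.
Import numFieldNormedType.Exports.

Local Open Scope classical_set_scope.
Local Open Scope complex_scope.
Local Open Scope ring_scope.

(** Every matrix norm is handled through one inequality: [mxnorm T <= c] means that the real part of
    [<T x, y>] is at most [c] times half the sum of the squares of [x] and [y]. It is linear in [T]
    and additive over orthogonal pieces, so block sums, direct sums, averages, limits and
    compressions each take one step. The representation has to be universal because an operator in
    the weak* closure of [phi(V)] carries information only about those functionals on [V] that are
    restrictions of normal ones. To land in the bidual, every functional must be of this kind, and
    to control matrix norms, every contractive matrix of functionals must be one compression. The
    product of matrix algebras replaces [B(H)] because extension then reduces to a
    finite-dimensional target, where Hahn-Banach suffices, and because bounded families of maps into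
    it converge entrywise along ultrafilters. The duals are only matrix normed spaces here. Their
    norms are suprema, which must be shown finite before they can be used. *)

Local Notation re := (@complex.Re _).
Local Notation im := (@complex.Im _).

(** * Complex scalars and inner products *)

Section ComplexNumbers.
Context (R : realType).
Implicit Types (z w : R[i]) (t : R).

Lemma re_real t : re t%:C = t.
Proof. by []. Qed.

Lemma re0 : re (0 : R[i]) = 0.
Proof. by []. Qed.

Lemma reD z w : re (z + w) = re z + re w.
Proof. by case: z; case: w. Qed.

Lemma imD z w : im (z + w) = im z + im w.
Proof. by case: z; case: w. Qed.

Lemma reN z : re (- z) = - re z.
Proof. by case: z. Qed.

Lemma reB z w : re (z - w) = re z - re w.
Proof. by rewrite reD reN. Qed.

Lemma reM z w : re (z * w) =
  re z * re w - im z * im w.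
Proof. by case: z; case: w. Qed.

Lemma imM z w : im (z * w) =
  re z * im w + im z * re w.
Proof. by case: z; case: w. Qed.

Lemma reZ t z : re (t%:C * z) = t * re z.
Proof. by rewrite reM /= mul0r subr0. Qed.

Lemma re_sum I (r : seq I) (P : pred I) (F : I -> R[i]) :
  re (\sum_(i <- r | P i) F i) = \sum_(i <- r | P i) re (F i).
Proof. exact: (big_morph _ reD). Qed.

Lemma im_sum I (r : seq I) (P : pred I) (F : I -> R[i]) :
  im (\sum_(i <- r | P i) F i) = \sum_(i <- r | P i) im (F i).
Proof. exact: (big_morph _ imD). Qed.

Lemma complex_eqP z w :
  re z = re w -> im z = im w -> z = w.
Proof. by case: z => a b; case: w => c d /= -> ->. Qed.

(** [Num.conj] is known through [z * conj z = |z|^2], from which a nonzero [z] cancels. *)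
Lemma conjE z : Num.conj z = conjc z.
Proof.
have [->|z0] := eqVneq z 0; first by rewrite conjC0 conjc0.
apply: (mulfI z0); rewrite -normCK -add_Re2_Im2.
by case: z {z0} => a b; apply: complex_eqP => /=; ring.
Qed.

Lemma re_conj z : re (Num.conj z) = re z.
Proof. by rewrite conjE; case: z. Qed.

Lemma im_conj z : im (Num.conj z) = - im z.
Proof. by rewrite conjE; case: z. Qed.

Lemma conj_real t : Num.conj t%:C = t%:C.
Proof. by rewrite conjE conjc_real. Qed.

End ComplexNumbers.

Section Nrm.
Context (R : realType) (E : normedModType R[i]).
Implicit Types (x y : E) (a : R[i]).

Lemma nrmE x : `|x| = (nrm x)%:C.
Proof.
apply: complex_eqP => //=.
exact: ger0_Im.
Qed.

Lemma nrm_ge0 x : 0 <= nrm x.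
Proof. by rewrite -ler0c -nrmE. Qed.

Lemma nrmD x y : nrm (x + y) <= nrm x + nrm y.
Proof. by have := ler_normD x y; rewrite !nrmE -rmorphD lecR. Qed.

Lemma nrmN x : nrm (- x) = nrm x.
Proof. by rewrite /nrm normrN. Qed.

Lemma nrmB x y : nrm (x - y) <= nrm x + nrm y.
Proof. by rewrite -[nrm y]nrmN; exact: nrmD. Qed.

Lemma nrm0 : nrm (0 : E) = 0.
Proof. by rewrite /nrm normr0. Qed.

Lemma nrm_eq0 x : nrm x = 0 -> x = 0.
Proof. by move=> x0; apply/normr0_eq0; rewrite nrmE x0. Qed.

Lemma nrmZ a x : nrm (a *: x) = nrm (a : R[i]^o) * nrm x.
Proof. by apply: (@complexI R); rewrite rmorphM -!nrmE normrZ nrmE. Qed.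

Lemma nrm_sum I (r : seq I) (P : pred I) (F : I -> E) :
  nrm (\sum_(i <- r | P i) F i) <= \sum_(i <- r | P i) nrm (F i).
Proof.
elim/big_rec2: _ => [|i y x _ h]; first by rewrite nrm0.
by rewrite (le_trans (nrmD _ _))// lerD2l.
Qed.

End Nrm.

Section NrmC.
Context (R : realType).
Implicit Types (z w : R[i]) (t : R).

Lemma sqr_nrmC z :
  nrm (z : R[i]^o) ^+ 2 = re z ^+ 2 + im z ^+ 2.
Proof.
by have := add_Re2_Im2 z; rewrite (nrmE (z : R[i]^o)) -rmorphXn => /complexI.
Qed.

Lemma nrmC_real t : nrm (t%:C : R[i]^o) = `|t|.
Proof.
apply/eqP; rewrite -(eqrXn2 (n := 2)) ?nrm_ge0// sqr_nrmC/= real_normK//.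
  by rewrite expr0n addr0.
exact: num_real.
Qed.

Lemma nrmCM z w :
  nrm (z * w : R[i]^o) = nrm (z : R[i]^o) * nrm (w : R[i]^o).
Proof. exact: nrmZ. Qed.

Lemma nrmC_conj z : nrm (Num.conj z : R[i]^o) = nrm (z : R[i]^o).
Proof.
apply/eqP; rewrite -(eqrXn2 (n := 2)) ?nrm_ge0// !sqr_nrmC re_conj im_conj.
by rewrite sqrrN.
Qed.

Lemma re_le_nrm z : re z <= nrm (z : R[i]^o).
Proof.
rewrite (le_trans (ler_norm _))// -(ler_pXn2r (n := 2)) ?nnegrE ?nrm_ge0//.
by rewrite sqr_nrmC real_normK ?num_real// lerDl sqr_ge0.
Qed.

Lemma mulC_conj z : z * Num.conj z = (nrm (z : R[i]^o) ^+ 2)%:C.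
Proof. by rewrite -normCK (nrmE (z : R[i]^o)) rmorphXn. Qed.

Lemma polarize z : exists w, nrm (w : R[i]^o) = 1 /\
  w * z = (nrm (z : R[i]^o))%:C.
Proof.
have [->|z0] := eqVneq z 0.
  by exists 1; rewrite mulr0 nrm0 /nrm normr1.
have nz : nrm (z : R[i]^o) != 0.
  by apply: contra_neq z0 => /nrm_eq0.
exists ((nrm (z : R[i]^o))^-1%:C * Num.conj z); split.
  rewrite nrmCM nrmC_conj nrmC_real ger0_norm ?invr_ge0 ?nrm_ge0//.
  by rewrite mulVf.
rewrite -mulrA [_ * z]mulrC mulC_conj -rmorphM; congr (_%:C).
by rewrite expr2 mulrA mulVf// mul1r.
Qed.

(** Rotation by a unit scalar turns real-part estimates, the form of all norm tests below, into
    estimates of the modulus. *)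
Lemma nrm_leP z t :
  (forall w, nrm (w : R[i]^o) = 1 -> re (w * z) <= t) ->
  nrm (z : R[i]^o) <= t.
Proof. by move=> h; have [w [/h + wz]] := polarize z; rewrite wz. Qed.

End NrmC.

Section InnerProduct.
Context (R : realType) (H : hilbertType R).
Implicit Types (x y : H) (a : R[i]).

Lemma innerDl y x x' : inner (x + x') y = inner x y + inner x' y.
Proof. exact: linearDl. Qed.

Lemma innerDr x y y' : inner x (y + y') = inner x y + inner x y'.
Proof. exact: linearDr. Qed.

Lemma innerBl y x x' : inner (x - x') y = inner x y - inner x' y.
Proof. exact: linearBl. Qed.

Lemma innerZl a x y : inner (a *: x) y = a * inner x y.
Proof. exact: linearZl_LR. Qed.

Lemma innerZr a x y : inner x (a *: y) = Num.conj a * inner x y.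
Proof. exact: linearZr_LR. Qed.

Lemma inner0l y : inner 0 y = 0 :> R[i].
Proof. exact: linear0l. Qed.

Lemma inner0r x : inner x 0 = 0 :> R[i].
Proof. exact: linear0r. Qed.

Lemma inner_suml y I (r : seq I) (P : pred I) (F : I -> H) :
  inner (\sum_(i <- r | P i) F i) y = \sum_(i <- r | P i) inner (F i) y.
Proof. exact: linear_sumlz. Qed.

Lemma inner_sumr x I (r : seq I) (P : pred I) (F : I -> H) :
  inner x (\sum_(i <- r | P i) F i) = \sum_(i <- r | P i) inner x (F i).
Proof. exact: linear_sumr. Qed.

Lemma innerC x y : inner x y = Num.conj (inner y x).
Proof. by rewrite hermC expr0 mul1r. Qed.

Lemma innerxx x : inner x x = (nrm x ^+ 2)%:C.
Proof. by rewrite inner_norm nrmE rmorphXn. Qed.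

End InnerProduct.

(** * Norms from real inner products, and norms of operator matrices over them *)

Section RealInnerProduct.
Context (R : realType) (E : lmodType R[i]) (N : E -> R) (ip : E -> E -> R).
Hypothesis N_ge0 : forall x, 0 <= N x.
Hypothesis N_eq0 : forall x, N x = 0 -> x = 0.
Hypothesis ipDl : forall y x x', ip (x + x') y = ip x y + ip x' y.
Hypothesis ipZl : forall t x y, ip (t%:C *: x) y = t * ip x y.
Hypothesis ipC : forall x y, ip x y = ip y x.
Hypothesis ipxx : forall x, ip x x = N x ^+ 2.

Lemma ip0l y : ip 0 y = 0.
Proof. by rewrite -(scale0r (0 : E)) -(rmorph0 (real_complex R)) ipZl mul0r. Qed.

Lemma ipDr x y y' : ip x (y + y') = ip x y + ip x y'.
Proof. by rewrite (ipC x (y + y')) ipDl !(ipC _ x). Qed.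

Lemma ipZr t x y : ip x (t%:C *: y) = t * ip x y.
Proof. by rewrite (ipC x (_ *: _)) ipZl (ipC y). Qed.

Lemma NZ t x : 0 <= t -> N (t%:C *: x) = t * N x.
Proof.
move=> t0; apply/eqP; rewrite -(eqrXn2 (n := 2)) ?mulr_ge0//.
by rewrite -ipxx ipZl ipZr ipxx exprMn mulrA expr2.
Qed.

Lemma N0 : N 0 = 0.
Proof. by rewrite -(scale0r (0 : E)) -(rmorph0 (real_complex R)) NZ// mul0r. Qed.

(** The expansion of the square of [N (s x + t y)]. Cauchy-Schwarz, AM-GM and the weighted estimate
    in [ampl_normP] are choices of [s] and [t]. *)
Lemma ip_lin_ge0 s t x y :
  0 <= s ^+ 2 * N x ^+ 2 + (s * t * ip x y) *+ 2 + t ^+ 2 * N y ^+ 2.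
Proof.
rewrite (le_trans (sqr_ge0 (N (s%:C *: x + t%:C *: y))))//.
rewrite -(ipxx (_ + _)) ipDl !ipDr !ipZl !ipZr !ipxx (ipC y x) le_eqVlt; apply/orP; left.
by apply/eqP; ring.
Qed.

Lemma ip_CS x y : ip x y <= N x * N y.
Proof.
have [Nx0|Nx0] := eqVneq (N x) 0; first by rewrite (N_eq0 Nx0) ip0l N0 mul0r.
have [Ny0|Ny0] := eqVneq (N y) 0.
  by rewrite (N_eq0 Ny0) ipC ip0l N0 mulr0.
have p : 0 < N x * N y by rewrite mulr_gt0// lt_def N_ge0 ?Nx0 ?Ny0.
rewrite -(ler_pM2l p); have := ip_lin_ge0 (N y) (- N x) x y; nra.
Qed.

Lemma ip_amgm x y : ip x y <= (N x ^+ 2 + N y ^+ 2) / 2.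
Proof. have := ip_lin_ge0 1 (- 1) x y; lra. Qed.

Lemma ND x y : N (x + y) <= N x + N y.
Proof.
rewrite -(ler_pXn2r (n := 2)) ?nnegrE ?addr_ge0//.
rewrite -(ipxx (_ + _)) ipDl !ipDr !ipxx (ipC y x); have := ip_CS x y; lra.
Qed.

Lemma N_sum I (r : seq I) (F : I -> E) :
  N (\sum_(i <- r) F i) <= \sum_(i <- r) N (F i).
Proof.
elim/big_rec2: _ => [|i y x _ h]; first by rewrite N0.
by rewrite (le_trans (ND _ _))// lerD2l.
Qed.

Section Amplification.
Variables (n : nat) (T : 'I_n -> 'I_n -> E -> E).
Hypothesis TZ : forall i j t x, T i j (t%:C *: x) = t%:C *: T i j x.
Hypothesis T_bounded : forall i j, exists M, forall x, N (T i j x) <= M * N x.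

Local Notation sqsum x := (\sum_j N (x j) ^+ 2).
Local Notation app x i := (\sum_j T i j (x j)).

Lemma sqsum_ge0 (x : 'I_n -> E) : 0 <= sqsum x.
Proof. by apply: sumr_ge0 => i _; rewrite sqr_ge0. Qed.

Lemma sqsum_eq0 (x : 'I_n -> E) : sqsum x = 0 -> forall j, x j = 0.
Proof.
move=> /eqP; rewrite psumr_eq0 => [/allP h j|i _]; last exact: sqr_ge0.
by apply: N_eq0; apply/eqP; have := h j (mem_index_enum j); rewrite expf_eq0.
Qed.

Lemma sqsumZ t (x : 'I_n -> E) : 0 <= t ->
  sqsum (fun j => t%:C *: x j) = t ^+ 2 * sqsum x.
Proof. by move=> t0; rewrite mulr_sumr; apply: eq_bigr => j _; rewrite NZ// exprMn. Qed.

Lemma appZ t (x : 'I_n -> E) i :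
  app (fun j => t%:C *: x j) i = t%:C *: app x i.
Proof. by rewrite scaler_sumr; apply: eq_bigr => j _; rewrite TZ. Qed.

(** The supremum in [ampl_norm] is meaningful only over a bounded set. The crude constant comes from
    row sums of the entrywise bounds. *)
Lemma app_bounded : exists M, forall x : 'I_n -> E,
  sqsum (fun i => app x i) <= M * sqsum x.
Proof.
have /choice[M hM] : forall ij : 'I_n * 'I_n, exists M : R,
    0 <= M /\ forall x, N (T ij.1 ij.2 x) <= M * N x.
  move=> [i j] /=; have [M hM] := T_bounded i j.
  exists `|M|; split=> // x; rewrite (le_trans (hM x))// ler_wpM2r//.
  exact: ler_norm.
exists (\sum_i (\sum_j M (i, j)) ^+ 2) => x.
rewrite mulr_suml ler_sum// => i _.
have M0 : 0 <= \sum_j M (i, j) by apply: sumr_ge0 => j _; have [] := hM (i, j).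
rewrite -(sqr_sqrtr (sqsum_ge0 x)) -exprMn ler_pXn2r ?nnegrE ?mulr_ge0 ?sqrtr_ge0//.
rewrite (le_trans (N_sum _ _))// mulr_suml ler_sum// => j _.
have [Mij /(_ (x j)) h] := hM (i, j); apply: (le_trans h).
rewrite ler_wpM2l// -(ler_pXn2r (n := 2)) ?nnegrE ?sqrtr_ge0//.
rewrite sqr_sqrtr ?sqsum_ge0// (bigD1 j)//= lerDl.
by apply: sumr_ge0 => k _; rewrite sqr_ge0.
Qed.

Let S := [set r | exists2 x : 'I_n -> E, sqsum x <= 1 &
    r = Num.sqrt (sqsum (fun i => app x i))].

Lemma has_sup_ampl : has_sup S.
Proof.
split.
  exists (Num.sqrt (sqsum (fun i => app (fun=> 0) i))), (fun=> 0) => //.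
  by rewrite big1// => j _; rewrite N0 expr0n.
have [M hM] := app_bounded; exists (Num.sqrt `|M|) => _ [x x1 ->].
rewrite ler_wsqrtr// (le_trans (hM x))//.
rewrite (le_trans (ler_norm _))// normrM (ger0_norm (sqsum_ge0 _)).
by rewrite -[leRHS]mulr1 ler_wpM2l.
Qed.

Lemma ampl_norm_ge0 : 0 <= ampl_norm N T.
Proof.
have h : S (Num.sqrt (sqsum (fun i => app (fun=> 0) i))).
  by exists (fun=> 0) => //; rewrite big1// => j _; rewrite N0 expr0n.
exact: le_trans (sqrtr_ge0 _) (ub_le_sup has_sup_ampl.2 h).
Qed.

Lemma ampl_norm_app (x : 'I_n -> E) :
  sqsum (fun i => app x i) <= ampl_norm N T ^+ 2 * sqsum x.
Proof.
have [x0|x0] := eqVneq (sqsum x) 0.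
  rewrite x0 mulr0 big1// => i _; rewrite big1 ?N0 ?expr0n// => j _.
  by rewrite (sqsum_eq0 x0); have := TZ i j 0 0; rewrite rmorph0 !scale0r.
have xp : 0 < sqsum x by rewrite lt_def x0 sqsum_ge0.
pose s := Num.sqrt (sqsum x).
have s0 : 0 < s by rewrite sqrtr_gt0.
have ss : s ^+ 2 = sqsum x by rewrite sqr_sqrtr// ltW.
have vs : 0 <= s^-1 by rewrite invr_ge0 ltW.
have y1 : sqsum (fun j => (s^-1)%:C *: x j) <= 1.
  by rewrite sqsumZ// -ss -exprMn mulVf ?gt_eqF// expr1n.
have /(ub_le_sup has_sup_ampl.2) : S (Num.sqrt (sqsum (fun i =>
    app (fun j => (s^-1)%:C *: x j) i))) by exists (fun j => (s^-1)%:C *: x j).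
under eq_bigr do rewrite appZ.
rewrite (sqsumZ _ vs) -/(ampl_norm N T) sqrtrM ?sqr_ge0// sqrtr_sqr ger0_norm//.
rewrite ler_pdivrMl// mulrC => h.
rewrite -ss -exprMn -[leLHS]sqr_sqrtr ?sqsum_ge0//.
by rewrite ler_pXn2r ?nnegrE ?sqrtr_ge0// mulr_ge0 ?ampl_norm_ge0// ltW.
Qed.

(* After rescaling [x] and [y], AM-GM replaces [|x| |y|] by the half-sum of
   squares, which is additive over the coordinates. *)
Lemma ampl_normP c : 0 <= c -> (ampl_norm N T <= c <-> forall x y : 'I_n -> E,
  \sum_i ip (app x i) (y i) <= c * ((sqsum x + sqsum y) / 2)).
Proof.
move=> c0; split=> [Tc x y|h].
  have h := le_trans (ampl_norm_app x) (_ : _ <= c ^+ 2 * sqsum x).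
  have {}h : sqsum (fun i => app x i) <= c ^+ 2 * sqsum x.
    apply: h; rewrite ler_wpM2r ?sqsum_ge0// ler_pXn2r ?nnegrE//.
    exact: ampl_norm_ge0.
  have [{}c0|cn] := eqVneq c 0.
    move: h; rewrite c0 expr0n !mul0r => h.
    rewrite big1// => i _; rewrite (_ : app x i = 0) ?ip0l//.
    apply: (@sqsum_eq0 (fun i => app x i)).
    by apply/eqP; rewrite eq_le h sqsum_ge0.
  have cp : 0 < c by rewrite lt_def cn.
  (* AM-GM with weights [c^-1] and [c]: they balance the two squares, as [app x] has size at most
     [c] times that of [x]. The division by [c] is why [c = 0] was treated apart. *)
  have q i : ip (app x i) (y i) <=
      (c^-1 * N (app x i) ^+ 2 + c * N (y i) ^+ 2) / 2.
    rewrite -(ler_pM2l cp); have := ip_lin_ge0 1 (- c) (app x i) (y i).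
    have := mulfV cn; set u := c^-1.
    set A := N _ ^+ 2; set B := N _ ^+ 2; set P := ip _ _.
    move=> cu; rewrite [c * (_ / 2)](_ : _ = (c * u * A + c ^+ 2 * B) / 2); last by ring.
    by rewrite cu; lra.
  apply: le_trans (ler_sum _ (fun i _ => q i)) _.
  rewrite -mulr_suml big_split/= -!mulr_sumr mulrA ler_pM2r ?invr_gt0//.
  rewrite mulrDr lerD2r -(ler_pM2l cp) mulrA mulfV// mul1r.
  by rewrite mulrA -expr2.
apply: ge_sup; first by have [] := has_sup_ampl.
move=> _ [x x1 ->].
set s := Num.sqrt _; have [->//|sn] := eqVneq s 0.
have sp : 0 < s by rewrite lt_def sn sqrtr_ge0.
have ss : s ^+ 2 = sqsum (fun i => app x i) by rewrite sqr_sqrtr ?sqsum_ge0.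
have v0 : 0 <= s^-1 by rewrite invr_ge0 ltW.
(* The optimal test vector is [app x] divided by its norm. *)
have := h x (fun i => (s^-1)%:C *: app x i).
rewrite sqsumZ// -ss -exprMn mulVf// expr1n.
under eq_bigr do rewrite ipZr ipxx.
rewrite -mulr_sumr -ss expr2 mulrA mulVf// mul1r => /le_trans; apply.
rewrite -[leRHS]mulr1 ler_wpM2l//; lra.
Qed.

End Amplification.
End RealInnerProduct.

(** * Bounded operators and their matrix norms *)

Section BoundedOps.
Context (R : realType) (H : hilbertType R).

Lemma bop_linear (T : bop H) : linear T.
Proof. by case: T => f fb /=; move/asboolP: (fb) => []. Qed.

Lemma bop_continuous (T : bop H) : continuous T.
Proof. by case: T => f fb /=; move/asboolP: (fb) => []. Qed.

Lemma bopDr (T : bop H) x y : T (x + y) = T x + T y.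
Proof. by have := bop_linear T 1 x y; rewrite !scale1r. Qed.

Lemma bop0r (T : bop H) : T 0 = 0.
Proof.
by have := bop_linear T (-1) 0 0; rewrite !scaleN1r !addNr.
Qed.

Lemma bopZr (T : bop H) a x : T (a *: x) = a *: T x.
Proof. by have := bop_linear T a x 0; rewrite !addr0 bop0r addr0. Qed.

Lemma bop_sumr (T : bop H) I (r : seq I) (P : pred I) (F : I -> H) :
  T (\sum_(i <- r | P i) F i) = \sum_(i <- r | P i) T (F i).
Proof. by apply: (big_morph T) => [x y|]; [exact: bopDr|exact: bop0r]. Qed.

Lemma bopDl (S T : bop H) x : (S + T) x = S x + T x.
Proof. by []. Qed.

Lemma bop0l x : (0 : bop H) x = 0.
Proof. by []. Qed.

Lemma bopZl a (T : bop H) x : (a *: T) x = a *: T x.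
Proof. by []. Qed.

Lemma bopNl (T : bop H) x : (- T) x = - T x.
Proof. by []. Qed.

Lemma bop_suml I (r : seq I) (P : pred I) (F : I -> bop H) x :
  (\sum_(i <- r | P i) F i) x = \sum_(i <- r | P i) F i x.
Proof. by apply: (big_morph (fun T : bop H => T x)). Qed.

Lemma bop_ext (S T : bop H) : S =1 T -> S = T.
Proof. by move=> ST; apply: val_inj; apply/funext. Qed.

End BoundedOps.

Lemma linear_bounded_nrm (R : realType) (H : hilbertType R) (f : {linear H -> H}) :
  continuous f <-> exists M : R, forall x, nrm (f x) <= M * nrm x.
Proof.
split=> [cf|[M hM]].
  have /linear_boundedP[M [Mr hM]] := continuous_linear_bounded 0 (cf 0).
  exists (re (M + 1)) => x.
  have /hM/(_ x) : M < M + 1 by rewrite ltrDl.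
  by rewrite !nrmE lecE => /andP[_]; case: (M + 1) => a b /=; rewrite mulr0 subr0.
apply: bounded_linear_continuous; apply/linear_boundedP.
exists (`|M|)%:C; split; first by rewrite complex_real.
move=> r Mr x.
have /RRe_real r' : r \is Num.real.
  by rewrite realE (ltW (le_lt_trans _ Mr))// ler0c.
rewrite -r' !nrmE -rmorphM lecR (le_trans (hM x))// ler_wpM2r ?nrm_ge0//.
rewrite (le_trans (ler_norm M))// ltW//.
by move: Mr; rewrite -r' ltcR.
Qed.

Section MxNormChar.
Context (R : realType).

Section Bop.
Context (H : hilbertType R).

Definition rip (x y : H) : R := re (inner x y).

Lemma ripDl y x x' : rip (x + x') y = rip x y + rip x' y.
Proof. by rewrite /rip innerDl reD. Qed.

Lemma ripZl (t : R) x y : rip (t%:C *: x) y = t * rip x y.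
Proof. by rewrite /rip innerZl reZ. Qed.

Lemma ripC x y : rip x y = rip y x.
Proof. by rewrite /rip innerC re_conj. Qed.

Lemma ripxx x : rip x x = nrm x ^+ 2.
Proof. by rewrite /rip innerxx. Qed.

Lemma ripDr x y y' : rip x (y + y') = rip x y + rip x y'.
Proof. by rewrite /rip innerDr reD. Qed.

Lemma ripNr x y : rip x (- y) = - rip x y.
Proof. by rewrite -scaleN1r /rip innerZr rmorphN1 mulN1r reN. Qed.

Lemma inner_inj (u v : H) : (forall y, inner u y = inner v y :> R[i]) -> u = v.
Proof.
move=> uv; apply/eqP; rewrite -subr_eq0; apply/eqP; apply: nrm_eq0.
apply/eqP; rewrite -(sqrf_eq0 (nrm _)) -ripxx /rip.
by rewrite innerBl uv subrr.
Qed.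

Lemma rip_CS x y : rip x y <= nrm x * nrm y.
Proof.
exact: (ip_CS (@nrm_ge0 _ _) (@nrm_eq0 _ _) ripDl ripZl ripC ripxx).
Qed.

Lemma inner_CS (x y : H) : nrm (inner x y : R[i]^o) <= nrm x * nrm y.
Proof.
apply: nrm_leP => w w1; rewrite -innerZl (le_trans (rip_CS _ _))//.
by rewrite nrmZ w1 mul1r.
Qed.

Lemma bop_bounded (T : bop H) :
  exists M : R, forall x : H, nrm (T x) <= M * nrm x.
Proof.
have lT := bop_linear T.
pose f := GRing.isLinear.Build R[i] H H *:%R T lT.
pose F : {linear H -> H} := HB.pack (T : H -> H) f.
exact: (@linear_bounded_nrm R H F).1 (@bop_continuous R H T).
Qed.

Lemma bop_build (f : H -> H) : linear f ->
  (exists M : R, forall x, nrm (f x) <= M * nrm x) -> exists T : bop H, T =1 f.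
Proof.
move=> lf bf; pose g := GRing.isLinear.Build R[i] H H *:%R f lf.
pose F : {linear H -> H} := HB.pack f g.
have fb : f \in bounded_operator (H := H).
  by apply/asboolP; split=> //; apply/(@linear_bounded_nrm R H F).
by exists (BOp fb).
Qed.

Lemma bop_mxnormP n (T : 'M[bop H]_n) c : 0 <= c ->
  (mxnorm T <= c <-> forall x y : 'I_n -> H,
  \sum_i rip (\sum_j T i j (x j)) (y i) <=
    c * ((\sum_j nrm (x j) ^+ 2 + \sum_j nrm (y j) ^+ 2) / 2)).
Proof.
apply: (ampl_normP (@nrm_ge0 _ _) (@nrm_eq0 _ _) ripDl ripZl ripC ripxx).
  by move=> i j t x; rewrite bopZr.
by move=> i j; exact: bop_bounded.
Qed.

Lemma bop_mxnorm_ge0 n (T : 'M[bop H]_n) : 0 <= mxnorm T.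
Proof.
apply: (ampl_norm_ge0 (@nrm_ge0 _ _) (@nrm_eq0 _ _) ripDl ripZl ripC ripxx).
by move=> i j; exact: bop_bounded.
Qed.

End Bop.

Section Matrix.
Context (m : nat).
Implicit Types x y : 'cV[R[i]]_m.

Definition cip x y : R := re (\sum_k x k 0 * Num.conj (y k 0)).

Lemma cipDl y x x' : cip (x + x') y = cip x y + cip x' y.
Proof.
rewrite /cip -reD -big_split/=; congr (re _); apply: eq_bigr => k _.
by rewrite mxE mulrDl.
Qed.

Lemma cipZl (t : R) x y : cip (t%:C *: x) y = t * cip x y.
Proof.
rewrite /cip -reZ mulr_sumr; congr (re _); apply: eq_bigr => k _.
by rewrite mxE mulrA.
Qed.

Lemma cipC x y : cip x y = cip y x.
Proof.
rewrite /cip !re_sum; apply: eq_bigr => k _.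
by rewrite -re_conj rmorphM /= conjCK mulrC.
Qed.

Lemma l2norm_sqr x : l2norm x ^+ 2 = \sum_k nrm (x k 0 : R[i]^o) ^+ 2.
Proof. by rewrite sqr_sqrtr// sumr_ge0// => k _; rewrite sqr_ge0. Qed.

Lemma cipxx x : cip x x = l2norm x ^+ 2.
Proof.
rewrite l2norm_sqr /cip re_sum; apply: eq_bigr => k _.
by rewrite mulC_conj.
Qed.

Lemma l2norm_ge0 x : 0 <= l2norm x.
Proof. exact: sqrtr_ge0. Qed.

Lemma l2norm_eq0 x : l2norm x = 0 -> x = 0.
Proof.
move=> x0; apply/matrixP => k j; rewrite mxE (ord1 j).
have /eqP : \sum_k nrm (x k 0 : R[i]^o) ^+ 2 = 0.
  by rewrite -l2norm_sqr x0 expr0n.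
rewrite psumr_eq0 => [/allP h|i _]; last exact: sqr_ge0.
have := h k (mem_index_enum k); rewrite /= expf_eq0/= => /eqP.
exact: nrm_eq0.
Qed.

Lemma l2norm_bounded (A : 'M[R[i]]_m) :
  exists M, forall x, l2norm (A *m x) <= M * l2norm x.
Proof.
exists (\sum_k \sum_l nrm (A k l : R[i]^o)) => x.
rewrite -(ler_pXn2r (n := 2)) ?nnegrE ?mulr_ge0 ?sumr_ge0 ?l2norm_ge0//; last first.
  by move=> k _; rewrite sumr_ge0// => l _; rewrite nrm_ge0.
rewrite exprMn [leLHS]l2norm_sqr.
pose r k := \sum_l nrm (A k l : R[i]^o).
have r0 k : 0 <= r k by rewrite sumr_ge0// => l _; rewrite nrm_ge0.
apply: (@le_trans _ _ ((\sum_k r k ^+ 2) * l2norm x ^+ 2)).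
  rewrite mulr_suml ler_sum// => k _; rewrite -exprMn.
  rewrite ler_pXn2r ?nnegrE ?nrm_ge0 ?mulr_ge0 ?l2norm_ge0//.
  rewrite mxE (le_trans (@nrm_sum _ R[i]^o _ _ _ _))// mulr_suml ler_sum// => l _.
  rewrite nrmCM ler_wpM2l ?nrm_ge0//.
  rewrite -(ler_pXn2r (n := 2)) ?nnegrE ?nrm_ge0 ?l2norm_ge0// l2norm_sqr.
  by rewrite (bigD1 l)//= lerDl sumr_ge0// => k' _; rewrite sqr_ge0.
rewrite ler_wpM2r ?sqr_ge0// expr2 mulr_suml ler_sum// => k _.
rewrite expr2 ler_wpM2l// (bigD1 k)//= -/(r k) lerDl sumr_ge0// => k' _.
exact: r0.
Qed.

Lemma mx_mxnorm_cipP n (A : 'M['M[R[i]]_m]_n) c : 0 <= c ->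
  (mxnorm A <= c <-> forall x y : 'I_n -> 'cV[R[i]]_m,
  \sum_i cip (\sum_j A i j *m x j) (y i) <=
    c * ((\sum_j l2norm (x j) ^+ 2 + \sum_j l2norm (y j) ^+ 2) / 2)).
Proof.
exact: (ampl_normP l2norm_ge0 l2norm_eq0 cipDl cipZl cipC cipxx
  (T := fun i j => mulmx (A i j)) (fun i j t x => esym (scalemxAr _ _ _))
  (fun i j => l2norm_bounded (A i j))).
Qed.

Lemma l2norm_mul_le (A : 'M[R[i]]_m) c x :
  mxnorm (const_mx A : 'M['M[R[i]]_m]_1) <= c -> l2norm (A *m x) <= c * l2norm x.
Proof.
move=> Ac; pose B := const_mx A : 'M['M[R[i]]_m]_1.
have := ampl_norm_app l2norm_ge0 l2norm_eq0 cipDl cipZl cipC cipxx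
  (T := fun i j => mulmx (B i j)) (fun i j t x => esym (scalemxAr _ _ _))
  (fun i j => l2norm_bounded (B i j)) (fun=> x).
rewrite !big_ord1 mxE -exprMn ler_pXn2r ?nnegrE ?l2norm_ge0//; last first.
  rewrite mulr_ge0 ?l2norm_ge0//.
  exact: (ampl_norm_ge0 l2norm_ge0 l2norm_eq0 cipDl cipZl cipC cipxx
    (T := fun i j => mulmx (B i j)) (fun i j => l2norm_bounded (B i j))).
by move=> /le_trans; apply; rewrite ler_wpM2r ?l2norm_ge0.
Qed.

(** In scalars the test is a finite sum, linear in the entries of [A] and symmetric under exchange
    of inner and outer indices. Entrywise limits and [flip_mx] rely on this. *)
Lemma mx_mxnormP n (A : 'M['M[R[i]]_m]_n) c : 0 <= c ->
  (mxnorm A <= c <-> forall a b : 'I_n -> 'I_m -> R[i],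
  re (\sum_i \sum_j \sum_k \sum_l
    A i j k l * a j l * Num.conj (b i k)) <=
    c * ((\sum_j \sum_l nrm (a j l : R[i]^o) ^+ 2 +
          \sum_j \sum_l nrm (b j l : R[i]^o) ^+ 2) / 2)).
Proof.
move=> c0.
have P := mx_mxnorm_cipP A c0.
have E (a b : 'I_n -> 'cV[R[i]]_m) :
    \sum_i cip (\sum_j A i j *m a j) (b i) =
    re (\sum_i \sum_j \sum_k \sum_l
      A i j k l * a j l 0 * Num.conj (b i k 0)).
  rewrite re_sum; apply: eq_bigr => i _; rewrite /cip exchange_big/=.
  congr (re _); apply: eq_bigr => k _.
  rewrite summxE mulr_suml; apply: eq_bigr => j _.
  by rewrite mxE mulr_suml.
apply: (iff_trans P); split=> h.
  move=> a b; have := h (fun j => \col_l a j l) (fun j => \col_l b j l).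
  have F (d : 'I_n -> 'I_m -> R[i]) : \sum_j l2norm (\col_l d j l) ^+ 2 =
      \sum_j \sum_l nrm (d j l : R[i]^o) ^+ 2.
    by apply: eq_bigr => j _; rewrite l2norm_sqr; apply: eq_bigr => l _; rewrite mxE.
  rewrite E !F => /(le_trans _); apply; rewrite le_eqVlt; apply/orP; left.
  by apply/eqP; congr (re _); do 4 (apply: eq_bigr => ? _); rewrite !mxE.
move=> x y; rewrite E; apply: le_trans (h (fun j l => x j l 0) (fun j l => y j l 0)) _.
rewrite le_eqVlt; apply/orP; left; apply/eqP.
by congr (_ * ((_ + _) / _)); apply: eq_bigr => j _; rewrite l2norm_sqr.
Qed.

Lemma mx_mxnorm_ge0 n (A : 'M['M[R[i]]_m]_n) : 0 <= mxnorm A.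
Proof.
exact: (ampl_norm_ge0 l2norm_ge0 l2norm_eq0 cipDl cipZl cipC cipxx
  (T := fun i j => mulmx (A i j))
  (fun i j => l2norm_bounded (A i j))).
Qed.

End Matrix.
End MxNormChar.

(** * Orthonormal families and Gram-Schmidt *)

Section Orthonormal.
Context (R : realType) (H : hilbertType R).

Definition orthonormal_family m (e : 'I_m -> H) :=
  forall k l, inner (e k) (e l) = (k == l)%:R :> R[i].

Lemma inner_bop_lincomb (T : bop H) m (e : 'I_m -> H) (a b : 'I_m -> R[i]) :
  inner (T (\sum_l a l *: e l)) (\sum_k b k *: e k) =
  \sum_k \sum_l inner (T (e l)) (e k) * a l * Num.conj (b k) :> R[i].
Proof.
rewrite inner_sumr; apply: eq_bigr => k _.
rewrite innerZr bop_sumr inner_suml mulr_sumr; apply: eq_bigr => l _.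
by rewrite bopZr innerZl mulrC (mulrC (a l)).
Qed.

Lemma inner_lincomb m (e : 'I_m -> H) (a : 'I_m -> R[i]) k :
  orthonormal_family e -> inner (\sum_l a l *: e l) (e k) = a k :> R[i].
Proof.
move=> oe; rewrite inner_suml (bigD1 k)//= innerZl oe eqxx mulr1.
by rewrite big1 ?addr0// => l lk; rewrite innerZl oe (negbTE lk) mulr0.
Qed.

Lemma nrm_lincomb m (e : 'I_m -> H) (a : 'I_m -> R[i]) :
  orthonormal_family e ->
  nrm (\sum_l a l *: e l) ^+ 2 = \sum_l nrm (a l : R[i]^o) ^+ 2.
Proof.
move=> oe; apply: (@complexI R); rewrite -innerxx inner_sumr rmorph_sum/=.
by apply: eq_bigr => k _; rewrite innerZr inner_lincomb// mulrC mulC_conj.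
Qed.

Lemma gram_schmidt (s : seq H) : exists m (e : 'I_m -> H),
  orthonormal_family e /\
  forall x, x \in s -> x = \sum_k inner x (e k) *: e k.
Proof.
elim: s => [|x s [m [e [oe es]]]].
  by exists 0%N, (fun=> 0); split=> // -[].
pose r := x - \sum_k inner x (e k) *: e k.
have [r0|r0] := eqVneq r 0.
  exists m, e; split=> // z; rewrite inE => /orP[/eqP ->|/es//].
  by apply/eqP; rewrite -subr_eq0 -/r r0.
have nr : nrm r != 0 by apply: contra_neq r0 => /nrm_eq0.
have re' k : inner r (e k) = 0 :> R[i].
  by rewrite innerBl inner_lincomb// subrr.
have er k : inner (e k) r = 0 :> R[i] by rewrite innerC re' conjC0.
pose u : H := (nrm r)^-1%:C *: r.
pose f (k : 'I_m.+1) := if unlift ord_max k is Some k' then e k' else u.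
have fmax : f ord_max = u by rewrite /f unlift_none.
have fw (k : 'I_m) : f (widen_ord (leqnSn m) k) = e k.
  rewrite /f (_ : widen_ord _ k = lift ord_max k) ?liftK//.
  by apply: val_inj; rewrite /= /bump leqNgt ltn_ord.
exists m.+1, f; split.
  move=> k l; rewrite /f.
  case: (unliftP ord_max k) => [k' ->|->]; case: (unliftP ord_max l) => [l' ->|->].
  - by rewrite oe (inj_eq lift_inj).
  - by rewrite innerZr er mulr0 eq_sym (negbTE (neq_lift _ _)).
  - by rewrite innerZl re' mulr0 (negbTE (neq_lift _ _)).
  - rewrite eqxx innerZl innerZr conj_real innerxx -!rmorphM.
    by rewrite expr2 [X in _ * X]mulrA mulVf// mul1r mulVf.
move=> z; rewrite inE big_ord_recr/= fmax.
under eq_bigr do rewrite fw.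
move=> /orP[/eqP->|/es zE].
  have xr : x = r + \sum_k inner x (e k) *: e k by rewrite subrK.
  have xu : inner x u = (nrm r)%:C.
    rewrite {1}xr innerDl !innerZr conj_real innerxx inner_suml big1 => [|k _].
      by rewrite mulr0 addr0 -rmorphM expr2 mulrA mulVf// mul1r.
    by rewrite innerZl er mulr0.
  by rewrite xu /u scalerA -rmorphM mulfV// rmorph1 scale1r addrC.
rewrite (_ : inner z u = 0) ?scale0r ?addr0//.
by rewrite zE inner_suml big1// => k _; rewrite innerZl innerZr er !mulr0.
Qed.

Lemma gram_schmidt_families n (x y : 'I_n -> H) :
  exists m (e : 'I_m -> H) (a b : 'I_n -> 'I_m -> R[i]),
  [/\ orthonormal_family e, forall j, x j = \sum_k a j k *: e k
    & forall j, y j = \sum_k b j k *: e k].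
Proof.
have [m [e [oe es]]] := gram_schmidt (codom x ++ codom y).
exists m, e, (fun j k => inner (x j) (e k)), (fun j k => inner (y j) (e k)).
by split=> // j; apply: es; rewrite mem_cat codom_f ?orbT.
Qed.

End Orthonormal.

(** * Matrix norms of operator spaces *)

Section MxNormForm.
Context (R : realType) (H : hilbertType R).

Definition bop_form n (T : 'M[bop H]_n) (x y : 'I_n -> H) : R :=
  \sum_i rip (\sum_j T i j (x j)) (y i).

Lemma bop_formE n (T : 'M[bop H]_n) (x y : 'I_n -> H) :
  bop_form T x y = re (\sum_i \sum_j inner (T i j (x j)) (y i)).
Proof.
by rewrite re_sum; apply: eq_bigr => i _; rewrite /rip inner_suml.
Qed.

Lemma mx_compress_le n (T : 'M[bop H]_n) m (e : 'I_m -> H) :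
  orthonormal_family e ->
  mxnorm (\matrix_(i, j) (\matrix_(k, l) (inner (T i j (e l)) (e k) : R[i]))) <=
  mxnorm T.
Proof.
move=> oe; have T0 := bop_mxnorm_ge0 T.
apply/mx_mxnormP => // a b.
have := (bop_mxnormP T T0).1 (lexx _) (fun j => \sum_l a j l *: e l)
  (fun j => \sum_l b j l *: e l).
rewrite -/(bop_form _ _ _) bop_formE.
under [X in _ * ((X + _) / _)]eq_bigr do rewrite nrm_lincomb//.
under [X in _ * ((_ + X) / _)]eq_bigr do rewrite nrm_lincomb//.
move=> /(le_trans _); apply; rewrite le_eqVlt; apply/orP; left; apply/eqP.
congr (re _); do 2 (apply: eq_bigr => ? _); rewrite inner_bop_lincomb.
by do 2 (apply: eq_bigr => ? _); rewrite !mxE.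
Qed.

(** A norm test involves finitely many vectors, and a single orthonormal family spans all of them,
    so finite compressions detect the norm. *)
Lemma mxnorm_le_compress n (T : 'M[bop H]_n) c : 0 <= c ->
  (forall m (e : 'I_m -> H), orthonormal_family e ->
    mxnorm (\matrix_(i, j) (\matrix_(k, l) (inner (T i j (e l)) (e k) : R[i])))
    <= c) ->
  mxnorm T <= c.
Proof.
move=> c0 h; apply/bop_mxnormP => // x y.
have [m [e [a [b [oe xE yE]]]]] := gram_schmidt_families x y.
have := (mx_mxnormP _ c0).1 (h _ _ oe) a b.
rewrite -/(bop_form _ _ _) bop_formE.
under [X in _ <= _ * ((X + _) / _) -> _]eq_bigr do
  rewrite -(nrm_lincomb _ oe) -xE.
under [X in _ <= _ * ((_ + X) / _) -> _]eq_bigr do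
  rewrite -(nrm_lincomb _ oe) -yE.
apply: le_trans; rewrite le_eqVlt; apply/orP; left; apply/eqP.
congr (re _); do 2 (apply: eq_bigr => ? _); rewrite xE yE inner_bop_lincomb.
by do 2 (apply: eq_bigr => ? _); rewrite !mxE.
Qed.

End MxNormForm.

Definition norm1 (R : realType) (V : mxNormedType R) (v : V) : R :=
  mxnorm (const_mx v : 'M[V]_1).

(** The product [r^* v q] of scalar matrices around a matrix over [V]. *)
Definition sandwich (R : realType) (V : lmodType R[i]) n m p
    (r : 'I_n -> 'I_m -> R[i]) (v : 'M[V]_n) (q : 'I_n -> 'I_p -> R[i]) :
    'M[V]_(m, p) :=
  \matrix_(k, l) \sum_i \sum_j (q j l * Num.conj (r i k)) *: v i j.

(** The relation [q^* q = 1], up to conjugation. *)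
Definition isometric_cols (R : realType) n m (q : 'I_n -> 'I_m -> R[i]) :=
  forall k l, \sum_i q i k * Num.conj (q i l) = (k == l)%:R.

Section OpSpaceFacts.
Context (R : realType) (V : opSpaceType R).

Lemma opspace_form : exists (H : hilbertType R) (J : {linear V -> bop H}),
  [/\ injective J,
    forall n (v : 'M[V]_n), mxnorm (map_mx J v) = mxnorm v
  & forall n (v : 'M[V]_n) c, 0 <= c -> (mxnorm v <= c <->
    forall x y, bop_form (map_mx J v) x y <=
      c * ((\sum_j nrm (x j) ^+ 2 + \sum_j nrm (y j) ^+ 2) / 2))].
Proof.
have [H [J [injJ isoJ]]] := @opspace_concrete R V.
exists H, J; split=> [||n v c c0]; [exact: injJ|exact: isoJ|].
by rewrite -(isoJ n v); exact: bop_mxnormP.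
Qed.

Lemma mxnorm_ge0 n (v : 'M[V]_n) : 0 <= mxnorm v.
Proof.
have [H [J [_ isoJ _]]] := opspace_form.
by rewrite -isoJ bop_mxnorm_ge0.
Qed.

Lemma norm1_ge0 (v : V) : 0 <= norm1 v.
Proof. exact: mxnorm_ge0. Qed.

Lemma sum_sandwich (W : lmodType R[i]) (f : {linear V -> W}) (n m p : nat)
    (r : 'I_n -> 'I_m -> R[i]) (v : 'M[V]_n) (q : 'I_n -> 'I_p -> R[i]) k l :
  f (sandwich r v q k l) =
  \sum_i \sum_j (q j l * Num.conj (r i k)) *: f (v i j).
Proof.
rewrite mxE linear_sum; apply: eq_bigr => i _; rewrite linear_sum.
by apply: eq_bigr => j _; rewrite linearZ.
Qed.

(** The adjoint rule: [<r^* v q x, y> = <v (q x), r y>]. *)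
Lemma bop_form_sandwich (H : hilbertType R) (J : {linear V -> bop H}) n m
    (r q : 'I_n -> 'I_m -> R[i]) (v : 'M[V]_n) x y :
  bop_form (map_mx J (sandwich r v q)) x y =
  bop_form (map_mx J v) (fun j => \sum_l q j l *: x l)
                        (fun i => \sum_k r i k *: y k).
Proof.
rewrite !bop_formE; congr (re _).
transitivity (\sum_k \sum_l \sum_i \sum_j
    q j l * Num.conj (r i k) * inner (J (v i j) (x l)) (y k) : R[i]).
  apply: eq_bigr => k _; apply: eq_bigr => l _.
  rewrite mxE sum_sandwich bop_suml inner_suml; apply: eq_bigr => i _.
  rewrite bop_suml inner_suml; apply: eq_bigr => j _.
  by rewrite bopZl innerZl.
under eq_bigr do rewrite exchange_big/=.
rewrite exchange_big/=; apply: eq_bigr => i _.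
under eq_bigr do rewrite exchange_big/=.
rewrite exchange_big/=; apply: eq_bigr => j _.
rewrite inner_sumr; apply: eq_bigr => k _.
rewrite innerZr mxE bop_sumr inner_suml mulr_sumr; apply: eq_bigr => l _.
by rewrite bopZr innerZl; ring.
Qed.

Lemma nrm_isometric_cols (H : hilbertType R) n m (q : 'I_n -> 'I_m -> R[i])
    (x : 'I_m -> H) : isometric_cols q ->
  \sum_j nrm (\sum_l q j l *: x l) ^+ 2 = \sum_l nrm (x l) ^+ 2.
Proof.
move=> iq; apply: (@complexI R); rewrite !rmorph_sum/=.
transitivity (\sum_k \sum_l (k == l)%:R * inner (x k) (x l) : R[i]).
  under [RHS]eq_bigr do under eq_bigr do rewrite -iq mulr_suml.
  under [RHS]eq_bigr do rewrite exchange_big/=.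
  rewrite exchange_big/=; apply: eq_bigr => j _.
  rewrite -innerxx inner_suml; apply: eq_bigr => k _.
  rewrite inner_sumr; apply: eq_bigr => l _.
  by rewrite innerZl innerZr mulrA.
apply: eq_bigr => k _; rewrite (bigD1 k)//= eqxx mul1r innerxx big1 ?addr0//.
by move=> l lk; rewrite eq_sym (negbTE lk) mul0r.
Qed.

Lemma mxnorm_sandwich n m (r q : 'I_n -> 'I_m -> R[i]) (v : 'M[V]_n) :
  isometric_cols r -> isometric_cols q -> mxnorm (sandwich r v q) <= mxnorm v.
Proof.
move=> ir iq; have [H [J [_ _ P]]] := opspace_form.
have v0 := mxnorm_ge0 v; apply/P => // x y.
rewrite bop_form_sandwich (le_trans ((P _ _ _ v0).1 (lexx _) _ _))//.
by rewrite !nrm_isometric_cols.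
Qed.

(** The form of a block sum is the sum of the two forms, and the half-sums of squares of the two
    parts of [x] and [y] add up in the same way. *)
Lemma mxnorm_block n m (v : 'M[V]_n) (w : 'M[V]_m) c :
  mxnorm v <= c -> mxnorm w <= c -> mxnorm (block_mx v 0 0 w) <= c.
Proof.
move=> vc wc; have [H [J [_ _ P]]] := opspace_form.
have c0 : 0 <= c by rewrite (le_trans (mxnorm_ge0 v)).
apply/P => // x y; rewrite /bop_form !big_split_ord/=.
have hv := (P _ _ _ c0).1 vc (fun i => x (lshift m i)) (fun i => y (lshift m i)).
have hw := (P _ _ _ c0).1 wc (fun i => x (rshift n i)) (fun i => y (rshift n i)).
apply: le_trans (_ : _ <= _ + _) (le_trans (lerD hv hw) _); last first.
  by rewrite -mulrDr ler_wpM2l//; lra.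
rewrite le_eqVlt; apply/orP; left; apply/eqP; congr (_ + _).
  apply: eq_bigr => i _; rewrite big_split_ord/= [X in _ + X]big1 ?addr0.
    by congr (rip _ _); apply: eq_bigr => j _; rewrite [in RHS]mxE mxE block_mxEul.
  by move=> j _; rewrite mxE block_mxEur mxE linear0.
apply: eq_bigr => i _; rewrite big_split_ord/= [X in X + _]big1 ?add0r.
  by congr (rip _ _); apply: eq_bigr => j _; rewrite [in RHS]mxE mxE block_mxEdr.
by move=> j _; rewrite mxE block_mxEdl mxE linear0.
Qed.

Lemma mxnorm_eq0 n (v : 'M[V]_n) : mxnorm v = 0 -> v = 0.
Proof.
have [H [J [injJ _ P]]] := opspace_form => v0; apply/matrixP => i j.
rewrite mxE; apply: injJ; rewrite linear0; apply: bop_ext => x.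
rewrite bop0l; apply: nrm_eq0; apply/eqP; rewrite -(sqrf_eq0 (nrm _)).
have := (P n v 0 (lexx _)).1 _ (fun k => if k == j then x else 0)
  (fun k => if k == i then J (v i j) x else 0).
rewrite v0 mul0r => /(_ (lexx _)).
rewrite /bop_form (bigD1 i)//= eqxx (bigD1 j)//= eqxx !big1 => [|k ki|k kj].
- by rewrite !addr0 mxE ripxx => h; rewrite eq_le h sqr_ge0.
- by rewrite (negbTE ki) /rip inner0r.
- by rewrite (negbTE kj) bop0r.
Qed.

Lemma norm1_eq0 (v : V) : norm1 v = 0 -> v = 0.
Proof. by move=> /mxnorm_eq0/matrixP/(_ 0 0); rewrite !mxE. Qed.

Lemma mxnormZ n (v : 'M[V]_n) (t : R) : 0 <= t ->
  mxnorm (map_mx (fun u : V => t%:C *: u) v) <= t * mxnorm v.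
Proof.
move=> t0; have [H [J [_ _ P]]] := opspace_form.
have v0 := mxnorm_ge0 v.
apply/P => [|x y]; first by rewrite mulr_ge0.
have := (P _ _ _ v0).1 (lexx _) x y => /(ler_wpM2l t0).
rewrite mulrA; apply: le_trans; rewrite le_eqVlt; apply/orP; left; apply/eqP.
rewrite !bop_formE -reZ mulr_sumr; congr (re _); apply: eq_bigr => i _.
rewrite mulr_sumr; apply: eq_bigr => j _.
by rewrite !mxE linearZ bopZl innerZl.
Qed.

Lemma mxnorm0 n : mxnorm (0 : 'M[V]_n) = 0.
Proof.
apply/eqP; rewrite eq_le mxnorm_ge0 andbT.
have := mxnormZ (0 : 'M[V]_n) (lexx (0 : R)); rewrite mul0r.
rewrite (_ : map_mx _ _ = 0)//; apply/matrixP => i j.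
by rewrite !mxE scaler0.
Qed.

Lemma norm10 : norm1 (0 : V) = 0.
Proof. exact: mxnorm0. Qed.

Lemma norm1Z (v : V) (t : R) : 0 <= t -> norm1 (t%:C *: v) <= t * norm1 v.
Proof. by move=> t0; have := mxnormZ (const_mx v : 'M[V]_1) t0; rewrite map_const_mx. Qed.

Lemma norm1D (v w : V) : norm1 (v + w) <= norm1 v + norm1 w.
Proof.
have [H [J [_ _ P]]] := opspace_form.
have v0 := norm1_ge0 v; have w0 := norm1_ge0 w.
apply/P => [|x y]; first by rewrite addr_ge0.
have := lerD ((P _ _ _ v0).1 (lexx _) x y) ((P _ _ _ w0).1 (lexx _) x y).
rewrite -mulrDl; apply: le_trans; rewrite le_eqVlt; apply/orP; left; apply/eqP.
by rewrite /bop_form !big_ord1 -ripDl !mxE linearD.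
Qed.

Lemma norm1N (v : V) : norm1 (- v) <= norm1 v.
Proof.
have [H [J [_ _ P]]] := opspace_form.
have v0 := norm1_ge0 v.
apply/P => // x y.
have := (P _ _ _ v0).1 (lexx _) x (fun i => - y i).
rewrite !big_ord1 nrmN; apply: le_trans; rewrite le_eqVlt; apply/orP; left.
by apply/eqP; rewrite /bop_form !big_ord1 !mxE linearN bopNl ripNr ripC ripNr ripC.
Qed.

(* Unlike the operator space structure itself, this property passes to the
   dual by a direct computation, and it is all that the matrix norms of the
   dual need to be finite. *)
Definition row_bounded (U : mxNormedType R) :=
  forall n (v : 'M[U]_n) (a b : 'I_n -> R[i]), mxnorm v <= 1 ->
  norm1 (\sum_i \sum_j (a j * Num.conj (b i)) *: v i j) <=
    \sum_j nrm (a j : R[i]^o) ^+ 2 + \sum_j nrm (b j : R[i]^o) ^+ 2.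

Lemma opspace_row_bounded : row_bounded V.
Proof.
move=> n v a b v1; have [H [J [_ _ P]]] := opspace_form.
set A := \sum_j nrm (a j : R[i]^o) ^+ 2.
set B := \sum_j nrm (b j : R[i]^o) ^+ 2.
have A0 : 0 <= A by rewrite sumr_ge0// => j _; rewrite sqr_ge0.
have B0 : 0 <= B by rewrite sumr_ge0// => j _; rewrite sqr_ge0.
apply/P => [|x y]; first by rewrite addr_ge0.
have E : const_mx (\sum_i \sum_j (a j * Num.conj (b i)) *: v i j) =
    sandwich (fun j (_ : 'I_1) => b j) v (fun j (_ : 'I_1) => a j).
  by apply/matrixP => k l; rewrite !mxE.
rewrite E bop_form_sandwich (le_trans ((P _ _ _ ler01).1 v1 _ _))//.
have S (d : 'I_n -> R[i]) (z : 'I_1 -> H) :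
    \sum_j nrm (\sum_(l < 1) d j *: z l) ^+ 2 =
    (\sum_j nrm (d j : R[i]^o) ^+ 2) * nrm (z 0) ^+ 2.
  rewrite mulr_suml; apply: eq_bigr => j _.
  by rewrite big_ord1 nrmZ exprMn.
rewrite !S !big_ord1 -/A -/B.
have := mulr_ge0 A0 (sqr_ge0 (nrm (y 0))).
have := mulr_ge0 B0 (sqr_ge0 (nrm (x 0))).
lra.
Qed.

End OpSpaceFacts.

(** * Extension of completely contractive maps into matrix algebras *)

Section HahnBanach.
Context (R : realType) (U : lmodType R[i]) (p : U -> R).
Hypothesis pD : forall u v, p (u + v) <= p u + p v.
Hypothesis pZ : forall (t : R) u, 0 <= t -> p (t%:C *: u) <= t * p u.

Let p0_le0 : p 0 <= 0.
Proof. by have := pZ 0 (lexx 0); rewrite scale0r mul0r. Qed.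

(* Graphs of real-linear functionals dominated by [p]. *)
Let dominated (G : set (U * R)) :=
  (forall u v r q (t : R), G (u, r) -> G (v, q) ->
    G (u + t%:C *: v, r + t * q)) /\ (forall u r, G (u, r) -> r <= p u).

Let dominated_fun G u r q : dominated G -> G (u, r) -> G (u, q) -> r = q.
Proof.
move=> [GD Gp] Gur Guq.
have h a b : G (u, a) -> G (u, b) -> a - b <= 0.
  move=> Ga Gb; have /Gp := GD _ _ _ _ (-1) Ga Gb.
  by rewrite rmorphN1 scaleN1r subrr mulN1r => /le_trans; apply; exact: p0_le0.
by apply/eqP; rewrite eq_le -subr_le0 h// -subr_le0 h.
Qed.

Let pZ_eq (t : R) u : 0 < t -> t * p u <= p (t%:C *: u).
Proof.
move=> t0; rewrite -ler_pdivlMl//.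
have := pZ (t%:C *: u) (ltW (_ : 0 < t^-1)); rewrite invr_gt0 => /(_ t0).
by rewrite scalerA -rmorphM mulVf ?gt_eqF// rmorph1 scale1r.
Qed.

Let extend G u0 : dominated G -> G (0, 0) ->
  exists G', [/\ dominated G', G `<=` G' & exists c, G' (u0, c)].
Proof.
move=> [GD Gp] G0.
(* Domination at [u - u0] and at [u + u0] bounds the value [c] at [u0] from below and from above.
   [S] collects the lower bounds; subadditivity of [p] keeps them under the upper ones. *)
pose S := [set x | exists2 ur : U * R, G ur & x = ur.2 - p (ur.1 - u0)].
have GDD u v r q : G (u, r) -> G (v, q) -> G (u + v, r + q).
  by move=> Gu Gv; have := GD _ _ _ _ 1 Gu Gv; rewrite scale1r mul1r.
have GZ u r (t : R) : G (u, r) -> G (t%:C *: u, t * r).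
  by move=> Gu; have := GD _ _ _ _ t G0 Gu; rewrite !add0r.
have le v q : G (v, q) -> ubound S (p (v + u0) - q).
  move=> Gv _ [[u r] /= Gu ->].
  rewrite lerBrDr addrAC lerBlDr.
  apply: le_trans (Gp _ _ (GDD _ _ _ _ Gu Gv)) _.
  rewrite (_ : u + v = (v + u0) + (u - u0)) ?pD//.
  by rewrite addrACA subrr addr0 addrC.
have S0 : S !=set0 by exists (0 - p (0 - u0)), (0, 0).
have hS : has_sup S by split=> //; exists (p (0 + u0) - 0); exact: le.
pose c := sup S.
have cle v q : G (v, q) -> q + c <= p (v + u0).
  by move=> Gv; rewrite addrC -lerBrDr; apply: ge_sup => //; exact: le.
have cge v q : G (v, q) -> q - c <= p (v - u0).
  move=> Gv; rewrite lerBlDr addrC -lerBlDr.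
  by apply: (ub_le_sup hS.2); exists (v, q).
exists [set x | exists ur, exists t : R,
  G ur /\ x = (ur.1 + t%:C *: u0, ur.2 + t * c)]; split.
- split=> [u v r q t|u r].
    move=> [[u1 r1] [t1 /= [G1 [-> ->]]]] [[u2 r2] [t2 /= [G2 [-> ->]]]].
    exists (u1 + t%:C *: u2, r1 + t * r2), (t1 + t * t2); split=> /=.
      exact: GD.
    congr (_, _); last by ring.
    by rewrite scalerDr scalerA -rmorphM addrACA -scalerDl -rmorphD.
  move=> [[v q] [t /= [Gv [-> ->]]]].
  have [t0|t0|->] := ltgtP t 0; last first.
  - by rewrite rmorph0 scale0r mul0r !addr0; exact: Gp.
  - have := cle _ _ (GZ _ _ t^-1 Gv) => /(ler_wpM2l (ltW t0)).
    rewrite mulrDr mulrA mulfV ?gt_eqF// mul1r => /le_trans; apply.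
    apply: (le_trans (pZ_eq _ t0)); rewrite scalerDr scalerA -rmorphM.
    by rewrite mulfV ?gt_eqF// rmorph1 scale1r.
  - have s0 : 0 < - t by rewrite oppr_gt0.
    have := cge _ _ (GZ _ _ (- t)^-1 Gv) => /(ler_wpM2l (ltW s0)).
    rewrite mulrBr mulrA mulfV ?gt_eqF// mul1r mulNr opprK => /le_trans; apply.
    apply: (le_trans (pZ_eq _ s0)); rewrite scalerBr scalerA -rmorphM.
    by rewrite mulfV ?gt_eqF// rmorph1 scale1r rmorphN scaleNr opprK.
- move=> [u r] Gu; exists (u, r), 0; split=> //=.
  by rewrite scale0r mul0r !addr0.
- by exists c, (0, 0), 1; split=> //=; rewrite scale1r mul1r !add0r.
Qed.

Lemma hahn_banach (G0 : set (U * R)) : G0 (0, 0) ->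
  (forall u v r q (t : R), G0 (u, r) -> G0 (v, q) ->
    G0 (u + t%:C *: v, r + t * q)) ->
  (forall u r, G0 (u, r) -> r <= p u) ->
  exists s : U -> R,
  [/\ forall (t : R) u v, s (u + t%:C *: v) = s u + t * s v,
      forall u, s u <= p u & forall u r, G0 (u, r) -> s u = r].
Proof.
move=> G00 G0D G0p.
(* Zorn is applied to graphs joined with [G0], because the union of the empty chain is empty and
   must also qualify. *)
have [|A [domA maxA]] := @Zorn_bigcup _ [set A | dominated (A `|` G0)].
  move=> F FP Ftot.
  have key x y : (\bigcup_(X in F) X `|` G0) x -> (\bigcup_(X in F) X `|` G0) y ->
      exists2 Y, dominated Y & [/\ Y x, Y y & Y `<=` \bigcup_(X in F) X `|` G0].
    have sub X : F X -> X `|` G0 `<=` \bigcup_(X in F) X `|` G0.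
      by move=> FX z [Xz|]; [left; exists X|right].
    move=> [[X FX Xx]|Gx] [[Y FY Yy]|Gy].
    - have [XY|YX] := Ftot _ _ FX FY.
        by exists (Y `|` G0); [exact: FP|split; [left; exact: XY|left|exact: sub]].
      by exists (X `|` G0); [exact: FP|split; [left|left; exact: YX|exact: sub]].
    - by exists (X `|` G0); [exact: FP|split; [left|right|exact: sub]].
    - by exists (Y `|` G0); [exact: FP|split; [right|left|exact: sub]].
    - by exists G0; [split|split=> // z; right].
  split=> [u v r q t Gu Gv|u r Gu].
    by have [Y [YD _] [Yu Yv]] := key _ _ Gu Gv; apply; exact: YD.
  by have [Y [_ Yp] [Yu _ _]] := key _ _ Gu Gu; exact: Yp.
pose G := A `|` G0; have {}domA : dominated G by [].
have GG0 : G (0, 0) by right.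
have total u : exists r, G (u, r).
  have [G' [domG' GG' [c G'c]]] := extend u domA GG0.
  apply: contrapT => nG; apply: (maxA G').
    split=> [x Ax|G'A]; first by apply: GG'; left.
    by apply: nG; exists c; left; exact: G'A.
  by rewrite /= (_ : _ `|` _ = G')//; apply/setUidPl => x G0x; apply: GG'; right.
have [s sP] := choice total.
exists s; split=> [t u v|u|u r G0u].
- by apply: (dominated_fun domA (sP _)); exact: domA.1.
- exact: domA.2.
- by apply: (dominated_fun domA (sP _)); right.
Qed.

End HahnBanach.

(** * Scalar matrix factors around matrices of vectors *)

Section Sandwich.
Context (R : realType).

Lemma sandwich_comp (Y : lmodType R[i]) n m p (y : 'M[Y]_n)
    (r q : 'M[R[i]]_(n, m)) (r' q' : 'M[R[i]]_(m, p)) :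
  sandwich r' (sandwich r y q) q' = sandwich (r *m r') y (q *m q').
Proof.
apply/matrixP => k l; rewrite !mxE.
transitivity (\sum_s \sum_t \sum_i \sum_j
    (q' t l * Num.conj (r' s k) * (q j t * Num.conj (r i s))) *: y i j).
  apply: eq_bigr => s _; apply: eq_bigr => t _; rewrite mxE scaler_sumr.
  by apply: eq_bigr => i _; rewrite scaler_sumr; apply: eq_bigr => j _; rewrite scalerA.
under eq_bigr do rewrite exchange_big/=.
rewrite exchange_big/=; apply: eq_bigr => i _.
under eq_bigr do rewrite exchange_big/=.
rewrite exchange_big/=; apply: eq_bigr => j _.
rewrite !mxE rmorph_sum/= mulr_sumr scaler_suml; apply: eq_bigr => s _.
rewrite mulr_suml scaler_suml; apply: eq_bigr => t _.
by congr (_ *: _); rewrite rmorphM/=; ring.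
Qed.

Lemma sandwich1 (Y : lmodType R[i]) n (y : 'M[Y]_n) :
  sandwich (1%:M : 'M[R[i]]_n) y (1%:M : 'M[R[i]]_n) = y.
Proof.
apply/matrixP => k l; rewrite mxE (bigD1 k)//= (bigD1 l)//= !mxE !eqxx.
rewrite conjC1 mulr1 scale1r !big1 ?addr0// => [i ik|j jl].
  by rewrite big1// => j _; rewrite !mxE (negbTE ik) conjC0 mulr0 scale0r.
by rewrite !mxE (negbTE jl) mul0r scale0r.
Qed.

Lemma sandwich_lin (X Y : lmodType R[i]) (f : {linear X -> Y}) n m
    (r q : 'I_n -> 'I_m -> R[i]) (x : 'M[X]_n) :
  map_mx f (sandwich r x q) = sandwich r (map_mx f x) q.
Proof.
apply/matrixP => k l; rewrite !mxE linear_sum; apply: eq_bigr => i _.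
by rewrite linear_sum; apply: eq_bigr => j _; rewrite linearZ mxE.
Qed.

Definition hsnorm2 n m (a : 'I_n -> 'I_m -> R[i]) : R :=
  \sum_j \sum_l nrm (a j l : R[i]^o) ^+ 2.

(* The rows [eps *: 1] make the columns of [a] linearly independent. *)
Lemma isometric_factorization n m (a : 'M[R[i]]_(n, m)) (eps : R) : 0 < eps ->
  exists (q : 'M[R[i]]_(n + m, m)) (alpha : 'M[R[i]]_m),
  [/\ isometric_cols q, alpha \in unitmx,
      col_mx a (eps%:C)%:M = q *m alpha
    & hsnorm2 alpha = hsnorm2 a + eps ^+ 2 *+ m].
Proof.
move=> e0; pose B := (col_mx a (eps%:C)%:M)^T.
have le : (m <= n + m)%N by rewrite leq_addl.
have US := schmidt_unitarymx B le; set S := schmidt B in US.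
have /submxP[L BL] : (B <= S)%MS := schmidt_sub B.
have SS : S *m (S ^T ^ Num.conj)%sesqui = 1%:M by apply/unitarymxP.
exists S^T, L^T; split.
- move=> k l; have /matrixP/(_ k l) := SS; rewrite !mxE => <-.
  by apply: eq_bigr => j _; rewrite !mxE.
- rewrite unitmx_tr.
  have : L *m (S *m (col_mx 0 (eps^-1%:C)%:M)) = 1%:M.
    rewrite mulmxA -BL /B tr_col_mx mul_row_col mulmx0 add0r tr_scalar_mx.
    by rewrite -scalar_mxM -rmorphM mulfV ?gt_eqF.
  by move=> /mulmx1_unit[].
- by rewrite -trmx_mul -BL trmxK.
have HS k (M : 'M[R[i]]_(m, k)) :
    \tr (M *m (M ^T ^ Num.conj)%sesqui) = (hsnorm2 M)%:C.
  rewrite /hsnorm2 rmorph_sum/=; apply: eq_bigr => i _.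
  rewrite mxE rmorph_sum/=; apply: eq_bigr => j _.
  by rewrite !mxE mulC_conj.
have tr k l (M : 'M[R[i]]_(k, l)) : hsnorm2 M^T = hsnorm2 M.
  by rewrite /hsnorm2 exchange_big/=; do 2 (apply: eq_bigr => ? _); rewrite mxE.
rewrite tr; apply: (@complexI R); rewrite -HS.
(* The rows of [S] are orthonormal, so [L] and [B] have the same Gram matrix, hence the same
   Hilbert-Schmidt norm. *)
have -> : L *m (L ^T ^ Num.conj)%sesqui = B *m (B ^T ^ Num.conj)%sesqui.
  by rewrite BL trmx_mul map_mxM !mulmxA -(mulmxA L) SS mulmx1.
rewrite HS /B tr; congr (_%:C); rewrite /hsnorm2 big_split_ord/=; congr (_ + _).
  by do 2 (apply: eq_bigr => ? _); rewrite col_mxEu.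
rewrite -[m in RHS]card_ord -sumr_const; apply: eq_bigr => i _.
rewrite (bigD1 i)//= col_mxEd mxE eqxx mulr1n nrmC_real real_normK ?num_real//.
rewrite big1 ?addr0// => j ji; rewrite col_mxEd mxE eq_sym (negbTE ji) mulr0n.
by rewrite nrm0 expr0n.
Qed.

Lemma sandwich_col_block (Y : lmodType R[i]) n k m (y : 'M[Y]_n) (w : 'M[Y]_k)
    (r q : 'M[R[i]]_(n, m)) (r' q' : 'M[R[i]]_(k, m)) :
  sandwich (col_mx r r') (block_mx y 0 0 w) (col_mx q q') =
  sandwich r y q + sandwich r' w q'.
Proof.
have z0 k1 k2 (s : 'I_k1) (t : 'I_k2) : (0 : 'M[Y]_(k1, k2)) s t = 0.
  by rewrite mxE.
apply/matrixP => i j; rewrite !mxE big_split_ord/=; congr (_ + _).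
  apply: eq_bigr => s _; rewrite big_split_ord/= [X in _ + X]big1 ?addr0.
    by apply: eq_bigr => t _; rewrite block_mxEul !col_mxEu.
  by move=> t _; rewrite block_mxEur z0 scaler0.
apply: eq_bigr => s _; rewrite big_split_ord/= [X in X + _]big1 ?add0r.
  by apply: eq_bigr => t _; rewrite block_mxEdr !col_mxEd.
by move=> t _; rewrite block_mxEdl z0 scaler0.
Qed.

Lemma sandwich0 (Y : lmodType R[i]) n m p (r : 'I_n -> 'I_m -> R[i])
    (q : 'I_n -> 'I_p -> R[i]) : sandwich r (0 : 'M[Y]_n) q = 0.
Proof.
apply/matrixP => i j; rewrite !mxE big1// => s _; rewrite big1// => t _.
by rewrite mxE scaler0.
Qed.

End Sandwich.

Lemma exchange_big4 (V : nmodType) (I J K L : finType)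
    (F : I -> J -> K -> L -> V) :
  \sum_i \sum_j \sum_k \sum_l F i j k l =
  \sum_k \sum_l \sum_i \sum_j F i j k l.
Proof.
rewrite pair_bigA exchange_big/=; under eq_bigr do rewrite exchange_big/=.
by apply: eq_bigr => k _; apply: eq_bigr => l _; rewrite pair_bigA.
Qed.

(** * The extension theorem for a single matrix algebra *)

Section Wittstock.
Context (R : realType) (X Y : opSpaceType R) (i : {linear X -> Y}) (m : nat)
  (f : {linear X -> 'M[R[i]]_m}).
Hypotheses (isoi : complete_isometry i) (ccf : complete_contraction f).

Let U : lmodType R[i] := 'I_m -> 'I_m -> Y.

(* [p] below is the gauge of [{b^* y a | |y| <= 1}]: a linear functional on
   [U] is dominated by [p] exactly when it comes from a completely contractive
   map [Y -> M_m]. *)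
Let cost (u : U) : set R := [set t | exists n (y : 'M[Y]_n) (b a : 'M[R[i]]_(n, m)),
  [/\ mxnorm y <= 1, forall k l, u k l = sandwich b y a k l
    & t = (hsnorm2 a + hsnorm2 b) / 2]].

Let p (u : U) := inf (cost u).

Lemma hsnorm2_ge0 n k (a : 'I_n -> 'I_k -> R[i]) : 0 <= hsnorm2 a.
Proof. by apply: sumr_ge0 => j _; apply: sumr_ge0 => l _; rewrite sqr_ge0. Qed.

Lemma hsnorm2Z n k (t : R) (a : 'M[R[i]]_(n, k)) :
  hsnorm2 (t%:C *: a) = t ^+ 2 * hsnorm2 a.
Proof.
rewrite /hsnorm2 mulr_sumr; apply: eq_bigr => j _.
rewrite mulr_sumr; apply: eq_bigr => l _.
by rewrite mxE nrmCM nrmC_real exprMn real_normK ?num_real.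
Qed.

Lemma hsnorm2_col n k l (a : 'M[R[i]]_(n, l)) (b : 'M[R[i]]_(k, l)) :
  hsnorm2 (col_mx a b) = hsnorm2 a + hsnorm2 b.
Proof.
rewrite /hsnorm2 big_split_ord/=; congr (_ + _); do 2 (apply: eq_bigr => ? _).
  by rewrite col_mxEu.
by rewrite col_mxEd.
Qed.

Lemma sandwichZ n k l (t : R) (r : 'M[R[i]]_(n, k)) (y : 'M[Y]_n)
    (q : 'M[R[i]]_(n, l)) : sandwich (t%:C *: r) y (t%:C *: q) =
  map_mx (fun u => (t ^+ 2)%:C *: u) (sandwich r y q).
Proof.
apply/matrixP => s s'; rewrite !mxE scaler_sumr; apply: eq_bigr => j _.
rewrite scaler_sumr; apply: eq_bigr => j' _; rewrite !mxE scalerA.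
by congr (_ *: _); rewrite rmorphM/= conj_real rmorphXn/=; ring.
Qed.

Lemma sandwich_mapZ n k l (t : R[i]) (r : 'M[R[i]]_(n, k)) (y : 'M[Y]_n)
    (q : 'M[R[i]]_(n, l)) :
  sandwich r (map_mx (fun u => t *: u) y) q =
  map_mx (fun u => t *: u) (sandwich r y q).
Proof.
apply/matrixP => s s'; rewrite !mxE scaler_sumr; apply: eq_bigr => j _.
rewrite scaler_sumr; apply: eq_bigr => j' _; rewrite !mxE !scalerA.
by congr (_ *: _); ring.
Qed.

Lemma mxnormZ_le1 n (y : 'M[Y]_n) c : 0 < c -> mxnorm y <= c ->
  mxnorm (map_mx (fun u : Y => (c^-1)%:C *: u) y) <= 1.
Proof.
move=> c0 yc; have v0 : 0 <= c^-1 by rewrite invr_ge0 ltW.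
by rewrite (le_trans (mxnormZ _ v0))// ler_pdivrMl// mulr1.
Qed.

Let cost_ge0 u : lbound (cost u) 0.
Proof.
by move=> _ [n [y [b [a [_ _ ->]]]]]; rewrite divr_ge0// addr_ge0// hsnorm2_ge0.
Qed.

Let cost_scale (t : R) u r : 0 <= t -> cost u r -> cost (t%:C *: u) (t * r).
Proof.
move=> t0 [n [y [b [a [y1 uE ->]]]]].
exists n, y, ((Num.sqrt t)%:C *: b), ((Num.sqrt t)%:C *: a); split=> // [k l|].
  by rewrite sandwichZ mxE -uE sqr_sqrtr.
by rewrite !hsnorm2Z sqr_sqrtr// -mulrDr mulrA.
Qed.

Let cost_neq0 u : cost u !=set0.
Proof.
pose y := \matrix_(k, l) u k l; pose c := mxnorm y + 1.
have c0 : 0 < c by rewrite ltr_wpDl// mxnorm_ge0.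
have : cost ((c^-1)%:C *: u) ((hsnorm2 (1%:M : 'M[R[i]]_m) +
    hsnorm2 (1%:M : 'M[R[i]]_m)) / 2).
  exists m, (map_mx (fun u : Y => (c^-1)%:C *: u) y), 1%:M, 1%:M; split=> //.
    by rewrite mxnormZ_le1// lerDl.
  by move=> k l; rewrite sandwich1 !mxE.
move=> /(cost_scale (ltW c0)); rewrite scalerA -rmorphM mulfV ?gt_eqF//.
by rewrite rmorph1 scale1r => ?; eexists; eassumption.
Qed.

Let has_inf_cost u : has_inf (cost u).
Proof. by split; [exact: cost_neq0|exists 0; exact: cost_ge0]. Qed.

Let p_le u t : cost u t -> p u <= t.
Proof. by move=> ut; apply: ge_inf => //; have [] := has_inf_cost u. Qed.

Let p_ge u t : lbound (cost u) t -> t <= p u.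
Proof. by move=> h; apply: lb_le_inf => //; exact: cost_neq0. Qed.

(** Two factorizations are stacked: [y] and [y'] go into a block sum, the scalar factors on top of
    each other. Hilbert-Schmidt squares add under stacking, which is why the cost is a half-sum of
    squares and not a product of norms. *)
Let pD u v : p (u + v) <= p u + p v.
Proof.
rewrite -lerBlDr; apply: p_ge => _ [n [y [b [a [y1 uE ->]]]]].
rewrite lerBlDr -lerBlDl; apply: p_ge => _ [n' [y' [b' [a' [y'1 vE ->]]]]].
rewrite lerBlDl; apply: p_le.
exists (n + n')%N, (block_mx y 0 0 y'), (col_mx b b'), (col_mx a a'); split.
- exact: mxnorm_block.
- by move=> k l; rewrite sandwich_col_block mxE -uE -vE.
- by rewrite !hsnorm2_col; lra.
Qed.

Let pZ (t : R) u : 0 <= t -> p (t%:C *: u) <= t * p u.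
Proof.
move=> t0; have h r : cost u r -> p (t%:C *: u) <= t * r.
  by move=> ur; apply: p_le; exact: cost_scale.
have [tn|tn] := eqVneq t 0.
  have [r ur] := cost_neq0 u.
  by rewrite (le_trans (h r ur))// tn !mul0r.
have tp : 0 < t by rewrite lt_def tn.
rewrite -ler_pdivrMl//; apply: p_ge => r ur.
by rewrite ler_pdivrMl// h.
Qed.

(** A map [f] into [M_m] is the same as the functional sending [x] in [M_m(X)] to the sum of the
    scalars [f (x k l) k l]. The graph carries it along [i] to a subspace of [U]. *)
Let graph : set (U * R) := [set ur | exists2 x : 'M[X]_m,
  ur.1 = (fun k l => i (x k l)) & ur.2 = re (\sum_k \sum_l f (x k l) k l)].

(** The obstacle is that [y] has entries in [Y], while [f] is defined on [X] only. After padding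
    with [eps], the factors split as isometric columns times invertible [alpha] and [beta]. The
    isometric parts compress [y] to a contraction [z], and invertibility makes [z] the image of some
    [w] over [X], which has norm at most 1 since [i] is a complete isometry. Complete contractivity
    of [f] at [w] gives the bound; the padding costs [eps ^+ 2 *+ m]. *)
Let graph_le_eps n (y : 'M[Y]_n) (b a : 'M[R[i]]_(n, m)) (x : 'M[X]_m) eps :
  0 < eps -> mxnorm y <= 1 -> map_mx i x = sandwich b y a ->
  re (\sum_k \sum_l f (x k l) k l) <=
  (hsnorm2 a + hsnorm2 b) / 2 + eps ^+ 2 *+ m.
Proof.
move=> e0 y1 xE.
have [q [alpha [iq ualpha aE na]]] := isometric_factorization a e0.
have [r [beta [ir ubeta bE nb]]] := isometric_factorization b e0.
pose y' := block_mx y 0 0 (0 : 'M[Y]_m).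
pose z := sandwich r y' q.
have z1 : mxnorm z <= 1.
  by rewrite (le_trans (mxnorm_sandwich _ ir iq))// mxnorm_block// mxnorm0.
have xz : map_mx i x = sandwich beta z alpha.
  by rewrite /z sandwich_comp -aE -bE sandwich_col_block sandwich0 addr0.
pose w := sandwich (invmx beta) x (invmx alpha).
have wz : map_mx i w = z.
  by rewrite sandwich_lin xz sandwich_comp !mulmxV// sandwich1.
have w1 : mxnorm w <= 1 by rewrite -isoi wz.
have xw : x = sandwich beta w alpha.
  by rewrite /w sandwich_comp !mulVmx// sandwich1.
have := (mx_mxnormP _ ler01).1 (le_trans (ccf w) w1) (fun t l => alpha t l)
  (fun s k => beta s k).
rewrite -/(hsnorm2 alpha) -/(hsnorm2 beta) na nb => h.
apply: (@le_trans _ _ (1 * ((hsnorm2 a + eps ^+ 2 *+ m +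
  (hsnorm2 b + eps ^+ 2 *+ m)) / 2))); last by lra.
apply: le_trans h; rewrite le_eqVlt; apply/orP; left; apply/eqP.
congr (re _).
transitivity (\sum_k \sum_l \sum_s \sum_t
    f (w s t) k l * alpha t l * Num.conj (beta s k)).
  apply: eq_bigr => k _; apply: eq_bigr => l _.
  rewrite {1}xw sum_sandwich summxE; apply: eq_bigr => s _.
  rewrite summxE; apply: eq_bigr => t _.
  by rewrite mxE; ring.
under eq_bigr do rewrite exchange_big/=.
rewrite exchange_big/=; apply: eq_bigr => s _.
under eq_bigr do rewrite exchange_big/=.
rewrite exchange_big/=; apply: eq_bigr => t _.
by apply: eq_bigr => k _; apply: eq_bigr => l _; rewrite [in RHS]mxE.
Qed.

Let graph_le u r : graph (u, r) -> r <= p u.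
Proof.
move=> [x /= uE ->]; apply: p_ge => _ [n [y [b [a [y1 uE' ->]]]]].
have xE : map_mx i x = sandwich b y a.
  by apply/matrixP => k l; rewrite mxE -uE' uE.
apply/ler_addgt0Pr => e e0.
(* The perturbation is taken with square [e / (m + 1)]: times [m] this is at most [e], also when
   [m = 0]. *)
have s0 : 0 < e / m.+1%:R by rewrite divr_gt0// ltr0n.
have sp : 0 < Num.sqrt (e / m.+1%:R) by rewrite sqrtr_gt0.
apply: (le_trans (graph_le_eps sp y1 xE)); rewrite lerD2l sqr_sqrtr; last exact: ltW.
rewrite -[leLHS]mulr_natr mulrAC ler_pdivrMr ?ltr0n//.
by apply: ler_wpM2l; [exact: ltW|rewrite ler_nat].
Qed.

Let graphD u v r q (t : R) : graph (u, r) -> graph (v, q) ->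
  graph (u + t%:C *: v, r + t * q).
Proof.
move=> [x /= -> ->] [x' /= -> ->].
exists (\matrix_(k, l) (x k l + t%:C *: x' k l)) => /=.
  by apply/funext => k; apply/funext => l; rewrite mxE linearD linearZ.
rewrite -reZ -reD mulr_sumr -big_split/=; congr (re _); apply: eq_bigr => k _.
rewrite mulr_sumr -big_split/=; apply: eq_bigr => l _.
by rewrite [in RHS]mxE linearD linearZ !mxE.
Qed.

Let graph0 : graph (0, 0).
Proof.
exists 0 => /=.
  by apply/funext => k; apply/funext => l; rewrite mxE linear0.
rewrite big1 ?re0// => k _; rewrite big1// => l _.
by rewrite mxE linear0 mxE.
Qed.

Let unit_fun k l (y : Y) : U :=
  fun k' l' => if (k' == k) && (l' == l) then y else 0.

Let unit_fun_lin k l a (y y' : Y) :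
  unit_fun k l (a *: y + y') = a *: unit_fun k l y + unit_fun k l y'.
Proof.
apply/funext => k'; apply/funext => l'.
have E (u v : U) : (a *: u + v) k' l' = a *: u k' l' + v k' l' by [].
by rewrite E /unit_fun; case: ifP => // _; rewrite scaler0 addr0.
Qed.

Let unit_fun_sum (u : U) : u = \sum_k \sum_l unit_fun k l (u k l).
Proof.
apply/funext => k'; apply/funext => l'.
have E (F : 'I_m -> U) : (\sum_k F k) k' l' = \sum_k F k k' l'.
  by apply: (big_morph (fun v : U => v k' l')).
rewrite E; under eq_bigr do rewrite E.
rewrite (bigD1 k')//= (bigD1 l')//= /unit_fun !eqxx !big1 ?addr0//.
  by move=> k kk; rewrite big1// => l _; rewrite eq_sym (negbTE kk).
by move=> l ll; rewrite andbC eq_sym (negbTE ll).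
Qed.

Lemma wittstock_mx : exists2 g : {linear Y -> 'M[R[i]]_m},
  complete_contraction g & forall x, g (i x) = f x.
Proof.
have [s [sD sp sG]] := hahn_banach pD pZ graph0 graphD graph_le.
have sDD u v : s (u + v) = s u + s v by have := sD 1 u v; rewrite scale1r mul1r.
have s0 : s 0 = 0 by have := sG _ _ graph0.
have sZ (t : R) u : s (t%:C *: u) = t * s u.
  by have := sD t 0 u; rewrite add0r s0 add0r.
have sN u : s (- u) = - s u by rewrite -scaleN1r -(rmorphN1 (real_complex R)) sZ mulN1r.
(* The complex-linear functional with real part [s]: its imaginary part at [u] is minus the real
   part at ['i *: u]. *)
pose S (u : U) : R[i]^o := s u +i* (- s ('i *: u)).
have S_lin : linear S.
  move=> a u v; have aE : a = (re a)%:C + (im a)%:C * 'i.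
    by case: (a) => a1 a2; apply: complex_eqP => /=; ring.
  apply: complex_eqP.
    rewrite /= {1}aE scalerDl sDD sDD sZ -scalerA sZ reD reM /=.
    by ring.
  rewrite /= scalerDr scalerA {1}aE mulrDr scalerDl imD imM /=.
  rewrite (_ : 'i * _%:C = (re a)%:C * 'i); last by rewrite mulrC.
  rewrite (_ : 'i * (_%:C * 'i) = (- im a)%:C); last first.
    by apply: complex_eqP => /=; ring.
  by rewrite !sDD -scalerA !sZ; ring.
pose Sl := GRing.isLinear.Build R[i] U R[i]^o *:%R S S_lin.
pose Slin : {linear U -> R[i]^o} := HB.pack S Sl.
pose G (y : Y) : 'M[R[i]]_m := \matrix_(k, l) S (unit_fun k l y).
have G_lin : linear G.
  by move=> a y y'; apply/matrixP => k l; rewrite !mxE unit_fun_lin S_lin.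
pose Gl := GRing.isLinear.Build R[i] Y 'M[R[i]]_m *:%R G G_lin.
pose Glin : {linear Y -> 'M[R[i]]_m} := HB.pack G Gl.
exists Glin => [n y|x]; last first.
  have sE x' k l : s (unit_fun k l (i x')) = re (f x' k l).
    apply: sG; exists (\matrix_(k', l') if (k' == k) && (l' == l) then x' else 0) => /=.
      by apply/funext => k'; apply/funext => l'; rewrite mxE /unit_fun; case: ifP => // _; rewrite linear0.
    congr (re _); rewrite (bigD1 k)//= (bigD1 l)//= mxE !eqxx/= !big1 ?addr0//.
      by move=> k' kk; rewrite big1// => l' _; rewrite mxE (negbTE kk)/= linear0 mxE.
    by move=> l' ll; rewrite mxE (negbTE ll) andbF linear0 mxE.
  apply/matrixP => k l; rewrite mxE; apply: complex_eqP; rewrite /= ?sE//.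
  have -> : 'i *: unit_fun k l (i x) = unit_fun k l (i ('i *: x)).
    have := unit_fun_lin k l 'i (i x) 0; rewrite addr0 linearZ => ->.
    rewrite (_ : unit_fun k l 0 = 0) ?addr0//.
    by apply/funext => k'; apply/funext => l'; rewrite /unit_fun; case: ifP.
  by rewrite sE linearZ mxE reM /=; ring.
(* A bound strictly above [mxnorm y] is positive, so that [y] can be divided by it. *)
suff h c : mxnorm y < c -> mxnorm (map_mx G y) <= c.
  by apply/ler_addgt0Pr => e e0; apply: h; rewrite ltrDl.
move=> yc; have c0 : 0 < c by rewrite (le_lt_trans _ yc)// mxnorm_ge0.
apply/mx_mxnormP => [|a b]; first exact: ltW.
pose A : 'M[R[i]]_(n, m) := \matrix_(j, l) a j l.
pose B : 'M[R[i]]_(n, m) := \matrix_(j, l) b j l.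
pose u : U := fun k l => sandwich B y A k l.
(* Testing the norm of [G y] against [a] and [b] is evaluating [s] at [B^* y A]. Once [y] is divided
   by [c], the cost of this element is at most half the sum of the squares of [a] and [b]. *)
have -> : re (\sum_i \sum_j \sum_k \sum_l
    map_mx G y i j k l * a j l * Num.conj (b i k)) = s u.
  transitivity (re (Slin u)); last by [].
  congr (re _); rewrite (unit_fun_sum u) linear_sum.
  transitivity (\sum_k \sum_l \sum_i0 \sum_j
      map_mx G y i0 j k l * a j l * Num.conj (b i0 k)); last first.
    apply: eq_bigr => k _; rewrite linear_sum; apply: eq_bigr => l _.
    rewrite /u mxE.
    pose F (v : Y) : R[i]^o := Slin (unit_fun k l v).
    have Fl : linear F by move=> c' v v'; rewrite /F unit_fun_lin linearP.
    pose Fm := GRing.isLinear.Build R[i] Y R[i]^o *:%R F Fl.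
    pose Flin : {linear Y -> R[i]^o} := HB.pack F Fm.
    rewrite -/(F _) -[F _]/(Flin _) linear_sum; apply: eq_bigr => i0 _.
    rewrite linear_sum; apply: eq_bigr => j _; rewrite linearZ/= !mxE.
    by rewrite -mulrA mulrC.
  exact: exchange_big4.
have -> : u = c%:C *: ((c^-1)%:C *: u).
  by rewrite scalerA -rmorphM mulfV ?gt_eqF// rmorph1 scale1r.
rewrite sZ; apply: ler_wpM2l; [exact: ltW|]; apply: (le_trans (sp _)); apply: p_le.
exists n, (map_mx (fun v : Y => (c^-1)%:C *: v) y), B, A; split=> [|k l|].
- by rewrite mxnormZ_le1// ltW.
- by rewrite sandwich_mapZ [in RHS]mxE.
- congr ((_ + _) / _); do 2 (apply: eq_bigr => ? _); by rewrite mxE.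
Qed.

End Wittstock.

(** * The l2 sum of finite-dimensional Hilbert spaces *)

Section UnorderedSums.
Context (R : realType) (A : eqType).
Implicit Types (u v : A -> R) (s : seq A).

Definition summable u :=
  exists c : R, forall s, uniq s -> \sum_(a <- s) `|u a| <= c.

(* [nsum] is only meaningful for nonnegative families. *)
Definition nsum u := sup [set r | exists2 s, uniq s & r = \sum_(a <- s) u a].

(** A signed family is the difference of the nonnegative families [|u| + u] and [|u|]. *)
Definition rsum u := nsum (fun a => `|u a| + u a) - nsum (fun a => `|u a|).

Lemma summable_le u v : summable v -> (forall a, `|u a| <= `|v a|) -> summable u.
Proof.
move=> [c hc] uv; exists c => s us; rewrite (le_trans _ (hc s us))//.
exact: ler_sum.
Qed.

Lemma summableD u v : summable u -> summable v -> summable (fun a => u a + v a).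
Proof.
move=> [c hc] [d hd]; exists (c + d) => s us.
rewrite (le_trans _ (lerD (hc s us) (hd s us)))// -big_split/=.
by apply: ler_sum => a _; exact: ler_normD.
Qed.

Lemma summableZ (t : R) u : summable u -> summable (fun a => t * u a).
Proof.
move=> [c hc]; exists (`|t| * c) => s us.
under eq_bigr do rewrite normrM.
by rewrite -mulr_sumr ler_wpM2l ?hc.
Qed.

Lemma summable_norm u : summable u -> summable (fun a => `|u a|).
Proof. by move=> us; apply: summable_le us _ => a; rewrite normr_id. Qed.

Lemma has_sup_nsum u : summable u ->
  has_sup [set r | exists2 s, uniq s & r = \sum_(a <- s) u a].
Proof.
move=> [c hc]; split; first by exists 0, [::]; rewrite ?big_nil.
exists c => _ [s us ->]; rewrite (le_trans _ (hc s us))//.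
by apply: ler_sum => a _; exact: ler_norm.
Qed.

Lemma nsum_ub u s : summable u -> uniq s -> \sum_(a <- s) u a <= nsum u.
Proof. by move=> hu us; apply: (ub_le_sup (has_sup_nsum hu).2); exists s. Qed.

Lemma nsum_le u (c : R) :
  (forall s, uniq s -> \sum_(a <- s) u a <= c) -> nsum u <= c.
Proof.
move=> h; apply: ge_sup; first by exists 0, [::]; rewrite ?big_nil.
by move=> _ [s us ->]; exact: h.
Qed.

Lemma nsum_ge0 u : summable u -> 0 <= nsum u.
Proof. by move=> hu; have := nsum_ub hu (isT : uniq [::]); rewrite big_nil. Qed.

Lemma nsum_term u a : summable u -> u a <= nsum u.
Proof.
by move=> hu; have := nsum_ub hu (isT : uniq [:: a]); rewrite big_seq1.
Qed.

Lemma le_nsum u v : summable v -> (forall a, u a <= v a) -> nsum u <= nsum v.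
Proof.
move=> hv uv; apply: nsum_le => s us; rewrite (le_trans _ (nsum_ub hv us))//.
exact: ler_sum.
Qed.

Lemma nsumD u v : (forall a, 0 <= u a) -> (forall a, 0 <= v a) ->
  summable u -> summable v -> nsum (fun a => u a + v a) = nsum u + nsum v.
Proof.
move=> u0 v0 hu hv; apply/eqP; rewrite eq_le; apply/andP; split.
  by apply: nsum_le => s us; rewrite big_split/= lerD// nsum_ub.
have mono (w : A -> R) s t : (forall a, 0 <= w a) -> uniq s -> uniq t ->
    {subset s <= t} -> \sum_(a <- s) w a <= \sum_(a <- t) w a.
  move=> w0 us ut st.
  have <- : \sum_(a <- t | a \in s) w a = \sum_(a <- s) w a.
    rewrite -big_filter; apply: perm_big; apply: uniq_perm => //.
      exact: filter_uniq.
    by move=> a; rewrite mem_filter; case: (boolP (a \in s)) => // /st.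
  by rewrite [leRHS](bigID (mem s))/= lerDl sumr_ge0.
rewrite -lerBrDr; apply: nsum_le => s us; rewrite lerBrDr -lerBrDl.
apply: nsum_le => t ut; rewrite lerBrDl.
(* Finite sets chosen separately for [u] and for [v] are both majorized on their union. *)
have uu : uniq (undup (s ++ t)) by exact: undup_uniq.
rewrite (le_trans _ (nsum_ub (summableD hu hv) uu))// big_split/= lerD// mono//.
  by move=> a a_s; rewrite mem_undup mem_cat a_s.
by move=> a a_t; rewrite mem_undup mem_cat a_t orbT.
Qed.

Lemma nsum0 : nsum (fun=> 0) = 0.
Proof.
apply/eqP; rewrite eq_le; apply/andP; split.
  by apply: nsum_le => s _; rewrite big1.
by apply: nsum_ge0; exists 0 => s _; rewrite big1// => a _; rewrite normr0.
Qed.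

Lemma nsumZ (t : R) u : 0 <= t -> summable u ->
  nsum (fun a => t * u a) = t * nsum u.
Proof.
move=> t0 hu; have [->|tn] := eqVneq t 0.
  rewrite mul0r -[RHS]nsum0; congr nsum; apply/funext => a; exact: mul0r.
have tp : 0 < t by rewrite lt_def tn.
apply/eqP; rewrite eq_le; apply/andP; split.
  by apply: nsum_le => s us; rewrite -mulr_sumr ler_wpM2l// nsum_ub.
rewrite -ler_pdivlMl//; apply: nsum_le => s us; rewrite ler_pdivlMl//.
by rewrite mulr_sumr nsum_ub//; exact: summableZ.
Qed.

(** Any other decomposition into nonnegative summable families gives the same value; linearity of
    [rsum] follows by picking convenient ones. *)
Lemma rsum_diff u v w : (forall a, 0 <= v a) -> (forall a, 0 <= w a) ->
  summable v -> summable w -> (forall a, u a = v a - w a) ->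
  rsum u = nsum v - nsum w.
Proof.
move=> v0 w0 hv hw uE.
have hu : summable u.
  have -> : u = (fun a => v a + (-1) * w a).
    by apply/funext => a; rewrite uE mulN1r.
  by apply: summableD => //; exact: summableZ.
have hn := summable_norm hu.
have hp : summable (fun a => `|u a| + u a) by exact: summableD.
apply/eqP; rewrite subr_eq addrAC eq_sym subr_eq; apply/eqP.
rewrite -!nsumD// => [|a]; last by rewrite -lerBlDr sub0r ler_normr lexx orbT.
by congr nsum; apply/funext => a; rewrite uE; ring.
Qed.

Lemma rsum_ge0 u : (forall a, 0 <= u a) -> summable u -> rsum u = nsum u.
Proof.
move=> u0 hu; rewrite (@rsum_diff u u (fun=> 0))//.
- by rewrite nsum0 subr0.
- by exists 0 => s _; rewrite big1// => a _; rewrite normr0.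
- by move=> a; rewrite subr0.
Qed.

Lemma rsumD u v : summable u -> summable v ->
  rsum (fun a => u a + v a) = rsum u + rsum v.
Proof.
move=> hu hv; have nu := summable_norm hu; have nv := summable_norm hv.
have p (w : A -> R) a : 0 <= `|w a| + w a.
  by rewrite -lerBlDr sub0r ler_normr lexx orbT.
have su := summableD nu hu; have sv := summableD nv hv.
rewrite (@rsum_diff _ (fun a => (`|u a| + u a) + (`|v a| + v a))
  (fun a => `|u a| + `|v a|)).
- rewrite (nsumD (p u) (p v) su sv).
  by rewrite (@nsumD (fun a => `|u a|) (fun a => `|v a|))// /rsum; ring.
- by move=> a; rewrite addr_ge0.
- by move=> a; rewrite addr_ge0.
- exact: summableD.
- exact: summableD.
- by move=> a /=; ring.
Qed.

Lemma rsumZ (t : R) u : summable u -> rsum (fun a => t * u a) = t * rsum u.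
Proof.
move=> hu; have nu := summable_norm hu; have su := summableD nu hu.
have p a : 0 <= `|u a| + u a by rewrite -lerBlDr sub0r ler_normr lexx orbT.
have [t0|/ltW t0] := leP 0 t.
  rewrite (@rsum_diff _ (fun a => t * (`|u a| + u a)) (fun a => t * `|u a|)).
  - by rewrite !nsumZ// /rsum; ring.
  - by move=> a; rewrite mulr_ge0.
  - by move=> a; rewrite mulr_ge0.
  - exact: summableZ.
  - exact: summableZ.
  - by move=> a /=; ring.
have s0 : 0 <= - t by rewrite oppr_ge0.
rewrite (@rsum_diff _ (fun a => (- t) * `|u a|)
  (fun a => (- t) * (`|u a| + u a))).
- by rewrite !nsumZ// /rsum; ring.
- by move=> a; rewrite mulr_ge0.
- by move=> a; rewrite mulr_ge0.
- exact: summableZ.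
- exact: summableZ.
- by move=> a /=; ring.
Qed.

End UnorderedSums.

Section DependentProduct.
Context (R : pzRingType) (A : Type) (E : A -> lmodType R).

Definition dprod := forall a, E a.

HB.instance Definition _ := gen_eqMixin dprod.
HB.instance Definition _ := gen_choiceMixin dprod.

Let dext (x y : dprod) : (forall a, x a = y a) -> x = y.
Proof. exact: functional_extensionality_dep. Qed.

Let dprod0 : dprod := fun a => 0.
Let dprod_opp (x : dprod) : dprod := fun a => - x a.
Let dprod_add (x y : dprod) : dprod := fun a => x a + y a.
Let dprod_scale (t : R) (x : dprod) : dprod := fun a => t *: x a.

Let dprod_addA : associative dprod_add.
Proof. by move=> x y z; apply: dext => a; exact: addrA. Qed.

Let dprod_addC : commutative dprod_add.
Proof. by move=> x y; apply: dext => a; exact: addrC. Qed.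

Let dprod_add0 : left_id dprod0 dprod_add.
Proof. by move=> x; apply: dext => a; exact: add0r. Qed.

Let dprod_addN : left_inverse dprod0 dprod_opp dprod_add.
Proof. by move=> x; apply: dext => a; exact: addNr. Qed.

HB.instance Definition _ :=
  GRing.isZmodule.Build dprod dprod_addA dprod_addC dprod_add0 dprod_addN.

Let dprod_scaleA s t x : dprod_scale s (dprod_scale t x) = dprod_scale (s * t) x.
Proof. by apply: dext => a; exact: scalerA. Qed.

Let dprod_scale1 : left_id 1 dprod_scale.
Proof. by move=> x; apply: dext => a; exact: scale1r. Qed.

Let dprod_scaleDr : right_distributive dprod_scale +%R.
Proof. by move=> s x y; apply: dext => a; exact: scalerDr. Qed.

Let dprod_scaleDl x : {morph dprod_scale^~ x : s t / s + t}.
Proof. by move=> s t; apply: dext => a; exact: scalerDl. Qed.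

HB.instance Definition _ := GRing.Zmodule_isLmodule.Build R dprod
  dprod_scaleA dprod_scale1 dprod_scaleDr dprod_scaleDl.

Lemma dprodP (t : R) (x y : dprod) a : (t *: x + y) a = t *: x a + y a.
Proof. by []. Qed.

Lemma dprod_ext (x y : dprod) : (forall a, x a = y a) -> x = y.
Proof. exact: dext. Qed.

End DependentProduct.

Section L2Sum.
Context (R : realType) (A : choiceType) (m : A -> nat).

Definition blocks := dprod (fun a => 'cV[R[i]]_(m a) : lmodType R[i]).

Definition block_sq (x : blocks) (a : A) : R := l2norm (x a) ^+ 2.

Definition square_summable : {pred blocks} :=
  [pred x | `[< summable (block_sq x) >]].

Lemma l2normZ k (t : R[i]) (x : 'cV[R[i]]_k) :
  l2norm (t *: x) = nrm (t : R[i]^o) * l2norm x.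
Proof.
apply/eqP; rewrite -(eqrXn2 (n := 2)) ?mulr_ge0 ?nrm_ge0 ?l2norm_ge0//.
rewrite exprMn !l2norm_sqr mulr_sumr; apply/eqP/eq_bigr => i _.
by rewrite mxE nrmCM exprMn.
Qed.

Lemma l2normD k (x y : 'cV[R[i]]_k) : l2norm (x + y) <= l2norm x + l2norm y.
Proof.
exact: (ND (@l2norm_ge0 R k) (@l2norm_eq0 R k) (@cipDl R k) (@cipZl R k)
  (@cipC R k) (@cipxx R k)).
Qed.

Lemma sqr_addr_le (a b : R) : (a + b) ^+ 2 <= 2 * a ^+ 2 + 2 * b ^+ 2.
Proof. have := sqr_ge0 (a - b); lra. Qed.

Lemma block_sqP (t : R[i]) (x y : blocks) a : block_sq (t *: x + y) a <=
  2 * nrm (t : R[i]^o) ^+ 2 * block_sq x a + 2 * block_sq y a.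
Proof.
rewrite /block_sq dprodP; apply: le_trans (_ : _ <= (nrm (t : R[i]^o) * l2norm (x a) + l2norm (y a)) ^+ 2) _.
  by rewrite ler_pXn2r ?nnegrE ?addr_ge0 ?mulr_ge0 ?nrm_ge0 ?l2norm_ge0// -l2normZ l2normD.
by rewrite (le_trans (sqr_addr_le _ _))// exprMn mulrA.
Qed.

Lemma block_sq_ge0 x a : 0 <= block_sq x a.
Proof. exact: sqr_ge0. Qed.

Lemma square_summable_submod : submod_closed square_summable.
Proof.
split=> [|t x y /asboolP hx /asboolP hy]; apply/asboolP.
  exists 0 => s _; rewrite big1// => a _; rewrite /block_sq.
  rewrite (_ : (0 : blocks) a = 0 *: 0 :> 'cV[R[i]]_(m a)); last by rewrite scale0r.
  by rewrite l2normZ nrm0 mul0r expr0n normr0.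
apply: (@summable_le _ _ _ (fun a => 2 * nrm (t : R[i]^o) ^+ 2 * block_sq x a + 2 * block_sq y a)).
  by apply: summableD; exact: summableZ.
move=> a; rewrite ger0_norm ?block_sq_ge0// (le_trans (block_sqP _ _ _ _))//.
exact: ler_norm.
Qed.

HB.instance Definition _ :=
  GRing.isSubmodClosed.Build R[i] blocks square_summable square_summable_submod.

Record l2sum := L2Sum { l2fun :> blocks ; _ : l2fun \in square_summable }.

HB.instance Definition _ := [isSub for l2fun].
HB.instance Definition _ := [Choice of l2sum by <:].
HB.instance Definition _ := [SubChoice_isSubLmodule of l2sum by <:].

Implicit Types x y z : l2sum.

Lemma l2_summable x : summable (block_sq x).
Proof. by case: x => x /= /asboolP. Qed.

Lemma l2funP (t : R[i]) x y a :
  l2fun (t *: x + y) a = t *: l2fun x a + l2fun y a.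
Proof. by []. Qed.

Lemma l2funD x y a : l2fun (x + y) a = l2fun x a + l2fun y a.
Proof. by []. Qed.

Lemma l2funZ (t : R[i]) x a : l2fun (t *: x) a = t *: l2fun x a.
Proof. by []. Qed.

Lemma l2fun_inj x y : (forall a, l2fun x a = l2fun y a) -> x = y.
Proof. by move=> xy; apply: val_inj; apply: dprod_ext. Qed.

Definition l2norm_sum x : R := Num.sqrt (nsum (block_sq x)).

Definition l2rip x y : R := rsum (fun a => cip (l2fun x a) (l2fun y a)).

Lemma summable_cip x y : summable (fun a => cip (l2fun x a) (l2fun y a)).
Proof.
apply: (@summable_le _ _ _ (fun a => block_sq x a + block_sq y a)).
  by apply: summableD; exact: l2_summable.
move=> a; rewrite [leRHS]ger0_norm ?addr_ge0 ?block_sq_ge0//.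
have amgm (u v : 'cV[R[i]]_(m a)) : cip u v <= (l2norm u ^+ 2 + l2norm v ^+ 2) / 2.
  exact: (ip_amgm (@cipDl R _) (@cipZl R _)
    (@cipC R _) (@cipxx R _)).
rewrite ler_norml /block_sq; apply/andP; split; last first.
  have := amgm (l2fun x a) (l2fun y a); have := sqr_ge0 (l2norm (l2fun x a)).
  by have := sqr_ge0 (l2norm (l2fun y a)); lra.
have := amgm ((-1)%:C *: l2fun x a) (l2fun y a); rewrite cipZl l2normZ nrmC_real normrN1 mul1r.
have := sqr_ge0 (l2norm (l2fun x a)).
by have := sqr_ge0 (l2norm (l2fun y a)); lra.
Qed.

Lemma l2ripDl y x x' : l2rip (x + x') y = l2rip x y + l2rip x' y.
Proof.
rewrite /l2rip -rsumD; [|exact: summable_cip|exact: summable_cip].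
by congr rsum; apply/funext => a; rewrite l2funD cipDl.
Qed.

Lemma l2ripZl (t : R) x y : l2rip (t%:C *: x) y = t * l2rip x y.
Proof.
rewrite /l2rip -rsumZ; last exact: summable_cip.
by congr rsum; apply/funext => a; rewrite l2funZ cipZl.
Qed.

Lemma l2ripC x y : l2rip x y = l2rip y x.
Proof. by congr rsum; apply/funext => a; rewrite cipC. Qed.

Lemma l2ripxx x : l2rip x x = l2norm_sum x ^+ 2.
Proof.
rewrite sqr_sqrtr ?nsum_ge0//; last exact: l2_summable.
rewrite -rsum_ge0; [|exact: block_sq_ge0|exact: l2_summable].
by congr rsum; apply/funext => a; rewrite cipxx.
Qed.

Lemma cip_i k (u v : 'cV[R[i]]_k) : cip ('i *: u) ('i *: v) = cip u v.
Proof.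
rewrite /cip; congr (re _); apply: eq_bigr => j _; rewrite !mxE rmorphM/=.
rewrite !conjE; case: (u j 0) => a b; case: (v j 0) => c d.
by apply: complex_eqP => /=; ring.
Qed.

Lemma l2rip_i x y : l2rip ('i *: x) ('i *: y) = l2rip x y.
Proof. by congr rsum; apply/funext => a; rewrite !l2funZ cip_i. Qed.

Lemma l2norm_sum_ge0 x : 0 <= l2norm_sum x.
Proof. exact: sqrtr_ge0. Qed.

Lemma l2norm_sum_sqr x : l2norm_sum x ^+ 2 = nsum (block_sq x).
Proof. by rewrite sqr_sqrtr// nsum_ge0//; exact: l2_summable. Qed.

Lemma l2norm_le_sum x a : l2norm (l2fun x a) <= l2norm_sum x.
Proof.
rewrite -(ler_pXn2r (n := 2)) ?nnegrE ?l2norm_sum_ge0 ?l2norm_ge0//.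
rewrite l2norm_sum_sqr.
exact: (nsum_term a (l2_summable x)).
Qed.

Lemma l2norm_sum_eq0 x : l2norm_sum x = 0 -> x = 0.
Proof.
move=> x0; apply: l2fun_inj => a; apply: l2norm_eq0.
by apply/eqP; rewrite eq_le l2norm_ge0 andbT -x0 l2norm_le_sum.
Qed.

Lemma l2norm_sumD x y : l2norm_sum (x + y) <= l2norm_sum x + l2norm_sum y.
Proof.
exact: (ND l2norm_sum_ge0 l2norm_sum_eq0 l2ripDl l2ripZl l2ripC l2ripxx).
Qed.

Lemma l2norm_sumZ (t : R[i]) x :
  l2norm_sum (t *: x) = nrm (t : R[i]^o) * l2norm_sum x.
Proof.
rewrite -[nrm _]ger0_norm ?nrm_ge0// -sqrtr_sqr -sqrtrM ?sqr_ge0//.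
rewrite -nsumZ ?sqr_ge0//; last exact: l2_summable.
congr (Num.sqrt (nsum _)); apply/funext => a.
by rewrite /block_sq l2funZ l2normZ exprMn.
Qed.

Let cnorm x : R[i] := (l2norm_sum x)%:C.

Let cnormD x y : cnorm (x + y) <= cnorm x + cnorm y.
Proof. by rewrite -rmorphD lecR l2norm_sumD. Qed.

Let cnormZ (t : R[i]) x : cnorm (t *: x) = `|t| * cnorm x.
Proof. by rewrite (nrmE (t : R[i]^o)) -rmorphM -l2norm_sumZ. Qed.

Let cnorm_eq0 x : cnorm x = 0 -> x = 0.
Proof. by move=> /(@complexI R)/l2norm_sum_eq0. Qed.

HB.instance Definition _ :=
  Lmodule_isNormed.Build R[i] l2sum cnormD cnormZ cnorm_eq0.

Lemma nrm_l2 x : nrm x = l2norm_sum x.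
Proof. by []. Qed.

End L2Sum.

Lemma imB (R : realType) (z w : R[i]) : im (z - w) = im z - im w.
Proof. by case: z; case: w. Qed.

Section RealLimits.
Context (R : realType) (T : Type) (F : set_system T) (FF : ProperFilter F).
Implicit Types (u v : T -> R).

Lemma cvg_addr u v (a b : R) : u @ F --> a -> v @ F --> b ->
  (fun t => u t + v t) @ F --> (a + b : R).
Proof. by move=> ua vb; apply: cvgD. Qed.

Lemma cvg_mulr u v (a b : R) : u @ F --> a -> v @ F --> b ->
  (fun t => u t * v t) @ F --> (a * b : R).
Proof. by move=> ua vb; apply: cvgM. Qed.

Lemma cvg_sumr (I : Type) (s : seq I) (u : I -> T -> R) (a : I -> R) :
  (forall i, u i @ F --> a i) ->
  (fun t => \sum_(i <- s) u i t) @ F --> (\sum_(i <- s) a i : R).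
Proof.
move=> ua; elim: s => [|i s IH].
  rewrite big_nil; under eq_fun do rewrite big_nil; exact: cvg_cst.
rewrite big_cons; under eq_fun do rewrite big_cons.
exact: cvg_addr.
Qed.

Lemma cvg_le_const u (a c : R) : u @ F --> a -> (\forall t \near F, u t <= c) ->
  a <= c.
Proof. by move=> ua uc; apply: cvgr_to_le ua uc. Qed.

End RealLimits.

Section L2Complete.
Context (R : realType) (A : choiceType) (m : A -> nat).
Local Notation H := (l2sum R m).

Lemma ball_l2 (x y : H) (e : R) : ball x e%:C y <-> nrm (x - y) < e.
Proof. by rewrite -ball_normE /= nrmE ltcR. Qed.

Lemma coord_le_nrm (x : H) a k : nrm (l2fun x a k 0 : R[i]^o) <= nrm x.
Proof.
apply: le_trans (l2norm_le_sum x a).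
rewrite -(ler_pXn2r (n := 2)) ?nnegrE ?nrm_ge0 ?l2norm_ge0// l2norm_sqr.
by rewrite (bigD1 k)//= lerDl sumr_ge0// => j _; rewrite sqr_ge0.
Qed.

Lemma normr_re_le (z : R[i]) : `|re z| <= nrm (z : R[i]^o).
Proof.
rewrite -(ler_pXn2r (n := 2)) ?nnegrE ?nrm_ge0// sqr_nrmC real_normK ?num_real//.
by rewrite lerDl sqr_ge0.
Qed.

Lemma normr_im_le (z : R[i]) : `|im z| <= nrm (z : R[i]^o).
Proof.
rewrite -(ler_pXn2r (n := 2)) ?nnegrE ?nrm_ge0// sqr_nrmC real_normK ?num_real//.
by rewrite lerDr sqr_ge0.
Qed.

Lemma l2sum_complete (F : set_system H) : ProperFilter F -> cauchy F -> cvg F.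
Proof.
move=> FF /cauchyP Fc.
have Fe (e : R) : 0 < e -> exists x : H, F (ball x e%:C).
  by move=> e0; apply: Fc; rewrite ltcR.
have coord (u : H -> R) : (forall x y, `|u x - u y| <= nrm (x - y)) ->
    cvg (u @ F).
  move=> ul; apply: cauchy_cvg; apply: cauchy_exP => e e0.
  have [x Fx] := Fe _ e0; exists (u x).
  have : F (u @^-1` (ball (u x) e)); last by [].
  apply: filterS Fx => y /ball_l2 xy.
  by rewrite /= -ball_normE /=; exact: le_lt_trans (ul x y) xy.
have creB (x y : H) a k : `|re (l2fun x a k 0) - re (l2fun y a k 0)| <= nrm (x - y).
  rewrite -reB; apply: le_trans (normr_re_le _) _.
  by have := coord_le_nrm (x - y) k; rewrite /= !mxE.
have cimB (x y : H) a k : `|im (l2fun x a k 0) - im (l2fun y a k 0)| <= nrm (x - y).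
  have -> : im (l2fun x a k 0) - im (l2fun y a k 0) =
      im (l2fun x a k 0 - l2fun y a k 0) by rewrite imB.
  apply: le_trans (normr_im_le _) _.
  by have := coord_le_nrm (x - y) k; rewrite /= !mxE.
(* The candidate limit is taken coordinatewise, in real and imaginary parts, where the filter is
   Cauchy in [R]. *)
pose z : blocks R m := fun a => \col_k
  (lim ((fun x : H => re (l2fun x a k 0)) @ F) +i*
   lim ((fun x : H => im (l2fun x a k 0)) @ F)).
have cre a k : (fun x : H => re (l2fun x a k 0)) @ F --> re (z a k 0).
  by rewrite mxE; apply: coord => x y.
have cim a k : (fun x : H => im (l2fun x a k 0)) @ F --> im (z a k 0).
  by rewrite mxE; apply: coord => x y.
(* Each finite partial sum of squares is continuous in the coordinates, so the bound [e] on the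
   distance from [x0] survives the coordinatewise limit. *)
have close (x0 : H) (e : R) (s : seq A) : F (ball x0 e%:C) -> 0 < e -> uniq s ->
    \sum_(a <- s) block_sq (l2fun x0 - z) a <= e ^+ 2.
  move=> Fx0 e0 us.
  pose f (a : A) (k : 'I_(m a)) (x : H) :=
    (re (l2fun x0 a k 0) - re (l2fun x a k 0)) *
    (re (l2fun x0 a k 0) - re (l2fun x a k 0)) +
    (im (l2fun x0 a k 0) - im (l2fun x a k 0)) *
    (im (l2fun x0 a k 0) - im (l2fun x a k 0)).
  have sqE (v : blocks R m) a : block_sq (l2fun x0 - v) a =
      \sum_k ((re (l2fun x0 a k 0) - re (v a k 0)) *
              (re (l2fun x0 a k 0) - re (v a k 0)) +
              (im (l2fun x0 a k 0) - im (v a k 0)) *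
              (im (l2fun x0 a k 0) - im (v a k 0))).
    rewrite /block_sq l2norm_sqr; apply: eq_bigr => k _.
    by rewrite sqr_nrmC !mxE !reB !imB !expr2.
  have lim1 : (fun x => \sum_(a <- s) \sum_k f a k x) @ F -->
      (\sum_(a <- s) block_sq (l2fun x0 - z) a : R).
    apply: cvg_sumr => a; rewrite sqE; apply: cvg_sumr => k.
    by apply: cvg_addr; apply: cvg_mulr; apply: cvgB; (exact: cvg_cst || by []).
  apply: (cvg_le_const _ lim1); apply: filterS Fx0 => x /ball_l2 xe.
  have -> : \sum_(a <- s) \sum_k f a k x =
      \sum_(a <- s) block_sq (l2fun (x0 - x)) a.
    by apply: eq_bigr => a _; rewrite (sqE (l2fun x)).
  apply: le_trans (nsum_ub (l2_summable (x0 - x)) us) _.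
  rewrite -l2norm_sum_sqr ler_pXn2r ?nnegrE ?l2norm_sum_ge0//; first exact: ltW.
  exact: ltW.
have [x1 Fx1] := Fe 1 ltr01.
(* [z] is square summable because [x1] is and [x1 - z] is, the latter by [close] at radius 1. *)
have w_in : l2fun x1 - z \in square_summable (R := R) (m := m).
  apply/asboolP; exists (1 ^+ 2) => s us.
  under eq_bigr do rewrite ger0_norm ?block_sq_ge0//.
  exact: close.
have zE : z = l2fun x1 - (l2fun x1 - z) by rewrite opprB addrC subrK.
have z_in : z \in square_summable (R := R) (m := m).
  rewrite zE rpredB//; exact: valP x1.
apply/cvg_ex; exists (L2Sum z_in).
apply/cvg_ballP => e e0.
have eE : e = (re e)%:C by move: e0; rewrite ltcE => /andP[/eqP h _]; apply: complex_eqP.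
have re0' : 0 < re e by move: e0; rewrite ltcE => /andP[].
have h0 : 0 < re e / 3 by rewrite divr_gt0.
have [x0 Fx0] := Fe _ h0; apply: (filterS _ Fx0) => x /ball_l2 x0x; rewrite eE; apply/ball_l2.
have d0 : nrm (x0 - L2Sum z_in) <= re e / 3.
  rewrite -(ler_pXn2r (n := 2)) ?nnegrE ?nrm_ge0 ?(ltW h0)//.
  rewrite nrm_l2 l2norm_sum_sqr; by apply: nsum_le => s us; exact: close.
have -> : L2Sum z_in - x = (x0 - x) - (x0 - L2Sum z_in) :> H.
  by rewrite opprB [RHS]addrC subrKA.
by rewrite (le_lt_trans (nrmB _ _))// (le_lt_trans (lerD (ltW x0x) d0))//; lra.
Qed.

HB.instance Definition _ := Uniform_isComplete.Build H l2sum_complete.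

(** A sesquilinear form is determined by its real part: the imaginary part of [<x, y>] is the real
    part of [<x, i y>]. *)
Definition l2inner (x y : H) : R[i] := l2rip x y +i* l2rip x ('i *: y).

Lemma l2rip_ir (x y : H) : l2rip ('i *: x) y = - l2rip x ('i *: y).
Proof.
rewrite -[l2rip ('i *: x) y]l2rip_i scalerA.
have -> : ('i * 'i)%R = (-1)%:C :> R[i] by apply: complex_eqP => /=; ring.
by rewrite l2ripZl mulN1r.
Qed.

Lemma l2inner_linear (y : H) : GRing.linear_for *%R (l2inner^~ y).
Proof.
move=> a x x'; rewrite /l2inner.
have {1 2}-> : a *: x = (re a)%:C *: x + (im a)%:C *: ('i *: x).
  rewrite scalerA -scalerDl; congr (_ *: _); case: (a) => b c.
  by apply: complex_eqP => /=; ring.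
rewrite !l2ripDl !l2ripZl !l2rip_ir scalerA.
have -> : ('i * 'i)%R = (-1)%:C :> R[i] by apply: complex_eqP => /=; ring.
rewrite (l2ripC x (_%:C *: y)) l2ripZl (l2ripC y).
by case: (a) => b c; apply: complex_eqP => /=; ring.
Qed.

Lemma l2innerC (x y : H) : l2inner x y = (-1) ^+ false * Num.conj (l2inner y x).
Proof.
rewrite expr0 mul1r conjE /l2inner /=; apply: complex_eqP => /=.
  exact: l2ripC.
by rewrite l2ripC l2rip_ir.
Qed.

Lemma l2inner_conj_linear (x : H) :
  GRing.linear_for (@Num.conj R[i] \; *%R) (l2inner x).
Proof.
move=> a y y'; rewrite l2innerC l2inner_linear expr0 mul1r rmorphD rmorphM /=.
by rewrite [l2inner x y]l2innerC [l2inner x y']l2innerC !expr0 !mul1r.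
Qed.

HB.instance Definition _ := bilinear_isBilinear.Build R[i] H H R[i] *%R
  (@Num.conj R[i] \; *%R) l2inner (l2inner_linear, l2inner_conj_linear).

HB.instance Definition _ := isHermitianSesquilinear.Build R[i] H false
  (@Num.conj R[i]) l2inner l2innerC.

Lemma l2innerxx (x : H) : l2inner x x = `|x| ^+ 2.
Proof.
rewrite nrmE nrm_l2 -rmorphXn -l2ripxx; apply: complex_eqP => //=.
by have := l2rip_ir x x; rewrite l2ripC; lra.
Qed.

Lemma l2inner_gt0 (x : H) : x != 0 -> 0 < l2inner x x.
Proof. by move=> x0; rewrite l2innerxx exprn_gt0// normr_gt0. Qed.

HB.instance Definition _ := isDotProduct.Build R[i] H l2inner l2inner_gt0.

HB.instance Definition _ := NormedModule_hasInner.Build R H l2innerxx.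

End L2Complete.

(** * Products of matrix algebras *)

Section BlockOperators.
Context (R : realType) (A : choiceType) (m : A -> nat).
Local Notation H := (l2sum R m).

Definition mats := dprod (fun a => 'M[R[i]]_(m a) : lmodType R[i]).

Definition bounded_mats : {pred mats} := [pred w : mats |
  `[< exists c : R, forall a (x : 'cV[R[i]]_(m a)),
        l2norm (w a *m x) <= c * l2norm x >]].

Lemma bounded_mats_submod : submod_closed bounded_mats.
Proof.
split=> [|t v w /asboolP[c hc] /asboolP[d hd]]; apply/asboolP.
  exists 0 => a x; rewrite mul0r.
  have -> : (0 : mats) a = 0 by [].
  by rewrite mul0mx -(scale0r (0 : 'cV[R[i]]_(m a))) l2normZ nrm0 mul0r.
exists (nrm (t : R[i]^o) * c + d) => a x.
rewrite (dprodP t v w a) mulmxDl -scalemxAl (le_trans (l2normD _ _))//.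
by rewrite mulrDl lerD// l2normZ -mulrA ler_wpM2l ?nrm_ge0.
Qed.

HB.instance Definition _ :=
  GRing.isSubmodClosed.Build R[i] mats bounded_mats bounded_mats_submod.

Record bmats := BMats { bmats_fun :> mats ; _ : bmats_fun \in bounded_mats }.

HB.instance Definition _ := [isSub for bmats_fun].
HB.instance Definition _ := [Choice of bmats by <:].
HB.instance Definition _ := [SubChoice_isSubLmodule of bmats by <:].

Implicit Types w : bmats.

Lemma bmats_bounded w : exists c : R, forall a (x : 'cV[R[i]]_(m a)),
  l2norm (bmats_fun w a *m x) <= c * l2norm x.
Proof. by case: w => w /= /asboolP. Qed.

Lemma bmats_inj w w' : (forall a, bmats_fun w a = bmats_fun w' a) -> w = w'.
Proof. by move=> h; apply: val_inj; apply: dprod_ext. Qed.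

Definition block_mul w (x : H) : blocks R m := fun a => bmats_fun w a *m l2fun x a.

Lemma block_mul_in w x : block_mul w x \in square_summable (R := R) (m := m).
Proof.
have [c hc] := bmats_bounded w; apply/asboolP.
apply: (@summable_le _ _ _ (fun a => c ^+ 2 * block_sq x a)).
  by apply: summableZ; exact: l2_summable.
move=> a; rewrite ger0_norm ?block_sq_ge0// (le_trans _ (ler_norm _))//.
rewrite /block_sq -exprMn ler_pXn2r ?nnegrE ?l2norm_ge0// ?hc//.
by rewrite (le_trans _ (hc a (l2fun x a))) ?l2norm_ge0.
Qed.

Definition block_app w (x : H) : H := L2Sum (block_mul_in w x).

Lemma block_app_linear w : linear (block_app w).
Proof.
by move=> t x y; apply: l2fun_inj => a; rewrite /= /block_mul mulmxDr -scalemxAr.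
Qed.

Lemma block_app_bounded w : exists M : R, forall x, nrm (block_app w x) <= M * nrm x.
Proof.
have [c hc] := bmats_bounded w; exists `|c| => x; rewrite !nrm_l2.
rewrite -(ler_pXn2r (n := 2)) ?nnegrE ?l2norm_sum_ge0 ?mulr_ge0 ?l2norm_sum_ge0//.
rewrite exprMn !l2norm_sum_sqr -nsumZ ?sqr_ge0//; last exact: l2_summable.
apply: le_nsum; first by apply: summableZ; exact: l2_summable.
move=> a; rewrite /block_sq -exprMn ler_pXn2r ?nnegrE ?mulr_ge0 ?l2norm_ge0//.
by rewrite (le_trans (hc _ _))// ler_wpM2r ?l2norm_ge0// ler_norm.
Qed.

Definition block_op w : bop H :=
  sval (cid (bop_build (block_app_linear w) (block_app_bounded w))).

Lemma block_opE w x a : l2fun (block_op w x) a = bmats_fun w a *m l2fun x a.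
Proof.
by rewrite /block_op; case: cid => T /= ->.
Qed.

Lemma block_op_linear : linear block_op.
Proof.
move=> t w w'; apply: bop_ext => x; rewrite bopDl bopZl.
apply: l2fun_inj => a; rewrite l2funP !block_opE.
by rewrite [bmats_fun _ a]dprodP mulmxDl -scalemxAl.
Qed.

HB.instance Definition _ :=
  GRing.isLinear.Build R[i] bmats (bop H) *:%R block_op block_op_linear.

(** The block sizes vary with the index, so [v] is transported along the proof of [a = b] that the
    decision returns. *)
Definition single_fun a (v : 'cV[R[i]]_(m a)) : blocks R m := fun b =>
  if @eqP _ a b is ReflectT e then ecast i 'cV[R[i]]_(m i) e v else 0.

Lemma single_funE a (v : 'cV[R[i]]_(m a)) : single_fun v a = v.
Proof.
rewrite /single_fun; case: eqP => // e.
by rewrite (eq_irrelevance e (erefl a)).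
Qed.

Lemma single_fun0 a b (v : 'cV[R[i]]_(m a)) : a != b -> single_fun v b = 0.
Proof. by rewrite /single_fun; case: eqP. Qed.

Lemma nsum_single (u : A -> R) a : (forall b, a != b -> u b = 0) -> 0 <= u a ->
  summable u /\ nsum u = u a.
Proof.
move=> u0 ua.
have S s : uniq s -> \sum_(b <- s) u b <= u a.
  move=> us; have [as_|as_] := boolP (a \in s).
    rewrite (bigD1_seq a)//= big1 ?addr0// => b ba; apply: u0.
    by rewrite eq_sym.
  by rewrite big_seq big1// => b bs; apply: u0; apply: contraNneq as_ => ->.
have hu : summable u.
  exists (u a) => s us; rewrite (eq_bigr u) ?S// => b _.
  rewrite ger0_norm//; have [<-//|/u0 -> //] := eqVneq a b.
split=> //; apply/eqP; rewrite eq_le nsum_term// andbT.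
exact: nsum_le.
Qed.

Lemma block_sq_single a (v : 'cV[R[i]]_(m a)) b : a != b ->
  block_sq (single_fun v) b = 0.
Proof.
move=> ab; rewrite /block_sq single_fun0//.
by rewrite -(scale0r (0 : 'cV[R[i]]_(m b))) l2normZ nrm0 mul0r expr0n.
Qed.

Lemma single_in a (v : 'cV[R[i]]_(m a)) :
  single_fun v \in square_summable (R := R) (m := m).
Proof.
apply/asboolP; have [] := @nsum_single (block_sq (single_fun v)) a => //.
  by move=> b; exact: block_sq_single.
exact: block_sq_ge0.
Qed.

Definition single a (v : 'cV[R[i]]_(m a)) : H := L2Sum (single_in v).

Lemma nrm_single a (v : 'cV[R[i]]_(m a)) : nrm (single v) = l2norm v.
Proof.
apply/eqP; rewrite -(eqrXn2 (n := 2)) ?nrm_ge0 ?l2norm_ge0//.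
rewrite nrm_l2 l2norm_sum_sqr.
have [_ ->] := @nsum_single (block_sq (single_fun v)) a
  (fun b => @block_sq_single a v b) (block_sq_ge0 _ _).
by rewrite /block_sq single_funE.
Qed.

Lemma cip0l k (v : 'cV[R[i]]_k) : cip 0 v = 0.
Proof. by have := cipZl 0 0 v; rewrite scale0r mul0r. Qed.

Lemma rip_single a (x : H) (v : 'cV[R[i]]_(m a)) :
  rip x (single v) = cip (l2fun x a) v.
Proof.
rewrite [LHS]/(l2rip x (single v)) /l2rip.
have h b : a != b -> cip (l2fun x b) (l2fun (single v) b) = 0.
  by move=> ab; rewrite /= single_fun0// cipC cip0l.
pose u b := cip (l2fun x b) (l2fun (single v) b).
(* The family is supported at [a]; it is split as a difference of two nonnegative families with the
   same support. *)
pose up b := if b == a then `|u a| else 0.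
pose um b := if b == a then `|u a| - u a else 0.
have um0 : 0 <= `|u a| - u a by rewrite subr_ge0 ler_norm.
have [sp np] : summable up /\ nsum up = up a.
  apply: nsum_single => [b|]; last by rewrite /up eqxx.
  by rewrite /up eq_sym => /negbTE ->.
have [sm nm] : summable um /\ nsum um = um a.
  apply: nsum_single => [b|]; last by rewrite /um eqxx.
  by rewrite /um eq_sym => /negbTE ->.
rewrite (@rsum_diff _ _ _ up um) ?np ?nm// /up /um ?eqxx.
- by rewrite /u /= single_funE; ring.
- by move=> b; case: ifP.
- by move=> b; case: ifP.
- move=> b; have [->|ba] := eqVneq b a; first by rewrite /u; ring.
  by rewrite subr0 h// eq_sym.
Qed.

End BlockOperators.

Section BoundedFamilies.
Context (R : realType) (A : choiceType) (m : A -> nat).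
Local Notation H := (l2sum R m).
Local Notation W := (bmats R m).

HB.instance Definition _ := Lmodule_hasMxNorm.Build R W
  (fun n (w : 'M[W]_n) => mxnorm (map_mx (@block_op R A m) w)).

Lemma block_op_inj : injective (@block_op R A m).
Proof.
move=> w w' ww'; apply: bmats_inj => a; apply/matrixP => k l.
have E u : col l (bmats_fun u a) = l2fun (block_op u (single (delta_mx l 0))) a.
  by rewrite block_opE /= single_funE colE.
have : col l (bmats_fun w a) = col l (bmats_fun w' a) by rewrite !E ww'.
by move=> /matrixP/(_ k 0); rewrite !mxE.
Qed.

Lemma bmats_concrete :
  exists (K : hilbertType R) (j : {linear W -> bop K}), injective j /\ complete_isometry j.
Proof. by exists H, (@block_op R A m); split=> //; exact: block_op_inj. Qed.

HB.instance Definition _ := MxNormed_isOpSpace.Build R W bmats_concrete.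

Definition block (a : A) (w : W) : 'M[R[i]]_(m a) := bmats_fun w a.

Lemma block_linear a : linear (block a).
Proof. by []. Qed.

HB.instance Definition _ a := GRing.isLinear.Build R[i] W 'M[R[i]]_(m a) *:%R
  (block a) (block_linear a).

Lemma rsum_le_nsum (u v : A -> R) : summable u -> summable v ->
  (forall a, 0 <= v a) -> (forall a, u a <= v a) -> rsum u <= nsum v.
Proof.
move=> hu hv v0 uv; have nu := summable_norm hu.
rewrite lerBlDr addrC -nsumD//; apply: le_nsum.
  exact: summableD.
by move=> a; rewrite lerD2l.
Qed.

Lemma summable_sum (I : Type) (s : seq I) (u : I -> A -> R) :
  (forall i, summable (u i)) -> summable (fun a => \sum_(i <- s) u i a).
Proof.
move=> hu; elim: s => [|i s IH].
  exists 0 => s _; rewrite big1// => a _; by rewrite big_nil normr0.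
have [c hc] := summableD (hu i) IH; exists c => t ut.
by rewrite (le_trans _ (hc t ut))// ler_sum// => a _; rewrite big_cons.
Qed.

Lemma rsum_sum (I : Type) (s : seq I) (u : I -> A -> R) :
  (forall i, summable (u i)) ->
  rsum (fun a => \sum_(i <- s) u i a) = \sum_(i <- s) rsum (u i).
Proof.
move=> hu; elim: s => [|i s IH].
  rewrite big_nil -[RHS](mul0r (rsum (fun _ : A => 0 : R))) -rsumZ.
    by congr rsum; apply/funext => a; rewrite big_nil mul0r.
  by exists 0 => s _; rewrite big1// => a _; rewrite normr0.
rewrite big_cons -IH -rsumD//; last exact: summable_sum.
by congr rsum; apply/funext => a; rewrite big_cons.
Qed.

Lemma l2fun_sum (I : Type) (s : seq I) (x : I -> H) a :
  l2fun (\sum_(i <- s) x i) a = \sum_(i <- s) l2fun (x i) a.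
Proof. by apply: (big_morph (fun z : H => l2fun z a)). Qed.

(** For one direction the test vectors are supported in the single coordinate [a]. For the other,
    the estimates in the blocks are added over all coordinates, which half-sums of squares allow. *)
Lemma bmats_mxnormP n (w : 'M[W]_n) c : 0 <= c ->
  (mxnorm w <= c <-> forall a, mxnorm (map_mx (block a) w) <= c).
Proof.
move=> c0; split=> [wc a|h].
  apply/mx_mxnorm_cipP => // x y.
  have := (bop_mxnormP (map_mx (@block_op R A m) w) c0).1 wc
    (fun j => single (x j)) (fun j => single (y j)).
  under [X in _ <= _ * ((X + _) / _) -> _]eq_bigr do rewrite nrm_single.
  under [X in _ <= _ * ((_ + X) / _) -> _]eq_bigr do rewrite nrm_single.
  apply: le_trans; rewrite le_eqVlt; apply/orP; left; apply/eqP.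
  apply: eq_bigr => i _; rewrite rip_single l2fun_sum; congr (cip _ _).
  by apply: eq_bigr => j _; rewrite !mxE block_opE /= single_funE.
apply/(bop_mxnormP _ c0) => x y.
have nE (z : 'I_n -> H) : \sum_j nrm (z j) ^+ 2 =
    rsum (fun a => \sum_j block_sq (l2fun (z j)) a).
  rewrite rsum_sum => [|j]; last exact: l2_summable.
  apply: eq_bigr => j _; rewrite nrm_l2 l2norm_sum_sqr rsum_ge0//.
    by move=> a; exact: block_sq_ge0.
  exact: l2_summable.
have s1 (z : 'I_n -> H) : summable (fun a => \sum_j block_sq (l2fun (z j)) a).
  by apply: summable_sum => j; exact: l2_summable.
rewrite !nE -rsumD// mulrA [c * _]mulrC -mulrA -[leRHS]mulrC -rsumZ; last exact: summableD.
rewrite (_ : \sum_i _ = rsum (fun a => \sum_i cip (\sum_j bmats_fun (w i j) a *m l2fun (x j) a) (l2fun (y i) a))); last first.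
  rewrite rsum_sum => [|i].
    apply: eq_bigr => i _; rewrite [LHS]/(l2rip _ _) /l2rip.
    congr rsum; apply/funext => a; congr (cip _ _); rewrite l2fun_sum.
    by apply: eq_bigr => j _; rewrite mxE block_opE.
  have := summable_cip (\sum_j block_op (w i j) (x j)) (y i).
  move=> [d hd]; exists d => s us; rewrite (le_trans _ (hd s us))//.
  rewrite le_eqVlt; apply/orP; left; apply/eqP; apply: eq_bigr => a _.
  congr (`|cip _ _|); rewrite l2fun_sum; apply: eq_bigr => j _.
  by rewrite block_opE.
have F a : 0 <= \sum_j block_sq (l2fun (x j)) a + \sum_j block_sq (l2fun (y j)) a.
  by rewrite addr_ge0// sumr_ge0// => j _; exact: block_sq_ge0.
rewrite [leRHS]rsum_ge0.
- apply: rsum_le_nsum.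
  + apply: summable_sum => i.
    have := summable_cip (\sum_j block_op (w i j) (x j)) (y i).
    move=> [d hd]; exists d => s us; rewrite (le_trans _ (hd s us))//.
    rewrite le_eqVlt; apply/orP; left; apply/eqP; apply: eq_bigr => a _.
    congr (`|cip _ _|); rewrite l2fun_sum; apply: eq_bigr => j _.
    by rewrite block_opE.
  + by apply: summableZ; exact: summableD.
  + by move=> a; rewrite mulr_ge0// divr_ge0.
  + move=> a; have := (mx_mxnorm_cipP _ c0).1 (h a) (fun j => l2fun (x j) a)
      (fun j => l2fun (y j) a).
    rewrite mulrA [c * _]mulrC -mulrA [leRHS]mulrC => /(le_trans _); apply.
    rewrite le_eqVlt; apply/orP; left; apply/eqP.
    apply: eq_bigr => i _; congr (cip _ _); apply: eq_bigr => j _.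
    by rewrite mxE.
- by move=> a; rewrite mulr_ge0// divr_ge0.
- by apply: summableZ; exact: summableD.
Qed.

(** By [bmats_mxnormP] a complete contraction into the product is a family of complete contractions
    into its blocks. Each is extended separately, and [norm1 y] bounds the resulting family
    uniformly. *)
Lemma bmats_injective : injective_opspace (W : opSpaceType R).
Proof.
move=> X Y i f isoi ccf.
have cca a : complete_contraction (block a \o f).
  move=> n v; rewrite map_mx_comp.
  have v0 := mxnorm_ge0 v.
  exact: ((bmats_mxnormP _ v0).1 (ccf n v) a).
have G a : exists2 g : {linear Y -> 'M[R[i]]_(m a)},
    complete_contraction g & forall x, g (i x) = block a (f x).
  exact: (wittstock_mx isoi (cca a)).
pose g a := s2val (cid2 (G a)).
have gcc a : complete_contraction (g a) := s2valP (cid2 (G a)).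
have gE a x : g a (i x) = block a (f x) := s2valP' (cid2 (G a)) x.
pose h (y : Y) : mats R m := fun a => g a y.
have h_in y : h y \in bounded_mats (R := R) (m := m).
  apply/asboolP; exists (norm1 y) => a x; apply: l2norm_mul_le.
  by have := gcc a 1%N (const_mx y); rewrite map_const_mx.
pose k y : W := BMats (h_in y).
have k_lin : linear k.
  by move=> t y y'; apply: bmats_inj => a; rewrite /= /h linearP.
pose kl := GRing.isLinear.Build R[i] Y W *:%R k k_lin.
pose K : {linear Y -> W} := HB.pack k kl.
exists K => [n y|x].
  apply/bmats_mxnormP => [|a]; first exact: mxnorm_ge0.
  have -> : map_mx (block a) (map_mx K y) = map_mx (g a) y.
    by apply/matrixP => s t; rewrite !mxE.
  exact: gcc.
by apply: bmats_inj => a /=; rewrite /h gE.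
Qed.

End BoundedFamilies.

(** * The universal family of matrix-valued complete contractions *)

Section MatrixStates.
Context (R : realType) (V : opSpaceType R).

(** [{classic _}] provides the choice structure required of the index of an l2 sum. *)
Definition cc_map : choiceType :=
  {classic {m : nat & {F : {linear V -> 'M[R[i]]_m} | complete_contraction F}}}.

Definition cc_dim (a : cc_map) : nat := projT1 a.

Definition cc_fun (a : cc_map) : {linear V -> 'M[R[i]]_(cc_dim a)} :=
  sval (projT2 a).

Lemma cc_funP (a : cc_map) : complete_contraction (cc_fun a).
Proof. exact: (svalP (projT2 a)). Qed.

Definition cc_point m (F : {linear V -> 'M[R[i]]_m})
    (ccF : complete_contraction F) : cc_map := existT _ m (exist _ F ccF).

Local Notation W := (bmats R cc_dim).

Lemma kappa_in (v : V) : (fun a => cc_fun a v) \in bounded_mats (R := R) (m := cc_dim).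
Proof.
apply/asboolP; exists (norm1 v) => a x; apply: l2norm_mul_le.
by have := cc_funP a (const_mx v : 'M[V]_1); rewrite map_const_mx.
Qed.

Definition kappa (v : V) : W := BMats (kappa_in v).

Lemma block_kappa a v : block a (kappa v) = cc_fun a v.
Proof. by []. Qed.

Lemma kappa_linear : linear kappa.
Proof. by move=> t v v'; apply: bmats_inj => a; rewrite /= linearP. Qed.

HB.instance Definition _ := GRing.isLinear.Build R[i] V W *:%R kappa kappa_linear.

(** No norm is lost: a concrete representation [J] is normed by its finite compressions, and each of
    these is itself a member of the family. *)
Lemma kappa_isometry : complete_isometry kappa.
Proof.
move=> n v; apply/eqP; rewrite eq_le; apply/andP; split.
  apply/bmats_mxnormP => [|a]; first exact: mxnorm_ge0.
  rewrite (_ : map_mx _ _ = map_mx (cc_fun a) v) ?cc_funP//.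
  by apply/matrixP => i j; rewrite !mxE.
have [H [J [_ isoJ _]]] := opspace_form V.
rewrite -isoJ; apply: mxnorm_le_compress; first exact: mxnorm_ge0.
move=> m e oe.
pose F (u : V) : 'M[R[i]]_m := \matrix_(k, l) inner (J u (e l)) (e k).
have F_lin : linear F.
  move=> t u u'; apply/matrixP => k l.
  by rewrite !mxE linearP bopDl bopZl innerDl innerZl.
pose Fl := GRing.isLinear.Build R[i] V 'M[R[i]]_m *:%R F F_lin.
pose F' : {linear V -> 'M[R[i]]_m} := HB.pack F Fl.
have ccF : complete_contraction F'.
  move=> k u.
  have -> : map_mx F' u = \matrix_(i, j) (\matrix_(p, q)
      (inner (map_mx J u i j (e q)) (e p) : R[i])).
    by apply/matrixP => i j; rewrite [LHS]mxE [RHS]mxE /= /F; apply/matrixP => p q; rewrite !mxE.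
  apply: (le_trans (mx_compress_le (map_mx J u) oe)).
  by rewrite isoJ.
have := (bmats_mxnormP (map_mx kappa v) (mxnorm_ge0 _)).1 (lexx _) (cc_point ccF).
apply: le_trans; rewrite le_eqVlt; apply/orP; left; apply/eqP; congr mxnorm.
by apply/matrixP => i j; rewrite !mxE block_kappa.
Qed.

End MatrixStates.

(** * The injective envelope *)

Section UltraLimits.
Context (R : realType) (T : Type) (U : set_system T) (UU : UltraFilter U).

(** Compactness of the segment gives a cluster point, and a cluster point of an ultrafilter is a
    limit. *)
Lemma ultra_cvg (u : T -> R) (M : R) : (forall t, `|u t| <= M) -> cvg (u @ U).
Proof.
move=> uM.
have FF : ProperFilter (u @ U) by exact: fmap_proper_filter.
have FA : (u @ U) `[- M, M]%classic.
  have : U (u @^-1` `[- M, M]%classic); last by [].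
  by apply: filterE => t; rewrite /= in_itv /= -ler_norml.
have [p [_ clp]] := @segment_compact R (- M) M _ FF FA.
apply/cvg_ex; exists p => B pB.
have [//|UC] := in_ultra_setVsetC (u @^-1` B) UU.
have [q [nBq Bq]] := clp (~` B) B UC pB.
by [].
Qed.

Lemma mx_mxnorm_lim n m (B : T -> 'M['M[R[i]]_m]_n) (L : 'M['M[R[i]]_m]_n) c :
  (forall i j k l, (fun t => re (B t i j k l)) @ U --> re (L i j k l)) ->
  (forall i j k l, (fun t => im (B t i j k l)) @ U --> im (L i j k l)) ->
  0 <= c -> (\forall t \near U, mxnorm (B t) <= c) -> mxnorm L <= c.
Proof.
move=> cre cim c0 Bc; apply/(mx_mxnormP _ c0) => a b.
have E (D : 'M['M[R[i]]_m]_n) :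
  re (\sum_i \sum_j \sum_k \sum_l D i j k l * a j l * Num.conj (b i k)) =
  \sum_i \sum_j \sum_k \sum_l
    (re (D i j k l) * re (a j l * Num.conj (b i k)) +
     im (D i j k l) * (- im (a j l * Num.conj (b i k)))).
  do 4 (rewrite re_sum; apply: eq_bigr => ? _).
  by rewrite -mulrA [LHS]reM mulrN.
rewrite E.
have lim : (fun t => \sum_i \sum_j \sum_k \sum_l
    (re (B t i j k l) * re (a j l * Num.conj (b i k)) +
     im (B t i j k l) * (- im (a j l * Num.conj (b i k))))) @ U -->
  (\sum_i \sum_j \sum_k \sum_l
    (re (L i j k l) * re (a j l * Num.conj (b i k)) +
     im (L i j k l) * (- im (a j l * Num.conj (b i k)))) : R).
  do 4 (apply: cvg_sumr => ?).
  by apply: cvg_addr; apply: cvg_mulr; (exact: cvg_cst || by []).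
apply: (cvg_le_const _ lim).
by apply: filterS Bc => t Bt; rewrite -E; exact: ((mx_mxnormP _ c0).1 Bt).
Qed.

Lemma entry_le m (B : 'M[R[i]]_m) c k l :
  mxnorm (const_mx B : 'M['M[R[i]]_m]_1) <= c -> nrm (B k l : R[i]^o) <= c.
Proof.
move=> Bc; have h := l2norm_mul_le (delta_mx l 0) Bc.
have d1 : l2norm (delta_mx l 0 : 'cV[R[i]]_m) = 1.
  apply/eqP; rewrite -(eqrXn2 (n := 2)) ?l2norm_ge0//.
  rewrite l2norm_sqr expr1n (bigD1 l)//= mxE !eqxx (_ : nrm _ = 1).
    rewrite expr1n big1 ?addr0// => j jl.
    by rewrite mxE (negbTE jl) nrm0 expr0n.
  by have : nrm (1 : R[i]^o) = 1 by rewrite /nrm normr1.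
move: h; rewrite d1 mulr1; apply: le_trans.
rewrite -(ler_pXn2r (n := 2)) ?nnegrE ?nrm_ge0 ?l2norm_ge0// l2norm_sqr.
rewrite (bigD1 k)//= -colE mxE. rewrite lerDl sumr_ge0// => j _.
exact: sqr_ge0.
Qed.

Context (A : choiceType) (m : A -> nat) (X : opSpaceType R).
Local Notation W := (bmats R m).
Variable psi : T -> {linear X -> W}.
Hypothesis cc_psi : forall t, complete_contraction (psi t).

Let block_le t n (x : 'M[X]_n) a :
  mxnorm (map_mx (fun u => block a (psi t u)) x) <= mxnorm x.
Proof.
have x0 := mxnorm_ge0 x.
have := (bmats_mxnormP _ x0).1 (cc_psi t x) a.
by rewrite -map_mx_comp.
Qed.

Let entry_bound t x a k l : nrm (block a (psi t x) k l : R[i]^o) <= norm1 x.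
Proof.
apply: entry_le.
by have := block_le t (const_mx x : 'M[X]_1) a; rewrite map_const_mx.
Qed.

(** This plays the role of point-weak* compactness of the complete contractions into [W]: each entry
    of each block is a bounded scalar. The last clause only asks for a bound that holds eventually,
    so that it also yields lower bounds for chains in Zorn's lemma. *)
Lemma ultra_limit : exists phi : {linear X -> W},
  [/\ forall x a k l, (fun t => re (block a (psi t x) k l)) @ U -->
        re (block a (phi x) k l),
      forall x a k l, (fun t => im (block a (psi t x) k l)) @ U -->
        im (block a (phi x) k l)
    & forall n (x : 'M[X]_n) c, 0 <= c ->
        (\forall t \near U, mxnorm (map_mx (psi t) x) <= c) ->
        mxnorm (map_mx phi x) <= c].
Proof.
pose f x : mats R m := fun a => \matrix_(k, l)
  (lim ((fun t => re (block a (psi t x) k l)) @ U) +i*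
   lim ((fun t => im (block a (psi t x) k l)) @ U)).
have cre x a k l : (fun t => re (block a (psi t x) k l)) @ U --> re (f x a k l).
  rewrite mxE; apply: (ultra_cvg (M := norm1 x)) => t.
  exact: le_trans (normr_re_le _) (@entry_bound t x a k l).
have cim x a k l : (fun t => im (block a (psi t x) k l)) @ U --> im (f x a k l).
  rewrite mxE; apply: (ultra_cvg (M := norm1 x)) => t.
  exact: le_trans (normr_im_le _) (@entry_bound t x a k l).
have lim_le n (x : 'M[X]_n) c a : 0 <= c ->
    (\forall t \near U, mxnorm (map_mx (psi t) x) <= c) ->
    mxnorm (map_mx (fun u => f u a) x) <= c.
  move=> c0 xc.
  apply: (@mx_mxnorm_lim _ _ (fun t => map_mx (fun u => block a (psi t u)) x)) => //.
  - by move=> i j k l; rewrite mxE; under eq_fun do rewrite mxE; exact: cre.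
  - by move=> i j k l; rewrite mxE; under eq_fun do rewrite mxE; exact: cim.
  apply: filterS xc => t /(bmats_mxnormP _ c0)/(_ a).
  by rewrite -map_mx_comp.
have f_in x : f x \in bounded_mats (R := R) (m := m).
  apply/asboolP; exists (norm1 x) => a y; apply: l2norm_mul_le.
  have := @lim_le 1%N (const_mx x) (norm1 x) a (norm1_ge0 x).
  by rewrite map_const_mx; apply; apply: filterE => t; exact: cc_psi.
pose g x : W := BMats (f_in x).
have g_lin : linear g.
  move=> s x y; apply: bmats_inj => a; apply/matrixP => k l; rewrite /=.
  have E t : block a (psi t (s *: x + y)) k l =
      s * block a (psi t x) k l + block a (psi t y) k l.
    by rewrite linearP linearP !mxE.
  have -> : (s *: f x + f y) a k l = s * f x a k l + f y a k l.
    by rewrite (dprodP s (f x) (f y) a) !mxE.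
  apply: complex_eqP.
    apply: (cvg_unique _ (cre (s *: x + y) a k l)) => //.
    rewrite reD reM (_ : (fun t => _) = (fun t =>
      re s * re (block a (psi t x) k l) - im s * im (block a (psi t x) k l) +
      re (block a (psi t y) k l))); last first.
      by apply/funext => t; rewrite E reD reM.
    apply: cvg_addr => //; apply: cvgB; apply: cvg_mulr => //; exact: cvg_cst.
  apply: (cvg_unique _ (cim (s *: x + y) a k l)) => //.
  rewrite imD imM (_ : (fun t => _) = (fun t =>
      re s * im (block a (psi t x) k l) + im s * re (block a (psi t x) k l) +
      im (block a (psi t y) k l))); last first.
    by apply/funext => t; rewrite E imD imM.
  by apply: cvg_addr => //; apply: cvg_addr; apply: cvg_mulr => //; exact: cvg_cst.
pose gl := GRing.isLinear.Build R[i] X W *:%R g g_lin.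
pose G : {linear X -> W} := HB.pack g gl.
exists G; split=> // n x c c0 xc; apply/bmats_mxnormP => // a.
by rewrite -map_mx_comp; exact: lim_le.
Qed.

End UltraLimits.

Section Averages.
Context (R : realType) (V : opSpaceType R).

Lemma mxnorm_avg n N (v : 'I_N.+1 -> 'M[V]_n) c : 0 <= c ->
  (forall k, mxnorm (v k) <= c) ->
  mxnorm (\matrix_(i, j) ((N.+1%:R^-1)%:C *: \sum_k v k i j)) <= c.
Proof.
move=> c0 vc; have [H [J [_ _ P]]] := opspace_form V.
apply/P => // x y.
set B := _ / 2.
have N0 : (0 : R) < N.+1%:R by rewrite ltr0n.
have -> : bop_form (map_mx J (\matrix_(i, j) ((N.+1%:R^-1)%:C *: \sum_k v k i j))) x y =
    N.+1%:R^-1 * \sum_k bop_form (map_mx J (v k)) x y.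
  under [in RHS]eq_bigr do rewrite bop_formE.
  rewrite bop_formE -re_sum -reZ; congr (re _); rewrite [in RHS]exchange_big/= mulr_sumr.
  apply: eq_bigr => i _; rewrite [in RHS]exchange_big/= mulr_sumr; apply: eq_bigr => j _.
  rewrite !mxE linearZ linear_sum bopZl innerZl bop_suml inner_suml.
  by congr (_ * _); apply: eq_bigr => k _; rewrite mxE.
rewrite ler_pdivrMl// mulr_natl -[N.+1 in leRHS]card_ord -sumr_const.
by apply: ler_sum => k _; exact: (P _ _ _ c0).1.
Qed.

End Averages.

Section FixedPoints.
Context (R : realType) (W : opSpaceType R) (theta : {linear W -> W}).

Definition fixed : {pred W} := [pred w | theta w == w].

Lemma fixed_submod : submod_closed fixed.
Proof.
split=> [|t v w]; rewrite !inE; first by rewrite linear0.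
by move=> /eqP vE /eqP wE; rewrite linearP vE wE.
Qed.

HB.instance Definition _ :=
  GRing.isSubmodClosed.Build R[i] W fixed fixed_submod.

(** When [theta] is idempotent this is its range. *)
Record fixed_space := Fixed { fixed_val :> W ; _ : fixed_val \in fixed }.

HB.instance Definition _ := [isSub for fixed_val].
HB.instance Definition _ := [Choice of fixed_space by <:].
HB.instance Definition _ := [SubChoice_isSubLmodule of fixed_space by <:].

Lemma fixed_val_linear : linear fixed_val.
Proof. by []. Qed.

HB.instance Definition _ :=
  GRing.isLinear.Build R[i] fixed_space W *:%R fixed_val fixed_val_linear.

HB.instance Definition _ := Lmodule_hasMxNorm.Build R fixed_space
  (fun n (w : 'M[fixed_space]_n) => mxnorm (map_mx fixed_val w)).

Lemma fixed_concrete : exists (K : hilbertType R) (j : {linear fixed_space -> bop K}),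
  injective j /\ complete_isometry j.
Proof.
have [H [J [injJ isoJ _]]] := opspace_form W.
exists H, (J \o fixed_val); split=> [x y /= /injJ|n v]; first exact: val_inj.
by rewrite map_mx_comp isoJ.
Qed.

HB.instance Definition _ := MxNormed_isOpSpace.Build R fixed_space fixed_concrete.

Lemma fixed_valK (x : fixed_space) : theta (fixed_val x) = fixed_val x.
Proof. by case: x => w /= /eqP. Qed.

Lemma fixed_val_isometry : complete_isometry fixed_val.
Proof. by []. Qed.

Lemma norm1_fixed (x : fixed_space) : norm1 (fixed_val x) = norm1 x.
Proof.
by rewrite /norm1 -[RHS](fixed_val_isometry (const_mx x : 'M[fixed_space]_1)) map_const_mx.
Qed.

Hypothesis idem : forall w, theta (theta w) = theta w.
Hypothesis cc_theta : complete_contraction theta.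

Lemma into_fixed_in w : theta w \in fixed.
Proof. by rewrite inE idem. Qed.

Definition into_fixed w : fixed_space := Fixed (into_fixed_in w).

Lemma into_fixed_linear : linear into_fixed.
Proof. by move=> t v w; apply: val_inj; rewrite /= linearP. Qed.

HB.instance Definition _ :=
  GRing.isLinear.Build R[i] W fixed_space *:%R into_fixed into_fixed_linear.

Lemma into_fixed_cc : complete_contraction into_fixed.
Proof.
move=> n w; apply: le_trans (cc_theta w); rewrite -fixed_val_isometry.
by rewrite -map_mx_comp.
Qed.

Lemma into_fixedK (x : fixed_space) : into_fixed (fixed_val x) = x.
Proof. by apply: val_inj => /=; exact: fixed_valK. Qed.

(** A completely contractive retract inherits extensions: extend into [W], then project. *)
Lemma fixed_injective : injective_opspace W ->
  injective_opspace (fixed_space : opSpaceType R).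
Proof.
move=> injW X Y i f isoi ccf.
have ccvf : complete_contraction (fixed_val \o f).
  by move=> n v; rewrite map_mx_comp; exact: ccf.
have [g ccg gE] := injW _ _ i (fixed_val \o f) isoi ccvf.
exists (into_fixed \o g) => [n v|x] /=.
  by rewrite map_mx_comp (le_trans (into_fixed_cc _))//; exact: ccg.
by have /= -> := gE x; exact: into_fixedK.
Qed.

End FixedPoints.

(** * Hamana's construction by a minimal seminorm *)

Section Hamana.
Context (R : realType) (A : choiceType) (m : A -> nat) (V : opSpaceType R).
Local Notation W := (bmats R m).
Context (kap : {linear V -> W}) (isok : complete_isometry kap).

Definition fixing (psi : W -> W) :=
  complete_contraction psi /\ forall v, psi (kap v) = kap v.

(** Minimality refers to the seminorm that sends [w] to [norm1 (psi w)]; matrix levels above the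
    first do not enter the order. *)
Definition minimal_fixing (psi : W -> W) := fixing psi /\
  forall phi : {linear W -> W}, fixing phi ->
    (forall w, norm1 (phi w) <= norm1 (psi w)) ->
    forall w, norm1 (psi w) <= norm1 (phi w).

Lemma complete_contraction_norm1 (X Y : mxNormedType R) (f : X -> Y) x :
  complete_contraction f -> norm1 (f x) <= norm1 x.
Proof. by move=> /(_ 1%N (const_mx x)); rewrite map_const_mx. Qed.

Lemma eq_leW (x y : R) : x = y -> x <= y.
Proof. by move=> ->. Qed.

Lemma exists_minimal_fixing : exists psi : {linear W -> W}, minimal_fixing psi.
Proof.
pose T := {psi : {linear W -> W} | fixing psi}.
have id_fixing : fixing (@idfun W).
  by split; [move=> n w; rewrite map_mx_id; [exact: lexx|]|].
pose t0 : T := exist _ (idfun : {linear W -> W}) id_fixing.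
(* The order is reversed, so that a maximal element has a minimal seminorm. *)
pose Rel (s t : T) := `[< forall w, norm1 (sval t w) <= norm1 (sval s w) >].
have Rel_refl t : Rel t t by apply/asboolP => w; exact: lexx.
have Rel_trans r s t : Rel r s -> Rel s t -> Rel r t.
  move=> /asboolP rs /asboolP st; apply/asboolP => w.
  exact: le_trans (st w) (rs w).
have [C totC|t tmax] := ZL_preorder t0 Rel_refl Rel_trans.
- have [C0|C0] := pselect (C !=set0); last first.
    by exists t0 => s Cs; exfalso; apply: C0; exists s.
  (* The tails of a nonempty chain form a proper filter. Along an ultrafilter refining it, the bound
     by any member [s] holds eventually, so the limit map lies below the whole chain. *)
  pose F := filter_from C (fun s => [set t | C t /\ Rel s t]).
  have FF : ProperFilter F.
    apply: filter_from_proper.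
      apply: filter_from_filter => // s t Cs Ct.
      have [st|ts] := totC _ _ Cs Ct.
        exists t; [exact: Ct|move=> r [Cr tr]].
        by split; (split; [exact: Cr|]); [exact: Rel_trans st tr|exact: tr].
      exists s; [exact: Cs|move=> r [Cr sr]].
      by split; (split; [exact: Cr|]); [exact: sr|exact: Rel_trans ts sr].
    by move=> s Cs; exists s; split; [exact: Cs|exact: Rel_refl].
  have [U [UU FU]] := ultraFilterLemma FF.
  have sP (s : T) : fixing (sval s) := proj2_sig s.
  have cc s : complete_contraction (sval s : {linear W -> W}) := (sP s).1.
  have [phi [pre pim pcc]] := ultra_limit UU cc.
  have phi_fix : fixing phi.
    split=> [n w|v].
      by apply: pcc; [exact: mxnorm_ge0|apply: filterE => s; exact: cc].
    apply: bmats_inj => a; apply/matrixP => k l.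
    have E (s : T) : sval s (kap v) = kap v := (sP s).2 v.
    apply: complex_eqP.
      apply: (cvg_unique _ (pre (kap v) a k l)) => //.
      rewrite (_ : (fun s => _) = fun=> re (block a (kap v) k l)).
        exact: cvg_cst.
      by apply/funext => s; rewrite E.
    apply: (cvg_unique _ (pim (kap v) a k l)) => //.
    rewrite (_ : (fun s => _) = fun=> im (block a (kap v) k l)).
      exact: cvg_cst.
    by apply/funext => s; rewrite E.
  exists (exist _ phi phi_fix) => s Cs; apply/asboolP => w.
  have near_le : U [set t : T | mxnorm (map_mx (sval t : {linear W -> W})
      (const_mx w : 'M[W]_1)) <= norm1 (sval s w)].
    apply: FU; exists s; [exact: Cs|move=> t [_ /asboolP st]].
    by have := st w; rewrite /norm1 -map_const_mx.
  have := pcc _ _ _ (norm1_ge0 (sval s w)) near_le.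
  by rewrite map_const_mx.
exists (sval t); split=> [|phi phi_fix le]; first exact: (proj2_sig t).
have : Rel t (exist _ phi phi_fix) by apply/asboolP.
by move=> /tmax/asboolP.
Qed.

Lemma iter_linear (psi : {linear W -> W}) k : linear (iter k psi).
Proof. by elim: k => [//|k IH] t x y; rewrite /= IH linearP. Qed.

Lemma iter_cc (psi : W -> W) k : complete_contraction psi ->
  complete_contraction (iter k psi).
Proof.
move=> cc; elim: k => [|k IH] n w; first by rewrite map_mx_id.
rewrite (_ : map_mx _ w = map_mx psi (map_mx (iter k psi) w)).
  exact: le_trans (cc _ _) (IH n w).
by apply/matrixP => i j; rewrite !mxE.
Qed.

(* The averages of the powers of [psi] lie below [psi], hence have the same
   seminorm, and they map [w - psi w] to telescoping sums. *)
Lemma minimal_fixing_idem (psi : {linear W -> W}) : minimal_fixing psi ->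
  forall w, psi (psi w) = psi w.
Proof.
move=> [[cc fixk] mini] w.
have key N : norm1 (psi (w - psi w)) <= N.+1%:R^-1 * (2 * norm1 w).
  pose f x := (N.+1%:R^-1)%:C *: \sum_(k < N.+1) iter k.+1 psi x.
  have f_lin : linear f.
    move=> t x y; rewrite /f; under eq_bigr do rewrite iter_linear.
    by rewrite big_split/= -scaler_sumr scalerDr !scalerA mulrC.
  pose fl := GRing.isLinear.Build R[i] W W *:%R f f_lin.
  pose g : {linear W -> W} := HB.pack f fl.
  have avg n (x : 'M[W]_n) c : 0 <= c -> mxnorm (map_mx psi x) <= c ->
      mxnorm (map_mx g x) <= c.
    move=> c0 xc.
    have -> : map_mx g x = \matrix_(i, j) ((N.+1%:R^-1)%:C *:
        \sum_(k < N.+1) (map_mx (iter k psi) (map_mx psi x)) i j).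
      apply/matrixP => i j; rewrite !mxE; congr (_ *: _); apply: eq_bigr => k _.
      by rewrite !mxE iterSr.
    exact: (mxnorm_avg (v := fun k => map_mx (iter k psi) (map_mx psi x)) c0
      (fun k => le_trans (iter_cc k cc _) xc)).
  have g_fix : fixing g.
    split=> [n x|v]; first by apply: avg; [exact: mxnorm_ge0|exact: cc].
    rewrite /= /f; have it k : iter k psi (kap v) = kap v.
      by elim: k => //= k ->.
    under eq_bigr do rewrite it.
    rewrite sumr_const card_ord -[kap v *+ _]scaler_nat scalerA.
    rewrite -(rmorph_nat (real_complex R)) -rmorphM mulVf ?pnatr_eq0//.
    by rewrite rmorph1 scale1r.
  have g_le x : norm1 (g x) <= norm1 (psi x).
    have := avg 1%N (const_mx x) (norm1 (psi x)) (norm1_ge0 _).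
    by rewrite !map_const_mx; apply.
  apply: (le_trans (mini g g_fix g_le _)).
  rewrite /= /f.
  have -> : \sum_(k < N.+1) iter k.+1 psi (w - psi w) = psi w - iter N.+2 psi w.
    have itB k : iter k.+1 psi (w - psi w) = iter k.+1 psi w - iter k.+2 psi w.
      rewrite [iter k.+2 psi w]iterSr; elim: k => [|k IH]; first by rewrite /= linearB.
      by rewrite iterS IH linearB.
    under eq_bigr do rewrite itB.
    rewrite -(big_mkord xpredT (fun k => iter k.+1 psi w - iter k.+2 psi w)).
    rewrite (eq_bigr (fun k => - (iter k.+2 psi w - iter k.+1 psi w))).
      by rewrite sumrN telescope_sumr// opprB.
    by move=> k _; rewrite opprB.
  apply: (le_trans (norm1Z _ _)); first by rewrite invr_ge0.
  apply: ler_wpM2l; first by rewrite invr_ge0 ler0n.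
  apply: (le_trans (norm1D _ _)).
  have h1 := complete_contraction_norm1 w cc.
  have h2 := complete_contraction_norm1 w (@iter_cc psi N.+2 cc).
  have h3 := norm1N (iter N.+2 psi w).
  by rewrite mulr_natl mulr2n; apply: lerD; [exact: h1|exact: le_trans h3 h2].
have z : norm1 (psi (w - psi w)) = 0.
  apply/eqP; rewrite eq_le norm1_ge0 andbT; apply/ler_addgt0Pr => e e0.
  rewrite add0r.
  set M := 2 * norm1 w in key.
  have M0 : 0 <= M by rewrite mulr_ge0// norm1_ge0.
  (* With [N] the integer part of [M / e], [M / (N + 1)] is below [e]. *)
  have := key (Num.truncn (M / e)); move=> /le_trans; apply.
  rewrite ler_pdivrMl ?ltr0n// -ler_pdivrMr//.
  apply: ltW; apply: truncnS_gt.
have : psi (w - psi w) = 0 by apply: norm1_eq0.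
by rewrite linearB => /eqP; rewrite subr_eq0 => /eqP.
Qed.

Lemma exists_envelope : exists (E : opSpaceType R) (i : {linear V -> E})
  (u : {linear E -> W}),
  [/\ injective_envelope i, complete_isometry u & forall v, u (i v) = kap v].
Proof.
have [th thmin] := exists_minimal_fixing.
have [[cc fixk] mini] := thmin.
have idem := minimal_fixing_idem thmin.
pose E : opSpaceType R := fixed_space th.
have in_fix v : kap v \in fixed th by rewrite inE fixk.
pose i0 v : E := Fixed (in_fix v).
have i0_lin : linear i0 by move=> t v v'; apply: val_inj; rewrite /= linearP.
pose il := GRing.isLinear.Build R[i] V E *:%R i0 i0_lin.
pose i : {linear V -> E} := HB.pack i0 il.
have isoi : complete_isometry i.
  move=> n v; rewrite -isok -(fixed_val_isometry (map_mx i v)) -map_mx_comp.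
  by [].
have injE : injective_opspace E := fixed_injective idem cc (@bmats_injective R A m).
have rig : rigid_extension i.
  move=> f ccf fi x.
  (* This is [f] seen on [W]. It lies below the minimal [th], hence is minimal itself and therefore
     idempotent. *)
  pose F : {linear W -> W} := fixed_val (theta := th) \o f \o into_fixed idem.
  have F_fix : fixing F.
    split=> [n w|v].
      have -> : map_mx F w =
          map_mx (fixed_val (theta := th)) (map_mx f (map_mx (into_fixed idem) w)).
        by apply/matrixP => s t; rewrite !mxE.
      exact: le_trans (ccf _ _) (into_fixed_cc idem cc w).
    have -> : F (kap v) = fixed_val (f (i v)).
      by rewrite /F /=; congr (fixed_val (f _)); apply: val_inj; rewrite /= fixk.
    by have /= -> := fi v.
  have F_le w : norm1 (F w) <= norm1 (th w).
    have := complete_contraction_norm1 (into_fixed idem w) ccf.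
    by rewrite -!norm1_fixed.
  have le_F := mini F F_fix F_le.
  have F_min : minimal_fixing F.
    split; [exact: F_fix|move=> phi phi_fix phiF w].
    apply: (le_trans (F_le w)); apply: mini; [exact: phi_fix|move=> w'].
    exact: le_trans (phiF w') (F_le w').
  have FF := minimal_fixing_idem F_min (fixed_val x).
  have Fv y : F (fixed_val y) = fixed_val (f y).
    by rewrite /F /= into_fixedK.
  rewrite !Fv in FF.
  (* Idempotence makes [F] kill [f x - x]. Minimality of [th] makes [th] kill it as well, yet [th]
     fixes it, so it is 0. *)
  have d0 : F (fixed_val (f x) - fixed_val x) = 0.
    by rewrite linearB !Fv FF subrr.
  apply/val_inj/eqP; rewrite -subr_eq0; apply/eqP.
  have : th (fixed_val (f x) - fixed_val x) = 0.
    apply: norm1_eq0; apply/eqP; rewrite eq_le norm1_ge0 andbT.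
    by apply: (le_trans (le_F _)); rewrite d0 norm10.
  by rewrite linearB !fixed_valK.
exists E, i, (fixed_val (theta := th)); split; first split.
- exact: isoi.
- exact: injE.
- exact: rig.
- move=> Z g ccg isogi n x.
  (* Injectivity gives [h] with [h \o g] fixing [V]; by rigidity it is the identity, so [g], having
     a completely contractive left inverse, cannot decrease norms. *)
  have [h cch hg] := injE V Z (g \o i) i isogi (fun n v => eq_leW (isoi n v)).
  have hgid : h \o g =1 id.
    apply: rig => [k y|v]; last exact: hg.
    rewrite map_mx_comp; exact: le_trans (cch _ _) (ccg _ _).
  apply: le_anti; rewrite ccg /=.
  have := cch n (map_mx g x); rewrite -map_mx_comp.
  have -> : map_mx (h \o g) x = x.
    by apply/matrixP => s t; rewrite mxE; exact: hgid.
  by [].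
- by move=> n x; exact: fixed_val_isometry.
- by [].
Qed.

End Hamana.

(** * The operator space dual *)

Section MatrixFlip.
Context (R : realType).

Definition flip_mx n m (B : 'M['M[R[i]]_m]_n) : 'M['M[R[i]]_n]_m :=
  \matrix_(k, l) \matrix_(i, j) B i j k l.

(** The canonical shuffle of a tensor product: the test in [mx_mxnormP] does not distinguish inner
    from outer indices. It is needed because pairing a matrix over the bidual with a matrix over the
    dual exchanges the two sizes. *)
Lemma mxnorm_flip_le n m (B : 'M['M[R[i]]_m]_n) : mxnorm (flip_mx B) <= mxnorm B.
Proof.
have B0 := mx_mxnorm_ge0 B; apply/(mx_mxnormP _ B0) => a b.
have := (mx_mxnormP _ B0).1 (lexx _) (fun j l => a l j) (fun i k => b k i).
have F (d : 'I_m -> 'I_n -> R[i]) : \sum_j \sum_l nrm (d l j : R[i]^o) ^+ 2 =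
    \sum_j \sum_l nrm (d j l : R[i]^o) ^+ 2 by rewrite exchange_big.
rewrite !F => h; apply: le_trans h; rewrite exchange_big4; apply: eq_leW.
congr (re _); do 4 (apply: eq_bigr => ? _); by rewrite !mxE.
Qed.

End MatrixFlip.

Section DualFacts.
Context (R : realType) (V : mxNormedType R).
Implicit Types f g : dual V.

Lemma dual_linear f : linear f.
Proof. by case: f => g gP /=; move/asboolP: (gP) => []. Qed.

Lemma dualP f (t : R[i]) v w : f (t *: v + w) = t * f v + f w.
Proof. exact: dual_linear. Qed.

Lemma dual0 f : f 0 = 0.
Proof. by have := dualP f (-1) 0 0; rewrite scaler0 addr0 mulN1r addNr. Qed.

Lemma dualD f v w : f (v + w) = f v + f w.
Proof. by have := dualP f 1 v w; rewrite scale1r mul1r. Qed.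

Lemma dualZ f (t : R[i]) v : f (t *: v) = t * f v.
Proof. by have := dualP f t v 0; rewrite !addr0 dual0 addr0. Qed.

Lemma dual_sum f I (r : seq I) (P : pred I) (F : I -> V) :
  f (\sum_(i <- r | P i) F i) = \sum_(i <- r | P i) f (F i).
Proof. by apply: (big_morph f) => [x y|]; [exact: dualD|exact: dual0]. Qed.

Lemma dual_bounded f : exists c : R, forall v, nrm (f v) <= c * norm1 v.
Proof. by case: f => g gP /=; move/asboolP: (gP) => []. Qed.

Lemma dual_ext f g : f =1 g -> f = g.
Proof. by move=> fg; apply: val_inj; apply/funext. Qed.

Lemma dualDl f g v : (f + g) v = f v + g v.
Proof. by []. Qed.

Lemma dualZl (t : R[i]) f v : (t *: f) v = t * f v.
Proof. by []. Qed.

(** The map into [M_n] that the matrix [F] over the dual stands for. *)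
Definition dual_mx n (F : 'M[dual V]_n) (v : V) : 'M[R[i]]_n :=
  \matrix_(i, j) F i j v.

Lemma dual_mx_linear n (F : 'M[dual V]_n) : linear (dual_mx F).
Proof. by move=> t v w; apply/matrixP => i j; rewrite !mxE dualP. Qed.

HB.instance Definition _ n (F : 'M[dual V]_n) :=
  GRing.isLinear.Build R[i] V 'M[R[i]]_n *:%R (dual_mx F) (dual_mx_linear F).

Hypothesis rowV : row_bounded V.
Hypothesis V0 : forall n, mxnorm (0 : 'M[V]_n) = 0.
Hypothesis V_ge0 : forall v : V, 0 <= norm1 v.

(** Without such a bound the supremum in [cbnorm] would be a default value. Each entry of [F] is a
    bounded functional, applied to a scalar combination of the entries of [v] that [row_bounded]
    controls. *)
Lemma dual_mx_bounded n (F : 'M[dual V]_n) : exists M : R,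
  forall k (v : 'M[V]_k), mxnorm v <= 1 -> mxnorm (map_mx (dual_mx F) v) <= M.
Proof.
have /choice[C hC] : forall pq : 'I_n * 'I_n, exists C : R,
    0 <= C /\ forall v, nrm (F pq.1 pq.2 v) <= C * norm1 v.
  move=> [p q] /=; have [c hc] := dual_bounded (F p q); exists `|c|.
  split; [exact: normr_ge0|move=> v].
  by rewrite (le_trans (hc v))// ler_wpM2r// ler_norm.
pose D := \sum_p \sum_q C (p, q).
have D0 : 0 <= D.
  by do 2 (apply: sumr_ge0 => ? _); exact: (hC _).1.
have M0 : 0 <= D * 2 by rewrite mulr_ge0.
exists (D * 2) => k v v1; apply/(mx_mxnormP _ M0) => a b.
pose S := hsnorm2 a + hsnorm2 b.
have term p q : re (\sum_i \sum_j F p q (v i j) * a j q * Num.conj (b i p)) <=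
    C (p, q) * S.
  have -> : \sum_i \sum_j F p q (v i j) * a j q * Num.conj (b i p) =
      F p q (\sum_i \sum_j (a j q * Num.conj (b i p)) *: v i j).
    rewrite dual_sum; apply: eq_bigr => i _; rewrite dual_sum.
    by apply: eq_bigr => j _; rewrite dualZ [RHS]mulrC mulrA.
  have [C0 hpq] := hC (p, q).
  apply: (le_trans (re_le_nrm _)); apply: (le_trans (hpq _)); apply: ler_wpM2l => //.
  apply: (le_trans (rowV _ _ v1)); apply: lerD.
    apply: ler_sum => j _; rewrite (bigD1 q)//= lerDl sumr_ge0// => l _.
    exact: sqr_ge0.
  apply: ler_sum => j _; rewrite (bigD1 p)//= lerDl sumr_ge0// => l _.
  exact: sqr_ge0.
apply: (@le_trans _ _ (D * S)); last first.
  by rewrite -mulrA; apply: ler_wpM2l => //; rewrite /S /hsnorm2; lra.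
have -> : \sum_i \sum_j \sum_p \sum_q
    map_mx (dual_mx F) v i j p q * a j q * Num.conj (b i p) =
    \sum_p \sum_q \sum_i \sum_j F p q (v i j) * a j q * Num.conj (b i p).
  by rewrite exchange_big4; do 4 (apply: eq_bigr => ? _); rewrite !mxE.
rewrite re_sum /D mulr_suml; apply: ler_sum => p _.
by rewrite re_sum mulr_suml; apply: ler_sum => q _; exact: term.
Qed.

Lemma dual_mxnormP n (F : 'M[dual V]_n) c :
  mxnorm F <= c <-> forall k (v : 'M[V]_k), mxnorm v <= 1 ->
    mxnorm (map_mx (dual_mx F) v) <= c.
Proof.
split=> [Fc k v v1|h].
  apply: le_trans Fc; have [M hM] := dual_mx_bounded F.
  apply: ub_le_sup; last by exists k, v.
  by exists M => _ [l [w [w1 ->]]]; exact: hM.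
apply: ge_sup; last by move=> _ [k [v [v1 ->]]]; exact: h.
by exists (mxnorm (map_mx (dual_mx F) (0 : 'M[V]_0))), 0%N, 0; rewrite V0 ler01.
Qed.

Lemma dual_mxnorm_ge0 n (F : 'M[dual V]_n) : 0 <= mxnorm F.
Proof.
have z1 : mxnorm (0 : 'M[V]_0) <= 1 by rewrite V0 ler01.
exact: le_trans (mx_mxnorm_ge0 _) ((dual_mxnormP F _).1 (lexx _) _ _ z1).
Qed.

Lemma dual_mxnorm0 n : mxnorm (0 : 'M[dual V]_n) = 0.
Proof.
apply: le_anti; rewrite dual_mxnorm_ge0 andbT; apply/dual_mxnormP => k v _.
apply/(mx_mxnormP _ (lexx 0)) => a b; rewrite mul0r big1 ?re0// => i _.
rewrite big1// => j _; rewrite big1// => p _; rewrite big1// => q _.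
by rewrite !mxE mul0r mul0r.
Qed.

(** The scalars [a] and [b] are absorbed into the test vectors, as [x j * a q] and [y i * b p],
    whose sums of squares factor. With this the norm facts above also apply to the bidual. *)
Lemma dual_row_bounded : row_bounded (dual V).
Proof.
move=> n F a b F1; apply/dual_mxnormP => k v v1.
set S := \sum_j _ + _.
have S0 : 0 <= S.
  by rewrite addr_ge0// sumr_ge0// => j _; exact: sqr_ge0.
apply/(mx_mxnormP _ S0) => x y.
have := (mx_mxnormP _ ler01).1 ((dual_mxnormP F _).1 F1 k v v1)
  (fun j q => x j 0 * a q) (fun i p => y i 0 * b p).
have N (z : 'I_k -> 'I_1 -> R[i]) (d : 'I_n -> R[i]) :
    \sum_j \sum_l nrm (z j 0 * d l : R[i]^o) ^+ 2 =
    (\sum_j nrm (d j : R[i]^o) ^+ 2) * \sum_j \sum_l nrm (z j l : R[i]^o) ^+ 2.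
  rewrite mulr_sumr; apply: eq_bigr => j _; rewrite big_ord1 mulr_suml.
  by apply: eq_bigr => l _; rewrite nrmCM exprMn mulrC.
rewrite !N; set X := \sum_j \sum_l nrm (x j l : R[i]^o) ^+ 2.
set Y := \sum_j \sum_l nrm (y j l : R[i]^o) ^+ 2.
have X0 : 0 <= X by do 2 (apply: sumr_ge0 => ? _); exact: sqr_ge0.
have Y0 : 0 <= Y by do 2 (apply: sumr_ge0 => ? _); exact: sqr_ge0.
set P := \sum_j nrm (a j : R[i]^o) ^+ 2; set Q := \sum_j nrm (b j : R[i]^o) ^+ 2.
have P0 : 0 <= P by apply: sumr_ge0 => ? _; exact: sqr_ge0.
have Q0 : 0 <= Q by apply: sumr_ge0 => ? _; exact: sqr_ge0.
move=> h; apply: (@le_trans _ _ (1 * ((P * X + Q * Y) / 2))); last first.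
  rewrite /S -/P -/Q; have := mulr_ge0 P0 Y0; have := mulr_ge0 Q0 X0; lra.
apply: le_trans h; apply: eq_leW; congr (re _).
apply: eq_bigr => i _; apply: eq_bigr => j _; rewrite !big_ord1 !mxE.
have -> : (\sum_p \sum_q (a q * Num.conj (b p)) *: F p q) (v i j) =
    \sum_p \sum_q (a q * Num.conj (b p)) * F p q (v i j).
  rewrite (big_morph (fun f : dual V => f (v i j)) (id1 := 0) (op1 := +%R))//.
  apply: eq_bigr => p _.
  by rewrite (big_morph (fun f : dual V => f (v i j)) (id1 := 0) (op1 := +%R)).
rewrite !mulr_suml; apply: eq_bigr => p _; rewrite !mulr_suml.
by apply: eq_bigr => q _; rewrite !mxE rmorphM /=; ring.
Qed.

End DualFacts.

(** * Normal functionals and the weak* topology *)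

Section Riesz.
Context (R : realType) (H : hilbertType R).

Lemma ball_nrm (x y : H) (e : R) : ball x e%:C y <-> nrm (x - y) < e.
Proof. by rewrite -ball_normE /= nrmE ltcR. Qed.

Lemma sqr_nrmD (x y : H) :
  nrm (x + y) ^+ 2 = nrm x ^+ 2 + rip x y *+ 2 + nrm y ^+ 2.
Proof. by rewrite -!ripxx ripDl !ripDr (ripC y x); ring. Qed.

Lemma ripZr (t : R) (x y : H) : rip x (t%:C *: y) = t * rip x y.
Proof. by rewrite ripC ripZl ripC. Qed.

Lemma nrmZ_real (t : R) (x : H) : nrm (t%:C *: x) ^+ 2 = t ^+ 2 * nrm x ^+ 2.
Proof. by rewrite -!ripxx ripZl ripZr mulrA expr2. Qed.

Section RealFunctional.
Context (f : H -> R) (c : R).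
Hypotheses (fD : forall x y, f (x + y) = f x + f y)
  (fZ : forall (t : R) x, f (t%:C *: x) = t * f x)
  (f_le : forall x, f x <= c * nrm x).

(** If [y] represents [f], then [g x] is the square of [x - y] minus that of [y], so the vector
    sought is the minimizer of [g]. *)
Let g x := nrm x ^+ 2 - 2 * f x.

Let g_lb : has_inf (range g).
Proof.
split; first by exists (g 0), 0.
exists (- c ^+ 2) => _ [x _ <-]; rewrite /g.
have := f_le x; have := sqr_ge0 (nrm x - c); lra.
Qed.

Let d := inf (range g).

Let d_le x : d <= g x.
Proof. by apply: ge_inf; [exact: g_lb.2|exists x]. Qed.

Let g_near (e : R) : 0 < e -> exists x, g x <= d + e.
Proof.
move=> e0; have [_ [x _ <-] xe] := inf_adherent e0 g_lb.
by exists x; exact: ltW.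
Qed.

(** The parallelogram law at the midpoint: near-minimizers are close to each other, which makes
    their filter Cauchy. *)
Let g_mid x y (e : R) : g x <= d + e -> g y <= d + e -> nrm (x - y) ^+ 2 <= 4 * e.
Proof.
move=> gx gy; have := d_le ((2^-1)%:C *: (x + y)).
have fN z : f (- z) = - f z by rewrite -scaleN1r -(rmorphN1 (real_complex R)) fZ mulN1r.
rewrite /g nrmZ_real fZ fD sqr_nrmD sqr_nrmD nrmN ripNr.
move: gx gy; rewrite /g; lra.
Qed.

Lemma riesz_real : exists y, forall x, f x = rip x y.
Proof.
pose F := filter_from [set e : R | 0 < e] (fun e => [set x | g x <= d + e]).
have FF : ProperFilter F.
  apply: filter_from_proper; last first.
    by move=> e e0; have [x xe] := g_near e0; exists x.
  apply: filter_from_filter; first by exists 1 => /=.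
  move=> e1 e2 /= e10 e20; exists (Num.min e1 e2); first by rewrite /= lt_min e10.
  move=> x /= xe; split; apply: (le_trans xe); rewrite lerD2l ge_min lexx ?orbT//.
have Fc : cauchy F.
  apply: cauchy_exP => e e0.
  have eE : e = (re e)%:C.
    by move: e0; rewrite ltcE => /andP[/eqP h _]; exact: complex_eqP.
  have e0' : 0 < re e by move: e0; rewrite ltcE => /andP[].
  have d0 : 0 < re e ^+ 2 / 8 by rewrite divr_gt0// exprn_gt0.
  have [x xe] := g_near d0; exists x; exists (re e ^+ 2 / 8) => //= y ye.
  rewrite eE; apply/ball_nrm; have := g_mid xe ye => h.
  rewrite -(ltr_pXn2r (n := 2)) ?nnegrE ?nrm_ge0 ?(ltW e0')//.
  apply: (le_lt_trans h); have := exprn_gt0 2 e0'; lra.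
have /cvg_ex[y Fy] : cvg F by exact: cauchy_cvg.
have fN z : f (- z) = - f z by rewrite -scaleN1r -(rmorphN1 (real_complex R)) fZ mulN1r.
have c0 : 0 <= `|c| by [].
have gy : g y <= d.
  (* Continuity of [g] at [y], made explicit with a near-minimizer [x = y - h] within [e] of [y].
     The constant collects the cross term [2 (|y| + e) e], the square of [h], the value of [f] at
     [h] and the slack [e], using [e <= 1]. *)
  have key (e : R) : 0 < e -> e <= 1 ->
      g y <= d + e * (2 * nrm y + 4 + 2 * `|c|).
    move=> e0 e1.
    have /Fy Fb : nbhs y (ball y e%:C) by apply: nbhsx_ballx; rewrite ltcR.
    have Fe : F [set x | g x <= d + e] by exists e.
    have [x [/ball_nrm yx /= xe]] := filter_ex (filterI Fb Fe).
    set h := y - x in yx.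
    have gyE : g y = nrm x ^+ 2 + rip x h *+ 2 + nrm h ^+ 2 - 2 * (f x + f h).
      have -> : y = x + h by rewrite /h addrC subrK.
      by rewrite /g fD sqr_nrmD.
    have xb : nrm x <= nrm y + e.
      have -> : x = y - h by rewrite /h opprB addrC subrK.
      by apply: (le_trans (nrmB _ _)); rewrite lerD2l ltW.
    rewrite gyE; have h0 := nrm_ge0 h; have x0 := nrm_ge0 x.
    have h1 : rip x h <= (nrm y + e) * e.
      apply: (le_trans (rip_CS _ _)); apply: ler_pM => //; exact: ltW.
    have h2 : nrm h ^+ 2 <= e * 1.
      rewrite expr2; apply: ler_pM => //; first exact: ltW.
      by rewrite (le_trans (ltW yx)).
    have h3 : - f h <= `|c| * e.
      rewrite -fN; apply: (le_trans (f_le _)); rewrite nrmN.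
      apply: (le_trans (_ : _ <= `|c| * nrm h)); first by rewrite ler_wpM2r// ler_norm.
      by rewrite ler_wpM2l// ltW.
    have h4 : e * e <= e * 1 by rewrite ler_pM2l.
    have xe' : nrm x ^+ 2 - 2 * f x <= d + e := xe.
    move: (rip x h) h1 => P h1; rewrite mulrDl in h1.
    rewrite !mulrDr; lra.
  apply/ler_addgt0Pr => e e0.
  pose M := 2 * nrm y + 4 + 2 * `|c|.
  have M0 : 0 < M by rewrite /M; have := nrm_ge0 y; lra.
  have m0 : 0 < Num.min 1 (e / M) by rewrite lt_min ltr01 divr_gt0.
  have m1 : Num.min 1 (e / M) <= 1 by rewrite ge_min lexx.
  apply: (le_trans (key _ m0 m1)); rewrite lerD2l -/M -ler_pdivlMr//.
  by rewrite ge_min lexx orbT.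
exists y => z.
(* The variation of [g] at its minimum in the direction [z]. *)
have var (t : R) : 0 <= t ^+ 2 * nrm z ^+ 2 + (t * (rip y z - f z)) *+ 2.
  have := le_trans gy (d_le (y + t%:C *: z)).
  rewrite /g fD fZ sqr_nrmD nrmZ_real ripZr; lra.
rewrite (ripC z y); set a := rip y z - f z in var.
suff : a = 0 by rewrite /a => /eqP; rewrite subr_eq0 => /eqP.
have [//|a0] := eqVneq a 0; exfalso.
have b0 : 0 < nrm z ^+ 2 + 1 by rewrite ltr_wpDl// sqr_ge0.
(* At this [t] the quadratic is negative unless [a = 0]; adding 1 keeps the denominator positive. *)
have := var (- a / (nrm z ^+ 2 + 1)).
set b := nrm z ^+ 2 + 1 in b0 *.
have -> : nrm z ^+ 2 = b - 1 by rewrite /b addrK.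
have -> : (- a / b) ^+ 2 * (b - 1) + (- a / b * a) *+ 2 =
    - (a ^+ 2 / b) * (1 + b^-1).
  by field; rewrite gt_eqF.
have a2 : 0 < a ^+ 2 by rewrite lt_def sqr_ge0 andbT sqrf_eq0.
rewrite mulNr oppr_ge0 leNgt mulr_gt0//.
- by rewrite divr_gt0.
- by rewrite ltr_wpDr// invr_ge0 ltW.
Qed.

End RealFunctional.

Lemma riesz (f : H -> R[i]) (c : R) : linear (f : H -> R[i]^o) ->
  (forall x, nrm (f x : R[i]^o) <= c * nrm x) ->
  exists y, forall x, f x = inner x y.
Proof.
move=> lf fc.
have f0 : f 0 = 0 by have := lf (-1) 0 0; rewrite !scaleN1r oppr0 addr0 addNr.
have fD x y : f (x + y) = f x + f y.
  by have := lf 1 x y; rewrite !scale1r.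
have fZ (a : R[i]) x : f (a *: x) = a * f x.
  by have := lf a x 0; rewrite !addr0 f0 addr0.
have [y yP] := @riesz_real (fun x => re (f x)) c
  (fun x y => etrans (congr1 _ (fD x y)) (reD _ _))
  (fun t x => etrans (congr1 _ (fZ _ x)) (reZ _ _))
  (fun x => le_trans (re_le_nrm _) (fc x)).
exists y => x; apply: complex_eqP; first exact: yP.
have := yP ('i *: x); rewrite /rip fZ innerZl.
by case: (f x) => a b; case: (inner x y : R[i]) => a' b' /=; lra.
Qed.

Lemma bop_of_form (B : H -> H -> R[i]) (c : R) :
  (forall (a : R[i]) x x' y, B (a *: x + x') y = a * B x y + B x' y) ->
  (forall (a : R[i]) x y y', B x (a *: y + y') = Num.conj a * B x y + B x y') ->
  (forall x y, nrm (B x y : R[i]^o) <= c * nrm x * nrm y) ->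
  exists T : bop H, forall x y, inner (T x) y = B x y.
Proof.
move=> Bl Br Bc.
(* The form is conjugate-linear in [y]; its conjugate is linear and [riesz] applies, the
   representing vector being [T x]. *)
have /choice[T TP] : forall x, exists z : H, forall y, Num.conj (B x y) = inner y z.
  move=> x; apply: (@riesz (fun y => Num.conj (B x y)) (c * nrm x)).
    by move=> a y y' /=; rewrite Br rmorphD rmorphM /= conjCK.
  by move=> y; rewrite nrmC_conj.
have TE x y : inner (T x) y = B x y by rewrite innerC -TP conjCK.
have Tl : linear T.
  by move=> a x x'; apply: inner_inj => y; rewrite innerDl innerZl !TE Bl.
have Tb : exists M : R, forall x, nrm (T x) <= M * nrm x.
  exists c => x; have [T0|T0] := eqVneq (nrm (T x)) 0.
    rewrite T0; have := Bc x x; have [x0|x0] := eqVneq (nrm x) 0; first by move=> _; rewrite x0 mulr0.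
    have xp : 0 < nrm x by rewrite lt_def x0 nrm_ge0.
    have := nrm_ge0 (B x x : R[i]^o) => h /(le_trans h).
    by rewrite pmulr_lge0.
  have Tp : 0 < nrm (T x) by rewrite lt_def T0 nrm_ge0.
  rewrite -(ler_pM2r Tp) -expr2 -ripxx.
  by apply: (le_trans (re_le_nrm _)); rewrite TE.
have [S SE] := bop_build Tl Tb.
by exists S => x y; rewrite SE.
Qed.

End Riesz.

Section ComplexLimits.
Context (R : realType) (T : Type) (F : set_system T) (FF : ProperFilter F).
Implicit Types (u : T -> R[i]^o) (l : R[i]^o).

Lemma nrm_le_re_im (z : R[i]) : nrm (z : R[i]^o) <= `|re z| + `|im z|.
Proof.
rewrite -(ler_pXn2r (n := 2)) ?nnegrE ?nrm_ge0 ?addr_ge0// sqr_nrmC.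
rewrite -[re z ^+ 2]real_normK ?num_real// -[im z ^+ 2]real_normK ?num_real//.
have := mulr_ge0 (normr_ge0 (re z)) (normr_ge0 (im z)).
set a := `|re z|; set b := `|im z|; rewrite sqrrD; lra.
Qed.

Lemma cvgC_nrmP u l : u @ F --> l <->
  forall e : R, 0 < e -> \forall t \near F, nrm (l - u t) < e.
Proof.
split=> [/cvgrPdist_lt h e e0|h].
  have /h : 0 < e%:C :> R[i] by rewrite ltcR.
  by apply: filterS => t; rewrite nrmE ltcR.
apply/cvgrPdist_lt => e e0.
have eE : e = (re e)%:C.
  by move: e0; rewrite ltcE => /andP[/eqP h' _]; exact: complex_eqP.
have e0' : 0 < re e by move: e0; rewrite ltcE => /andP[].
by apply: filterS (h _ e0') => t; rewrite eE nrmE ltcR.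
Qed.

Lemma cvgC_re_im u l : (fun t => re (u t)) @ F --> re l ->
  (fun t => im (u t)) @ F --> im l -> u @ F --> l.
Proof.
move=> /cvgrPdist_lt ul /cvgrPdist_lt vl; apply/cvgC_nrmP => e e0.
have e2 : 0 < e / 2 by rewrite divr_gt0.
apply: filterS2 (ul _ e2) (vl _ e2) => t; rewrite -reB.
have -> : im l - im (u t) = im (l - u t) by rewrite imB.
move=> h1 h2; apply: (le_lt_trans (nrm_le_re_im _)).
by rewrite [e]splitr ltrD.
Qed.

Lemma cvgC_le u l p (c : R) : u @ F --> l ->
  (\forall t \near F, nrm (u t - p) <= c) -> nrm (l - p) <= c.
Proof.
move=> /cvgC_nrmP ul uc; apply/ler_addgt0Pr => e e0.
have [t [h1 h2]] := filter_ex (filterI (ul e e0) uc).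
have -> : l - p = (u t - p) + (l - u t) by rewrite [RHS]addrC subrKA.
by apply: (le_trans (nrmD _ _)); apply: lerD => //; exact: ltW.
Qed.

Lemma cvgC_unique u l l' : u @ F --> l -> u @ F --> l' -> l = l'.
Proof.
move=> ul /cvgC_nrmP ul'.
have h (e : R) : 0 < e -> nrm (l - l') <= e.
  move=> e0; apply: (cvgC_le ul); apply: filterS (ul' e e0) => t /ltW.
  by rewrite -nrmN opprB.
apply/eqP; rewrite -subr_eq0; apply/eqP; apply: nrm_eq0.
apply: le_anti; rewrite nrm_ge0 andbT; apply/ler_addgt0Pr => e e0.
by rewrite add0r h.
Qed.

End ComplexLimits.

(** * Convergence of normal functionals and the weak* closure *)

Section NormalFunctionals.
Context (R : realType) (H : hilbertType R).
Implicit Types (S T : bop H) (w : normal_index H).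

Lemma bop_nrm_le T x : nrm (T x) <= norm1 T * nrm x.
Proof.
have := ampl_norm_app (@nrm_ge0 _ _) (@nrm_eq0 _ _) (@ripDl R H) (@ripZl R H)
  (@ripC R H) (@ripxx R H)
  (T := fun i j => (const_mx T : 'M[bop H]_1) i j)
  (fun i j t x => @bopZr R H ((const_mx T : 'M[bop H]_1) i j) _ x)
  (fun i j => @bop_bounded R H ((const_mx T : 'M[bop H]_1) i j)) (fun=> x).
rewrite !big_ord1 mxE -exprMn ler_pXn2r ?nnegrE ?nrm_ge0//.
by rewrite mulr_ge0 ?nrm_ge0//; exact: bop_mxnorm_ge0.
Qed.

Definition wx w (k : nat) : H := (sval w).1 k.
Definition wy w (k : nat) : H := (sval w).2 k.

(** By AM-GM this dominates the product of the norms of the two vectors, and its summability follows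
    at once from square summability. *)
Definition weight w (k : nat) : R := (nrm (wx w k) ^+ 2 + nrm (wy w k) ^+ 2) / 2.

Definition normal_partial T w (n : nat) : R[i]^o :=
  \sum_(0 <= k < n) inner (T (wx w k)) (wy w k).

Lemma weight_ge0 w k : 0 <= weight w k.
Proof. by rewrite divr_ge0// addr_ge0// sqr_ge0. Qed.

Lemma inner_weight T w k :
  nrm (inner (T (wx w k)) (wy w k) : R[i]^o) <= norm1 T * weight w k.
Proof.
have T0 : 0 <= norm1 T by exact: bop_mxnorm_ge0.
apply: (le_trans (inner_CS _ _)).
apply: (@le_trans _ _ (norm1 T * nrm (wx w k) * nrm (wy w k))).
  by rewrite ler_wpM2r ?nrm_ge0// bop_nrm_le.
rewrite -mulrA ler_wpM2l// /weight.
have := sqr_ge0 (nrm (wx w k) - nrm (wy w k)); lra.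
Qed.

Lemma weight_cvg w : cvgn (series (weight w)).
Proof.
have [sx sy] := svalP w.
have -> : series (weight w) = (fun n => (series (fun k => nrm (wx w k) ^+ 2) n +
    series (fun k => nrm (wy w k) ^+ 2) n) * 2^-1).
  by apply/funext => n; rewrite /series /= -big_split/= mulr_suml.
by apply: is_cvgMr_tmp; apply: is_cvgD.
Qed.

Definition total_weight w : R := limn (series (weight w)).

Definition tail_weight w n : R := total_weight w - series (weight w) n.

Lemma weight_nondecreasing w : nondecreasing_seq (series (weight w)).
Proof. by apply: nondecreasing_series => k _ _; exact: weight_ge0. Qed.

Lemma tail_weight_cvg w : tail_weight w @ \oo --> (0 : R).
Proof.
rewrite -(subrr (total_weight w)).
by apply: cvgB; [exact: cvg_cst|exact: weight_cvg].
Qed.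

Lemma normal_partialB T w n p : (n <= p)%N ->
  nrm (normal_partial T w p - normal_partial T w n) <= norm1 T * tail_weight w n.
Proof.
move=> np; have T0 : 0 <= norm1 T by exact: bop_mxnorm_ge0.
rewrite /normal_partial (@big_cat_nat _ _ _ n)//= addrAC subrr add0r.
apply: (le_trans (nrm_sum _ _ _)).
apply: (@le_trans _ _ (\sum_(n <= k < p) norm1 T * weight w k)).
  by apply: ler_sum => k _; exact: inner_weight.
rewrite -mulr_sumr ler_wpM2l// /tail_weight lerBrDr addrC.
have -> : series (weight w) n + \sum_(n <= k < p) weight w k = series (weight w) p.
  by rewrite /series /= [RHS](@big_cat_nat _ _ _ n).
exact: nondecreasing_cvgn_le (weight_nondecreasing w) (@weight_cvg w) p.
Qed.

(** The limit defining [normal_functional] means something only with convergence, here by domination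
    of the real and the imaginary series by the weights. *)
Lemma normal_cvg T w : normal_partial T w @ \oo --> normal_functional T w.
Proof.
have abs (f : R[i] -> R) : (forall z, `|f z| <= nrm (z : R[i]^o)) ->
    cvgn (series (fun k => f (inner (T (wx w k)) (wy w k)))).
  move=> fz; apply: normed_cvg.
  apply: (@series_le_cvg _ _ (fun k => norm1 T * weight w k)).
  - by move=> k; exact: normr_ge0.
  - by move=> k; rewrite mulr_ge0 ?weight_ge0//; exact: bop_mxnorm_ge0.
  - by move=> k; exact: le_trans (fz _) (inner_weight _ _ _).
  - have -> : series (fun k => norm1 T * weight w k) =
        (fun n => norm1 T * series (weight w) n).
      by apply/funext => n; rewrite /series /= mulr_sumr.
    by apply: is_cvgMl_tmp; exact: weight_cvg.
have cr := abs _ (@normr_re_le R); have ci := abs _ (@normr_im_le R).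
set a := limn _ in cr; set b := limn _ in ci.
have h : normal_partial T w @ \oo --> (a +i* b : R[i]^o).
  apply: cvgC_re_im => /=.
    by under eq_fun do rewrite re_sum; exact: cr.
  by under eq_fun do rewrite im_sum; exact: ci.
suff -> : normal_functional T w = a +i* b by [].
exact/cvg_lim.
Qed.

(** The rate depends on [T] only through its norm, so a normal functional is a norm limit of finite
    sums of vector functionals. *)
Lemma normal_tail T w n :
  nrm (normal_functional T w - normal_partial T w n) <= norm1 T * tail_weight w n.
Proof.
apply: (cvgC_le _ (@normal_cvg T w)).
by exists n => // p /= np; exact: normal_partialB.
Qed.

Lemma normal_functional_eq T w (l : R[i]^o) :
  normal_partial T w @ \oo --> l -> normal_functional T w = l.
Proof. by move=> h; apply: cvgC_unique (@normal_cvg T w) h. Qed.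

Lemma normal_functional_linear w (a : R[i]) S T :
  normal_functional (a *: S + T) w =
  a * normal_functional S w + normal_functional T w.
Proof.
apply: normal_functional_eq.
have -> : normal_partial (a *: S + T) w =
    (fun n => a *: normal_partial S w n + normal_partial T w n).
  apply/funext => n; rewrite /normal_partial scaler_sumr -big_split.
  by apply: eq_bigr => k _; rewrite bopDl bopZl innerDl innerZl.
by apply: cvgD; [apply: cvgZl_tmp|]; exact: normal_cvg.
Qed.

(** Exact agreement with [T] on finite lists of functionals is a filter base on [X] that converges
    to [T] in the initial topology. [List.In] is used as [normal_index] carries no decidable
    equality. *)
Lemma weak_star_closure_exact (X : set (bop H)) T :
  (forall s : seq (normal_index H), exists2 S, X S &
    forall w, List.In w s -> normal_functional S w = normal_functional T w) ->
  weak_star_closure X T.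
Proof.
move=> h.
pose agree (s : seq (normal_index H)) := [set S | X S /\ forall w, List.In w s ->
  normal_functional S w = normal_functional T w].
pose F := filter_from [set: seq (normal_index H)] agree.
have FF : ProperFilter F.
  apply: filter_from_proper; last first.
    by move=> s _; have [S XS Sw] := h s; exists S.
  apply: filter_from_filter; first by exists [::].
  move=> s t _ _; exists (s ++ t) => // S [XS Sw].
  by split; split=> // w ws; apply: Sw; apply: List.in_or_app; [left|right].
move=> B [C [[Q Qopen QC] CT] CB]; subst C.
have FO : F ((@normal_functional R H : bop H -> {ptws normal_index H -> R[i]^o}) @^-1` Q).
  have : {ptws, (@normal_functional R H : bop H -> {ptws normal_index H -> R[i]^o}) @ F -->
      (normal_functional T : {ptws normal_index H -> R[i]^o})}.
    apply/cvg_sup => w D /= [_ [[B' _ <-] /= B'T B'D]].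
    exists [:: w] => // S [_ Sw] /=; apply: B'D => /=.
    by rewrite Sw//=; left.
  by apply; apply: open_nbhs_nbhs.
have FX : F X by exists [::] => // S [].
have [S [XS QS]] := filter_ex (filterI FX FO).
by exists S; split=> //; exact: CB.
Qed.

(** Evaluation at each [w] is continuous for the initial topology, so finitely many such conditions
    cut out a neighbourhood of [T]. *)
Lemma weak_star_closure_approx (X : set (bop H)) T (s : seq (normal_index H)) (e : R) :
  0 < e -> weak_star_closure X T -> exists2 S, X S &
    forall w, List.In w s ->
      nrm (normal_functional T w - normal_functional S w) < e.
Proof.
move=> e0 clT.
have near w : nbhs (T : weak_star_bop H)
    [set S : weak_star_bop H | nrm (normal_functional T w - normal_functional S w) < e].
  have ct : {for (T : weak_star_bop H), continuous
      (fun S : weak_star_bop H => normal_functional S w)}.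
    have p : {for (normal_functional T : {ptws normal_index H -> R[i]^o}),
        continuous (fun g : {ptws normal_index H -> R[i]^o} => g w)}.
      have /cvg_sup/(_ w) h : nbhs (normal_functional T : {ptws normal_index H -> R[i]^o}) -->
          (normal_functional T : {ptws normal_index H -> R[i]^o}) by [].
      move=> B /=; rewrite nbhsE => -[B' [B'o B'T] B'B]; apply: h.
      exists ((fun g : normal_index H -> R[i]^o => g w) @^-1` B').
      by split; [exists B'|exact: B'T|move=> g; exact: B'B].
    exact: (cvg_comp _ _ (@initial_continuous _ _
      (@normal_functional R H : bop H -> {ptws normal_index H -> R[i]^o}) T) p).
  by have /cvgC_nrmP := ct; apply.
have : nbhs (T : weak_star_bop H) [set S : weak_star_bop H | forall w, List.In w s ->
    nrm (normal_functional T w - normal_functional S w) < e].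
  elim: s => [|w s IH]; first by apply: filterE => S w [].
  by apply: filterS2 (near w) IH => S h1 h2 w' [ <-|ws]; [exact: h1|exact: h2].
by move=> /clT [S [XS h]]; exists S.
Qed.

End NormalFunctionals.

(** * From WEP to weak expectations *)

Section FiniteInterpolation.
Context (R : realType) (V : mxNormedType R).

(** The hypothesis on kernels says that [g] is in the linear span of [s]. Stating this through [xi]
    avoids choosing coefficients. *)
Lemma dual_span (s : seq (dual V)) (g : dual V) (xi : dual V -> R[i]) :
  (forall (a : R[i]) f h, xi (a *: f + h) = a * xi f + xi h) ->
  (forall v, (forall f, List.In f s -> f v = 0) -> g v = 0) ->
  (forall f, List.In f s -> xi f = 0) -> xi g = 0.
Proof.
move=> xiP; have xi0 : xi 0 = 0.
  by have := xiP (-1) 0 0; rewrite scaler0 addr0 mulN1r addNr.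
elim: s g => [|f s IH] g gs xis.
  rewrite (_ : g = 0); first exact: xi0.
  by apply: dual_ext => v; rewrite gs.
have [[u [us fu]]|nu] := pselect (exists u,
    (forall h, List.In h s -> h u = 0) /\ f u = 1).
  have : xi (- g u *: f + g) = 0.
    apply: IH => [v vs|h hs]; last by apply: xis; right.
    rewrite dualDl dualZl.
    have : g (- f v *: u + v) = 0.
      apply: gs => h [<-|hs]; first by rewrite dualD dualZ fu mulr1 addNr.
      by rewrite dualD dualZ (us h hs) (vs h hs) mulr0 addr0.
    by rewrite dualD dualZ => <-; rewrite !mulNr mulrC.
  by rewrite xiP xis ?mulr0 ?add0r//; left.
apply: IH => [v vs|h hs]; last by apply: xis; right.
apply: gs => h [<-|hs]; last exact: vs.
have [//|fv] := eqVneq (f v) 0; exfalso; apply: nu.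
exists ((f v)^-1 *: v); split=> [h' hs|]; first by rewrite dualZ (vs h' hs) mulr0.
by rewrite dualZ mulVf.
Qed.

(** Helly's lemma in its purely algebraic form, without control on the norm of [v]. *)
Lemma dual_interpolation (s : seq (dual V)) (xi : dual V -> R[i]) :
  (forall (a : R[i]) f h, xi (a *: f + h) = a * xi f + xi h) ->
  exists v, forall f, List.In f s -> f v = xi f.
Proof.
move=> xiP; elim: s => [|f s [v vs]]; first by exists 0.
have [[u [us fu]]|nu] := pselect (exists u,
    (forall h, List.In h s -> h u = 0) /\ f u = 1).
  exists ((xi f - f v) *: u + v) => h [<-|hs].
    by rewrite dualD dualZ fu mulr1 subrK.
  by rewrite dualD dualZ (us h hs) mulr0 add0r vs.
suff : xi f - f v = 0.
  by move/eqP; rewrite subr_eq0 => /eqP fv; exists v => h [<-|/vs].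
(* Without a separating [u], [f] depends on [s], where [xi] and evaluation at [v] already agree. *)
apply: (@dual_span s f (fun h => xi h - h v)).
- by move=> a g h; rewrite xiP dualDl dualZl; ring.
- move=> w ws; have [//|fw] := eqVneq (f w) 0; exfalso; apply: nu.
  exists ((f w)^-1 *: w); split=> [h hs|]; first by rewrite dualZ (ws h hs) mulr0.
  by rewrite dualZ mulVf.
- by move=> h /vs ->; rewrite subrr.
Qed.

Lemma dual_of_fun (g : V -> R[i]) (c : R) :
  (forall (a : R[i]) v w, g (a *: v + w) = a * g v + g w) ->
  (forall v, nrm (g v : R[i]^o) <= c * norm1 v) -> exists f : dual V, f =1 g.
Proof.
move=> gl gc; have gin : (g : V -> R[i]^o) \in bounded_functional (V := V).
  by apply/asboolP; split; [move=> a v w; exact: gl|exists c].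
by exists (Dual gin).
Qed.

Hypothesis rowV : row_bounded V.
Hypothesis V0 : forall n, mxnorm (0 : 'M[V]_n) = 0.
Hypothesis Vge0 : forall v : V, 0 <= norm1 v.

(** The left side is a completely bounded norm. The factor 2 comes from the coarse bound in
    [row_bounded] and is harmless: the lemma serves boundedness and convergence only. *)
Lemma dual_norm1_le (f : dual V) c : 0 <= c ->
  (forall v, nrm (f v) <= c * norm1 v) -> norm1 f <= 2 * c.
Proof.
move=> c0 fc; apply/(dual_mxnormP rowV V0 Vge0) => k v v1.
have c20 : 0 <= 2 * c by rewrite mulr_ge0.
apply/(mx_mxnormP _ c20) => a b.
have -> : \sum_i \sum_j \sum_(k0 < 1) \sum_(l < 1)
    map_mx (dual_mx (const_mx f)) v i j k0 l * a j l * Num.conj (b i k0) =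
    f (\sum_i \sum_j (a j 0 * Num.conj (b i 0)) *: v i j).
  rewrite dual_sum; apply: eq_bigr => i _; rewrite dual_sum.
  apply: eq_bigr => j _; rewrite !big_ord1 !mxE dualZ.
  by rewrite [RHS]mulrC mulrA.
apply: (le_trans (re_le_nrm _)); apply: (le_trans (fc _)).
have h := rowV (fun j => a j 0) (fun i => b i 0) v1.
apply: (le_trans (ler_wpM2l c0 h)).
under [X in _ <= _ * ((X + _) / _)]eq_bigr do rewrite big_ord1.
under [X in _ <= _ * ((_ + X) / _)]eq_bigr do rewrite big_ord1.
by apply: eq_leW; field.
Qed.

End FiniteInterpolation.

(** * Operators defined by elements of the bidual *)

Section BidualOfRepresentation.
Context (R : realType) (V : opSpaceType R) (H : hilbertType R).
Context (phi : {linear V -> bop H}) (ccphi : complete_contraction phi).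

Local Notation rowV := (@opspace_row_bounded R V).
Local Notation V0 := (@mxnorm0 R V).
Local Notation Vge0 := (@norm1_ge0 R V).
Local Notation rowV' := (dual_row_bounded rowV V0 Vge0).
Local Notation V0' := (dual_mxnorm0 rowV V0 Vge0).

Lemma dual_norm1_ge0 (f : dual V) : 0 <= norm1 f.
Proof. exact: (dual_mxnorm_ge0 rowV V0 Vge0). Qed.

Lemma tail_weight_ge0 (w : normal_index H) n : 0 <= tail_weight w n.
Proof.
rewrite subr_ge0.
exact: nondecreasing_cvgn_le (weight_nondecreasing w) (@weight_cvg _ _ w) n.
Qed.

Lemma phi_norm1 v : norm1 (phi v) <= norm1 v.
Proof. exact: complete_contraction_norm1. Qed.

Lemma nrm_vec v x y :
  nrm (inner (phi v x) y : R[i]^o) <= nrm x * nrm y * norm1 v.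
Proof.
apply: (le_trans (inner_CS _ _)); rewrite [leRHS]mulrC mulrA.
apply: ler_wpM2r; first exact: nrm_ge0.
apply: (le_trans (bop_nrm_le _ _)); apply: ler_wpM2r; first exact: nrm_ge0.
exact: phi_norm1.
Qed.

Lemma vec_exists x y : exists f : dual V, forall v, f v = inner (phi v x) y.
Proof.
have [|f fE] := @dual_of_fun R V (fun v => inner (phi v x) y) (nrm x * nrm y)
  _ (fun v => nrm_vec v x y).
  by move=> a v w; rewrite linearP bopDl bopZl innerDl innerZl.
by exists f.
Qed.

Definition vec x y : dual V := sval (cid (vec_exists x y)).

Lemma vecE x y v : vec x y v = inner (phi v x) y.
Proof. exact: (svalP (cid (vec_exists x y)) v). Qed.

Lemma norm1_vec x y : norm1 (vec x y) <= 2 * (nrm x * nrm y).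
Proof.
apply: (dual_norm1_le rowV V0 Vge0).
  by apply: mulr_ge0; exact: nrm_ge0.
by move=> v; rewrite vecE; exact: nrm_vec.
Qed.

Lemma nf_exists w : exists f : dual V, forall v, f v = normal_functional (phi v) w.
Proof.
have [| |f fE] := @dual_of_fun R V (fun v => normal_functional (phi v) w)
  (tail_weight w 0).
- by move=> a v v'; rewrite linearP; exact: normal_functional_linear.
- move=> v; have := normal_tail (phi v) w 0.
  rewrite {1}/normal_partial big_geq// subr0 => h; apply: (le_trans h).
  rewrite mulrC; apply: ler_wpM2l; [exact: tail_weight_ge0|exact: phi_norm1].
by exists f.
Qed.

Definition nf w : dual V := sval (cid (nf_exists w)).

Lemma nfE w v : nf w v = normal_functional (phi v) w.
Proof. exact: (svalP (cid (nf_exists w)) v). Qed.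

Definition nf_partial w n : dual V := \sum_(0 <= k < n) vec (wx w k) (wy w k).

Lemma nf_partialE w n v : nf_partial w n v = normal_partial (phi v) w n.
Proof.
rewrite /nf_partial (big_morph (fun f : dual V => f v) (id1 := 0) (op1 := +%R))//.
by apply: eq_bigr => k _; rewrite vecE.
Qed.

Lemma norm1_nf_tail w n : norm1 (nf w - nf_partial w n) <= 2 * tail_weight w n.
Proof.
apply: (dual_norm1_le rowV V0 Vge0); first exact: tail_weight_ge0.
move=> v; have -> : (nf w - nf_partial w n) v =
    normal_functional (phi v) w - normal_partial (phi v) w n.
  by rewrite -nfE -nf_partialE.
apply: (le_trans (normal_tail _ _ _)); rewrite mulrC.
apply: ler_wpM2l; [exact: tail_weight_ge0|exact: phi_norm1].
Qed.

(** The identity holds for vector functionals by hypothesis, hence for their finite sums; [nf w] is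
    a norm limit of such sums and [xi] is bounded. *)
Lemma normal_functional_bidual (xi : dual (dual V)) (T : bop H) w :
  (forall x y, inner (T x) y = xi (vec x y)) -> normal_functional T w = xi (nf w).
Proof.
move=> TE; apply: normal_functional_eq.
have [c hc] := dual_bounded xi.
have E n : normal_partial T w n = xi (nf_partial w n).
  by rewrite /nf_partial dual_sum; apply: eq_bigr => k _; exact: TE.
apply/cvgC_nrmP => e e0.
(* The 2 is the factor of [dual_norm1_le]; adding 1 to the bound of [xi] keeps the denominator
   positive. *)
have d0 : 0 < e / (2 * (`|c| + 1)).
  by apply: divr_gt0 => //; apply: mulr_gt0 => //; apply: ltr_wpDl.
have /cvgrPdist_lt/(_ _ d0) := @tail_weight_cvg R H w.
apply: filterS => n; rewrite sub0r normrN ger0_norm ?tail_weight_ge0// => h.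
rewrite E.
have -> : xi (nf w) - xi (nf_partial w n) = xi (nf w - nf_partial w n).
  by rewrite dualD -(scaleN1r (nf_partial w n)) dualZ mulN1r.
apply: (le_lt_trans (hc _)).
have t0 := norm1_nf_tail w n; have c1 := ler_norm c.
apply: (@le_lt_trans _ _ ((`|c| + 1) * (2 * tail_weight w n))).
  have n0 := dual_norm1_ge0 (nf w - nf_partial w n).
  apply: (le_trans (ler_wpM2r n0 c1)); apply: ler_pM => //.
  by rewrite lerDl.
have p : 0 < `|c| + 1 by apply: ltr_wpDl.
move: h; rewrite ltr_pdivlMr; last by apply: mulr_gt0.
apply: le_lt_trans; apply: eq_leW; ring.
Qed.

Lemma bidual_op_exists (xi : dual (dual V)) :
  exists T : bop H, forall x y, inner (T x) y = xi (vec x y).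
Proof.
have [c hc] := dual_bounded xi.
have [| | |T TE] := @bop_of_form R H (fun x y => xi (vec x y)) (2 * `|c|).
- move=> a x x' y; rewrite -dualZ -dualD; congr (xi _); apply: dual_ext => v.
  by rewrite dualDl dualZl !vecE bopDr bopZr innerDl innerZl.
- move=> a x y y'; rewrite -dualZ -dualD; congr (xi _); apply: dual_ext => v.
  by rewrite dualDl dualZl !vecE innerDr innerZr.
- move=> x y; apply: (le_trans (hc _)).
  apply: (le_trans (ler_wpM2r (dual_norm1_ge0 _) (ler_norm c))).
  apply: (le_trans (ler_wpM2l (normr_ge0 c) (norm1_vec x y))).
  by apply: eq_leW; ring.
by exists T.
Qed.

Definition bidual_op xi : bop H := sval (cid (bidual_op_exists xi)).

Lemma bidual_opE xi x y : inner (bidual_op xi x) y = xi (vec x y) :> R[i].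
Proof. exact: (svalP (cid (bidual_op_exists xi)) x y). Qed.

Lemma bidual_op_linear : linear bidual_op.
Proof.
move=> a xi zeta; apply: bop_ext => x; apply: inner_inj => y.
by rewrite bopDl bopZl innerDl innerZl !bidual_opE.
Qed.

HB.instance Definition _ := GRing.isLinear.Build R[i] (dual (dual V)) (bop H) *:%R
  bidual_op bidual_op_linear.

Lemma bidual_op_closure xi : weak_star_closure (range phi) (bidual_op xi).
Proof.
apply: weak_star_closure_exact => s.
have [v vs] := @dual_interpolation R V (map nf s) xi (dualP xi).
exists (phi v); first by exists v.
move=> w ws; rewrite -nfE vs; last exact: List.in_map.
by rewrite (@normal_functional_bidual xi)//; exact: bidual_opE.
Qed.

(** The compression of [T] to [e] is, up to the shuffle, [xi] paired with the matrix of the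
    functionals [vec (e l) (e k)]. That matrix is a compression of [phi], hence a contraction over
    the dual. *)
Lemma mxnorm_le_bidual n (T : 'M[bop H]_n) (xi : 'M[dual (dual V)]_n) :
  (forall i j x y, inner (T i j x) y = xi i j (vec x y)) -> mxnorm T <= mxnorm xi.
Proof.
move=> TE; have xi0 := dual_mxnorm_ge0 rowV' V0' dual_norm1_ge0 xi.
apply: mxnorm_le_compress => // m e oe.
pose F : 'M[dual V]_m := \matrix_(k, l) vec (e l) (e k).
have F1 : mxnorm F <= 1.
  apply/(dual_mxnormP rowV V0 Vge0) => k v v1.
  apply: le_trans (le_trans (ccphi v) v1).
  have := mx_compress_le (map_mx phi v) oe; apply: le_trans.
  apply: eq_leW; congr mxnorm; apply/matrixP => i j; rewrite !mxE.
  by apply/matrixP => p q; rewrite !mxE vecE.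
have := (dual_mxnormP rowV' V0' dual_norm1_ge0 xi _).1 (lexx _) _ F F1.
apply: le_trans; apply: le_trans (mxnorm_flip_le _); apply: eq_leW.
congr mxnorm; apply/matrixP => i j; rewrite !mxE; apply/matrixP => k l.
by rewrite !mxE TE.
Qed.

End BidualOfRepresentation.

Lemma weak_expectation_of_WEP (R : realType) (V : opSpaceType R) (H : hilbertType R)
    (phi : {linear V -> bop H}) :
  WEP V -> complete_isometry phi -> has_weak_expectation (range phi).
Proof.
move=> [E [i [j [[isoi injE _ _] isoj ji]]]] isop.
have ccp : complete_contraction phi := fun n v => eq_leW (isop n v).
have [g ccg gphi] := injE V (bop H) phi i isop (fun n v => eq_leW (isoi n v)).
exists (bidual_op ccp \o j \o g); split.
- move=> n T; apply: le_trans (ccg n T).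
  rewrite -(isoj n (map_mx g T)).
  have h := @mxnorm_le_bidual R V H phi ccp n (map_mx (bidual_op ccp \o j \o g) T) (map_mx j (map_mx g T)).
  apply: h => p q x y; rewrite !mxE.
  exact: bidual_opE.
- by move=> T; exact: bidual_op_closure.
- move=> _ [v _ <-]; apply: bop_ext => x; apply: inner_inj => y /=.
  have -> : g (phi v) = i v by exact: gphi.
  by rewrite bidual_opE ji vecE.
Qed.

(** * From weak expectations to WEP *)

Section ClosureRelations.
Context (R : realType) (H : hilbertType R).

Lemma cvg_eventually0 (u : nat -> R) : (forall k, u k.+1 = 0) -> cvgn (series u).
Proof.
move=> u0; apply/cvg_ex; exists (u 0%N); apply: cvg_near_cst.
exists 1%N => // -[//|n] _; rewrite /series /= big_nat_recl// big1 ?addr0//.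
Qed.

Lemma l2seq_head (x : H) : l2seq (fun k => if k is 0%N then x else 0).
Proof. by apply: cvg_eventually0 => k; rewrite nrm0 expr0n. Qed.

(** The rank one element of the predual: both sequences vanish after their first term. *)
Definition vector_index (x y : H) : normal_index H :=
  exist _ (fun k => if k is 0%N then x else 0, fun k => if k is 0%N then y else 0)
    (conj (@l2seq_head x) (@l2seq_head y)).

Lemma normal_vector_index (T : bop H) x y :
  normal_functional T (vector_index x y) = inner (T x) y.
Proof.
apply: normal_functional_eq; apply: cvg_near_cst.
exists 1%N => // -[//|n] _; rewrite /normal_partial big_nat_recl// big1 ?addr0//.
by move=> k _; rewrite bop0r inner0l.
Qed.

(** Relations among matrix coefficients are weak*-closed conditions. Two terms give independence of
    the chosen representation, three give linearity. *)
Lemma closure_relation (X : set (bop H)) (T : bop H) (a b c : R[i])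
    (x y z x' y' z' : H) : weak_star_closure X T ->
  (forall S, X S -> a * inner (S x) x' + b * inner (S y) y' + c * inner (S z) z' = 0) ->
  a * inner (T x) x' + b * inner (T y) y' + c * inner (T z) z' = 0.
Proof.
move=> clT rel; apply/eqP/negPn/negP => D0.
set D := _ + _ in D0; pose nC (t : R[i]) := nrm (t : R[i]^o).
have Dp : 0 < nC D.
  by rewrite lt_def nrm_ge0 andbT; apply: contra D0 => /eqP/nrm_eq0 ->.
pose M := nC a + nC b + nC c.
have M0 : 0 <= M by rewrite !addr_ge0// nrm_ge0.
have M1 : 0 < M + 1 by rewrite ltr_wpDl.
(* The error [M] times this tolerance stays strictly below the modulus of [D], also when [M = 0]. *)
have e0 : 0 < nC D / (M + 1) by rewrite divr_gt0.
have [S XS h] := @weak_star_closure_approx R H X T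
  [:: vector_index x x'; vector_index y y'; vector_index z z'] _ e0 clT.
have hx := h (vector_index x x') (or_introl erefl).
have hy := h (vector_index y y') (or_intror (or_introl erefl)).
have hz := h (vector_index z z') (or_intror (or_intror (or_introl erefl))).
move: hx hy hz; rewrite !normal_vector_index => hx hy hz.
have DE : D = a * (inner (T x) x' - inner (S x) x') +
    b * (inner (T y) y' - inner (S y) y') + c * (inner (T z) z' - inner (S z) z').
  by rewrite -[D]subr0 -(rel S XS) /D; ring.
have : nC D <= M * (nC D / (M + 1)).
  rewrite {1}DE /nC !mulrDl.
  apply: (le_trans (nrmD _ _)); apply: lerD; last first.
    by rewrite nrmCM; apply: ler_wpM2l; [exact: nrm_ge0|exact: ltW].
  apply: (le_trans (nrmD _ _)); apply: lerD.
    by rewrite nrmCM; apply: ler_wpM2l; [exact: nrm_ge0|exact: ltW].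
  by rewrite nrmCM; apply: ler_wpM2l; [exact: nrm_ge0|exact: ltW].
rewrite mulrCA ler_pMr// leNgt => /negP; apply.
by rewrite ltr_pdivrMr// mul1r ltrDl.
Qed.

End ClosureRelations.

(** * Matrices of functionals as blocks of the universal representation *)

Section MatrixFunctionals.
Context (R : realType) (V : opSpaceType R).
Local Notation K := (l2sum R (@cc_dim R V)).

Lemma mx_mxnormZ m n (A : 'M['M[R[i]]_m]_n) (t : R) : 0 <= t ->
  mxnorm (map_mx (fun B : 'M[R[i]]_m => t%:C *: B) A) <= t * mxnorm A.
Proof.
move=> t0; have A0 := mx_mxnorm_ge0 A.
apply/mx_mxnormP; first exact: mulr_ge0.
move=> a b; have := (mx_mxnormP _ A0).1 (lexx _) a b => /(ler_wpM2l t0).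
rewrite mulrA; apply: le_trans; apply: eq_leW; rewrite -reZ; congr (re _).
do 4 (rewrite mulr_sumr; apply: eq_bigr => ? _).
by rewrite !mxE !mulrA.
Qed.

(** The dual norm tests only matrices of norm at most 1, so [v] is divided by a number slightly
    above its norm, which is positive. *)
Lemma dual_mx_cc m (F : 'M[dual V]_m) : mxnorm F <= 1 ->
  complete_contraction (dual_mx F).
Proof.
move=> F1 n v; apply/ler_addgt0Pr => e e0.
have c0 : 0 < mxnorm v + e by apply: ltr_wpDl => //; exact: mxnorm_ge0.
set c := _ + e in c0 *; have vc : mxnorm v <= c by rewrite lerDl ltW.
have := (dual_mxnormP (@opspace_row_bounded R V) (@mxnorm0 R V) (@norm1_ge0 R V)
  F 1).1 F1 _ _ (mxnormZ_le1 c0 vc) => h.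
have := mx_mxnormZ (map_mx (dual_mx F)
  (map_mx (fun u : V => (c^-1)%:C *: u) v)) (ltW c0).
move=> h'; apply: le_trans (_ : _ <= c * 1) _; last by rewrite mulr1.
apply: le_trans (ler_wpM2l (ltW c0) h); apply: le_trans h'; apply: eq_leW.
congr mxnorm; apply/matrixP => i j; rewrite [LHS]mxE [RHS]mxE [in RHS]mxE.
rewrite [in RHS]mxE linearZ scalerA -rmorphM /= divff ?scale1r//.
by rewrite gt_eqF.
Qed.

Definition coordinate (a : cc_map V) (l : 'I_(cc_dim a)) : K :=
  single (delta_mx l 0).

Lemma inner_coordinate (a : cc_map V) (l : 'I_(cc_dim a)) (x : K) :
  inner x (coordinate l) = l2fun x a l 0 :> R[i].
Proof.
have E (z : K) : re (inner z (coordinate l)) = re (l2fun z a l 0).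
  rewrite -/(rip z (coordinate l)) rip_single /cip (bigD1 l)//= big1 => [|k kl].
    by rewrite addr0 mxE !eqxx conjC1 mulr1.
  by rewrite mxE (negbTE kl) conjC0 mulr0.
apply: complex_eqP; first exact: E.
have := E ('i *: x); rewrite innerZl.
have -> : l2fun ('i *: x) a l 0 = 'i * l2fun x a l 0.
  by have := l2funP 'i x 0 a; rewrite addr0 => ->; rewrite !mxE addr0.
by case: (l2fun x a l 0) => p q; case: (inner x _ : R[i]) => p' q' /=; lra.
Qed.

Lemma coordinate_orthonormal (a : cc_map V) :
  orthonormal_family (@coordinate a).
Proof.
move=> k l; rewrite inner_coordinate /= single_funE mxE eqxx andbT.
by rewrite eq_sym.
Qed.

Definition universal_rep : {linear V -> bop K} :=
  @block_op R (cc_map V) (@cc_dim R V) \o @kappa R V.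

Lemma universal_rep_isometry : complete_isometry universal_rep.
Proof. by move=> n v; rewrite map_mx_comp; exact: (kappa_isometry v). Qed.

Lemma universal_repE (a : cc_map V) v k l :
  inner (universal_rep v (coordinate l)) (coordinate k) = cc_fun a v k l :> R[i].
Proof.
rewrite inner_coordinate block_opE /= single_funE.
by rewrite -colE mxE.
Qed.

(** [f] divided by [t] is a complete contraction into 1 by 1 matrices, hence an index of the
    universal family, and [x] is the coordinate vector of that block. A separate positive [t] covers
    functionals of norm 0. *)
Lemma functional_rep (f : dual V) (t : R) : 0 < t -> norm1 f <= t ->
  exists x : K, nrm x = 1 /\
    forall v, f v = t%:C * inner (universal_rep v x) x.
Proof.
move=> t0 ft; have s0 : 0 <= t^-1 by rewrite invr_ge0 ltW.
have tt : t^-1 * t = 1 by rewrite mulVf// gt_eqF.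
pose F : 'M[dual V]_1 := const_mx ((t^-1)%:C *: f).
have F1 : mxnorm F <= 1.
  apply/(dual_mxnormP (@opspace_row_bounded R V) (@mxnorm0 R V) (@norm1_ge0 R V)).
  move=> k v v1.
  have := (dual_mxnormP (@opspace_row_bounded R V) (@mxnorm0 R V) (@norm1_ge0 R V)
    (const_mx f : 'M[dual V]_1) t).1 ft k v v1 => h.
  have := le_trans (mx_mxnormZ (map_mx (dual_mx (const_mx f)) v) s0)
    (ler_wpM2l s0 h).
  rewrite tt; apply: le_trans; apply: eq_leW.
  congr mxnorm; apply/matrixP => i j; rewrite !mxE; apply/matrixP => p q.
  by rewrite !mxE.
pose a := cc_point (dual_mx_cc F1); exists (coordinate (ord0 : 'I_(cc_dim a))).
split.
  apply/eqP; rewrite -(eqrXn2 (n := 2)) ?nrm_ge0// expr1n -ripxx /rip.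
  by rewrite coordinate_orthonormal eqxx re_real.
move=> v; rewrite universal_repE /= !mxE dualZl mulrA -rmorphM /= divff ?mul1r//.
by rewrite gt_eqF.
Qed.

End MatrixFunctionals.

Section FromWeakExpectation.
Context (R : realType) (V : opSpaceType R).
Local Notation K := (l2sum R (@cc_dim R V)).
Local Notation phi := (@universal_rep R V).

Definition represents (f : dual V) (t : R[i]) (x y : K) :=
  forall v, f v = t * inner (phi v x) y.

Lemma represents_exists (f : dual V) :
  exists p : R[i] * K * K, represents f p.1.1 p.1.2 p.2.
Proof.
have t0 : 0 < norm1 f + 1 by rewrite ltr_wpDl// dual_norm1_ge0.
have ft : norm1 f <= norm1 f + 1 by rewrite lerDl.
have [x [_ xP]] := functional_rep t0 ft.
by exists ((norm1 f + 1)%:C, x, x).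
Qed.

Definition rep (f : dual V) : R[i] * K * K := sval (cid (represents_exists f)).

Lemma repP f : represents f (rep f).1.1 (rep f).1.2 (rep f).2.
Proof. exact: (svalP (cid (represents_exists f))). Qed.

(** The representation of [f] is an arbitrary choice; on the weak* closure of [range phi] the value
    is independent of it, by [normal_extension_eq]. *)
Definition normal_extension (T : bop K) (f : dual V) : R[i] :=
  (rep f).1.1 * inner (T (rep f).1.2) (rep f).2.

Lemma normal_extension_linearl f (a : R[i]) (S T : bop K) :
  normal_extension (a *: S + T) f =
  a * normal_extension S f + normal_extension T f.
Proof.
by rewrite /normal_extension bopDl bopZl innerDl innerZl mulrDr mulrCA.
Qed.

Lemma normal_extension_phi f v : normal_extension (phi v) f = f v.
Proof. by rewrite /normal_extension -repP. Qed.

Section InClosure.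
Context (T : bop K) (clT : weak_star_closure (range phi) T).

Lemma normal_extension_eq f t x y : represents f t x y ->
  normal_extension T f = t * inner (T x) y.
Proof.
rewrite /normal_extension; move: (rep f) (repP f) => [[s x'] y'] /= sP tP.
have := @closure_relation R K (range phi) T s (- t) 0 x' x 0 y' y 0 clT.
rewrite mul0r addr0 mulNr => /(_ _)/eqP; rewrite subr_eq0 => h.
apply/eqP; apply: h => _ [v _ <-].
by rewrite mul0r addr0 mulNr -sP -tP subrr.
Qed.

Lemma normal_extension_linear (a : R[i]) f g :
  normal_extension T (a *: f + g) = a * normal_extension T f + normal_extension T g.
Proof.
rewrite /normal_extension; move: (rep _) (@repP (a *: f + g)) => [[r x] x'] /= rP.
move: (rep f) (repP f) (rep g) (repP g) => [[s y] y'] /= sP [[t z] z'] /= tP.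
have := @closure_relation R K (range phi) T (- r) (a * s) t x y z x' y' z' clT.
move=> h; apply/eqP; rewrite -subr_eq0 -oppr_eq0; apply/eqP.
rewrite -[RHS]h => [|_ [v _ <-]]; first by rewrite opprB addrC mulrA mulNr addrA.
by rewrite mulNr -rP -mulrA -sP -tP dualDl dualZl -addrA addNr.
Qed.

(** A representation by a unit vector exists for every [t] slightly above [norm1 f], and
    independence of the representation lets the estimate use it. *)
Lemma normal_extension_bounded f :
  nrm (normal_extension T f : R[i]^o) <= norm1 T * norm1 f.
Proof.
have T0 : 0 <= norm1 T by exact: bop_mxnorm_ge0.
apply/ler_addgt0Pr => e e0.
have d0 : 0 < e / (norm1 T + 1) by rewrite divr_gt0// ltr_wpDl.
have f0 := dual_norm1_ge0 f.
set d := e / _ in d0.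
have t0 : 0 < norm1 f + d by exact: ltr_wpDl.
have ft : norm1 f <= norm1 f + d by rewrite lerDl ltW.
have [x [x1 xP]] := functional_rep t0 ft.
rewrite (normal_extension_eq xP) nrmCM nrmC_real ger0_norm ?(ltW t0)//.
have xT : nrm (inner (T x) x : R[i]^o) <= norm1 T.
  by have := le_trans (inner_CS (T x) x) (ler_wpM2r (nrm_ge0 x) (bop_nrm_le T x)); rewrite x1 !mulr1.
apply: (le_trans (ler_wpM2l (ltW t0) xT)); rewrite mulrDl mulrC lerD2l.
rewrite /d mulrAC -mulrA ler_piMr//; first exact: ltW.
by rewrite ler_pdivrMr ?mul1r ?lerDl// ltr_wpDl.
Qed.

Lemma bidual_of_closure : exists xi : dual (dual V), xi =1 normal_extension T.
Proof.
exact: (dual_of_fun normal_extension_linear normal_extension_bounded).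
Qed.

End InClosure.

Section Embedding.
Context (E : opSpaceType R) (L : {linear E -> bop K}).
Context (ccL : complete_contraction L)
  (clL : forall x, weak_star_closure (range phi) (L x)).

Definition bidual_embed (x : E) : dual (dual V) :=
  sval (cid (bidual_of_closure (@clL x))).

Lemma bidual_embedE x f : bidual_embed x f = normal_extension (L x) f.
Proof. exact: (svalP (cid (bidual_of_closure (@clL x))) f). Qed.

Lemma bidual_embed_linear : linear bidual_embed.
Proof.
move=> a x y; apply: dual_ext => f; rewrite dualDl dualZl !bidual_embedE.
by rewrite linearP normal_extension_linearl.
Qed.

HB.instance Definition _ := GRing.isLinear.Build R[i] E (dual (dual V)) *:%R
  bidual_embed bidual_embed_linear.

Local Notation rowV := (@opspace_row_bounded R V).
Local Notation V0 := (@mxnorm0 R V).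
Local Notation Vge0 := (@norm1_ge0 R V).

(** A contraction [F] over the dual is one index of the universal family, so all its entries are
    represented by coordinate vectors of one block. Pairing with [F] is then, up to the shuffle, the
    compression of [L x] to that block. *)
Lemma bidual_embed_le n (x : 'M[E]_n) :
  mxnorm (map_mx bidual_embed x) <= mxnorm x.
Proof.
apply/(dual_mxnormP (dual_row_bounded rowV V0 Vge0) (dual_mxnorm0 rowV V0 Vge0)
  (@dual_norm1_ge0 R V)) => k F F1.
pose a := cc_point (dual_mx_cc F1).
have repF p q : represents (F p q) 1 (coordinate (a := a) q) (coordinate (a := a) p).
  by move=> v; rewrite mul1r universal_repE mxE.
apply: le_trans (ccL x).
apply: le_trans (mx_compress_le (map_mx L x) (@coordinate_orthonormal R V a)).
apply: le_trans (mxnorm_flip_le _); apply: eq_leW.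
congr mxnorm; apply/matrixP => p q; rewrite [LHS]mxE [RHS]mxE.
apply/matrixP => i j; rewrite !mxE bidual_embedE.
by rewrite (normal_extension_eq (@clL _) (repF p q)) mul1r.
Qed.

(** The functional [vec y z] is represented by [y] and [z] themselves, so the embedding recovers the
    matrix coefficients of [L x] and [mxnorm_le_bidual] applies. *)
Lemma bidual_embed_isometry : complete_isometry L ->
  complete_isometry bidual_embed.
Proof.
move=> isoL n x; apply: le_anti; rewrite bidual_embed_le /=.
have ccp : complete_contraction phi := fun n v => eq_leW (universal_rep_isometry v).
rewrite -(isoL n x).
apply: (@mxnorm_le_bidual R V K phi ccp n (map_mx L x) (map_mx bidual_embed x)).
move=> i j y z; rewrite !mxE bidual_embedE.
rewrite (@normal_extension_eq _ (@clL _) _ 1 y z) ?mul1r// => v.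
by rewrite mul1r vecE.
Qed.

End Embedding.

Lemma WEP_of_weak_expectation : has_weak_expectation (range phi) -> WEP V.
Proof.
move=> [P [ccP clP Pphi]].
have [E [i [u [envi isou uK]]]] := exists_envelope (@kappa_isometry R V).
pose L : {linear E -> bop K} := P \o @block_op R (cc_map V) (@cc_dim R V) \o u.
have Li v : L (i v) = phi v by rewrite /L /= uK Pphi//; exists v.
have ccL : complete_contraction L.
  move=> n x; rewrite -[leRHS](isou n x).
  rewrite (_ : map_mx L x = map_mx P (map_mx (@block_op R (cc_map V) (@cc_dim R V)) (map_mx u x))).
    exact: ccP.
  by apply/matrixP => p q; rewrite !mxE.
have clL x : weak_star_closure (range phi) (L x) by exact: clP.
have isoL : complete_isometry L.
  have [_ _ _ ess] := envi; apply: ess; first exact: ccL.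
  move=> n v; rewrite (_ : map_mx (L \o i) v = map_mx phi v).
    exact: universal_rep_isometry.
  by apply/matrixP => p q; rewrite [LHS]mxE [RHS]mxE; exact: Li.
exists E, i, (bidual_embed clL); split.
- exact: envi.
- exact: bidual_embed_isometry.
- by move=> v f; rewrite bidual_embedE Li normal_extension_phi.
Qed.

End FromWeakExpectation.

Theorem proposition1p2 (R : realType) (V : opSpaceType R) :
  WEP V <->
  (forall (H : hilbertType R) (phi : {linear V -> bop H}),
     complete_isometry phi -> has_weak_expectation (range phi)).
Proof.
split=> [wep H phi|h]; first exact: weak_expectation_of_WEP.
by apply: WEP_of_weak_expectation; apply: h; exact: universal_rep_isometry.
Qed.
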